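(* Let $D=(V(D),E(D),w)$ be a weighted oriented chordal graph, i.e. a weighted oriented graph whose underlying simple graph $G$ is chordal. Then the following statements are equivalent: (1) $I(D)$ is componentwise linear; (2) $I(D)$ is vertex splittable; (3) $I(D)$ has the linear quotient property.
   Context: A weighted oriented graph $D=(V(D),E(D),w)$ consists of a finite vertex set $V(D)=\{x_1,\dots,x_n\}$, a set $E(D)$ of directed edges $(x,y)$ (from $x$ towards $y$) between distinct vertices, obtained by orienting each edge of a simple graph in exactly one direction, and a weight function $w:V(D)\to\{1,2,3,\dots\}$. Its underlying simple graph $G$ has $V(G)=V(D)$ and $E(G)=\{\{x,y\}: (x,y)\in E(D)\text{ or }(y,x)\in E(D)\}$. Identifying vertices with variables of $R=\mathbb{K}[x_1,\dots,x_n]$, $\mathbb{K}$ a field, the edge ideal is $I(D)=(x_ix_j^{w(x_j)} : (x_i,x_j)\in E(D))\subseteq R$. If a vertex is a source (has no incoming edge), its weight does not affect $I(D)$ and by convention is taken to be $1$. A simple graph is chordal if it has no induced cycle of length greater than three. For a homogeneous ideal $I\subseteq R$ and $d\ge 0$, $I_{\langle d\rangle}$ denotes the ideal generated by all homogeneous elements of degree $d$ in $I$. $I$ is componentwise linear if for each $d\geq 0$ the ideal $I_{\langle d\rangle}$ has a $d$-linear resolution over $R$, i.e. is zero or satisfies $\operatorname{reg}(I_{\langle d\rangle})=d$ (Castelnuovo–Mumford regularity). For a monomial ideal $I$, $\mathcal{G}(I)$ denotes its minimal set of monomial generators. $I$ has the linear quotient property if there is an ordering $u_1<\cdots<u_m$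 of $\mathcal{G}(I)$ such that the colon ideal $((u_1,\dots,u_{i-1}):u_i)$ is generated by a subset of the variables for $i=2,\dots,m$. A monomial ideal $I\subseteq\mathbb{K}[X]$ ($X$ a finite set of variables) is vertex splittable if it can be obtained by the following recursive procedure: (i) if $v$ is a monomial and $I=(v)$, or $I=(0)$, or $I$ is the whole ring, then $I$ is vertex splittable; (ii) if there are a variable $x\in X$ and vertex splittable ideals $I_1,I_2$ of $\mathbb{K}[X\setminus\{x\}]$ such that $I=xI_1+I_2$ (with $I_1, I_2$ viewed through their extensions to $\mathbb{K}[X]$), $I_2\subseteq I_1$, and $\mathcal{G}(I)$ is the disjoint union of $\mathcal{G}(xI_1)$ and $\mathcal{G}(I_2)$, then $I$ is vertex splittable. *)

(* Defs.v *)
From HB Require Import structures.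
From mathcomp Require Import all_boot all_order all_algebra.
From mathcomp Require Import mpoly.

Set Implicit Arguments.
Unset Strict Implicit.
Unset Printing Implicit Defensive.

Import GRing.Theory.
Local Open Scope ring_scope.

(** * Weighted oriented graphs *)

(* [dedge x y] is the directed edge (x, y); antisymmetry of [dedge] says that each
   edge of the underlying simple graph carries exactly one direction. *)
Record wo_graph (n : nat) := WOGraph {
  dedge : rel 'I_n;
  weight : 'I_n -> nat;
  dedge_irrefl : forall x, ~~ dedge x x;
  dedge_asym : forall x y, dedge x y -> ~~ dedge y x;
  weight_gt0 : forall x, (0 < weight x)%N;
  weight_source : forall x, (forall y, ~~ dedge y x) -> weight x = 1%N
}.

Definition underlying n (D : wo_graph n) : rel 'I_n :=
  fun x y => dedge D x y || dedge D y x.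

(* [ucycle e c]: c is a cyclic walk in e through pairwise distinct vertices. *)
Definition induced_cycle (T : finType) (e : rel T) (c : seq T) : Prop :=
  ucycle e c /\
  {in c &, forall x y, e x y -> (y == next c x) || (x == next c y)}.

Definition chordal (T : finType) (e : rel T) : Prop :=
  forall c : seq T, induced_cycle e c -> (size c <= 3)%N.

(** * Ideals of K[x_1, ..., x_n], as subsets *)

Definition mpset (K : fieldType) (n : nat) : Type := {mpoly K[n]} -> Prop.

Definition same_set (K : fieldType) n (I J : mpset K n) : Prop :=
  forall p, I p <-> J p.

Definition ideal_gen (K : fieldType) n (S : mpset K n) : mpset K n :=
  fun p => exists s : seq ({mpoly K[n]} * {mpoly K[n]}),
    (forall c, c \in s -> S c.2) /\ p = \sum_(c <- s) c.1 * c.2.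

Definition ideal_add (K : fieldType) n (I J : mpset K n) : mpset K n :=
  fun p => exists a b, [/\ I a, J b & p = a + b].

Definition ideal_mulX (K : fieldType) n (x : 'I_n) (I : mpset K n) :
    mpset K n :=
  fun p => exists2 q, I q & p = 'X_x * q.

Definition ideal_colon (K : fieldType) n (I : mpset K n) (f : {mpoly K[n]}) :
    mpset K n :=
  fun p => I (p * f).

Definition zero_ideal (K : fieldType) n : mpset K n := fun p => p = 0.
Definition unit_ideal (K : fieldType) n : mpset K n := fun _ => True.

Arguments zero_ideal K n _ : clear implicits.
Arguments unit_ideal K n _ : clear implicits.

Definition monomial_ideal (K : fieldType) n (s : seq 'X_{1..n}) : mpset K n :=
  ideal_gen (fun p => exists2 m, m \in s & p = 'X_[m]).
Arguments monomial_ideal K [n] s _.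

Definition variable_ideal (K : fieldType) n (A : {set 'I_n}) : mpset K n :=
  ideal_gen (fun p => exists2 x, x \in A & p = 'X_x).
Arguments variable_ideal K [n] A _.

Definition edge_ideal (K : fieldType) n (D : wo_graph n) : mpset K n :=
  ideal_gen (fun p => exists x y, dedge D x y /\ p = 'X_x * 'X_y ^+ weight D y).
Arguments edge_ideal K [n] D _.

(** * Componentwise linearity *)

(* A minimal graded free resolution
     ... -> F_2 -> F_1 -> F_0 -> I -> 0
   of I, where F_i is free with basis indexed by 'I_(rk i), the k-th basis
   element being of degree [deg i k]. Elements of F_i are row vectors, and the
   differential F_i.+1 -> F_i is v |-> v *m diff i. *)
Record min_graded_resolution (K : fieldType) n (I : mpset K n) := MinGradedRes {
  rk : nat -> nat;
  deg : forall i, 'I_(rk i) -> nat;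
  aug : 'cV[{mpoly K[n]}]_(rk 0);
  diff : forall i, 'M[{mpoly K[n]}]_(rk i.+1, rk i);
  aug_homog : forall k, aug k 0 \is (deg k).-homog;
  (* a nonzero entry is homogeneous of degree deg k - deg l; in particular the
     entry vanishes if deg k < deg l *)
  diff_homog : forall i k l m,
    m \in msupp (diff i k l) -> (mdeg m + deg l = deg k)%N;
  aug_image : forall p, I p <-> exists v : 'rV_(rk 0), p = (v *m aug) 0 0;
  exact0 : forall v : 'rV_(rk 0),
    v *m aug = 0 <-> exists u : 'rV_(rk 1), v = u *m diff 0;
  exactS : forall i (v : 'rV_(rk i.+1)),
    v *m diff i = 0 <-> exists u : 'rV_(rk i.+2), v = u *m diff i.+1;
  (* entries in the maximal ideal (x_1, ..., x_n) *)
  diff_minimal : forall i k l, (diff i k l)@_0%MM = 0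
}.

Definition betti (K : fieldType) n (I : mpset K n)
    (F : min_graded_resolution I) (i j : nat) : nat :=
  #|[set k : 'I_(rk F i) | deg k == j]|.

(* reg(I) = r, that is r = max {j - i | betti i j <> 0}. The Betti numbers do
   not depend on the resolution, and I = 0 has no regularity. For I <> 0 in the
   polynomial ring the maximum is nonnegative, so r may range over nat. *)
Definition has_regularity (K : fieldType) n (I : mpset K n) (r : nat) : Prop :=
  exists F : min_graded_resolution I,
    (forall i j, betti F i j <> 0%N -> (j <= r + i)%N) /\
    (exists i j, betti F i j <> 0%N /\ j = (r + i)%N).

Definition linear_resolution (K : fieldType) n (d : nat) (I : mpset K n) :
    Prop :=
  same_set I (zero_ideal K n) \/ has_regularity I d.

Definition component (K : fieldType) n (I : mpset K n) (d : nat) : mpset K n :=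
  ideal_gen (fun p => I p /\ p \is d.-homog).

Definition componentwise_linear (K : fieldType) n (I : mpset K n) : Prop :=
  forall d, linear_resolution d (component I d).

(** * Linear quotients and vertex splittability *)

(* I is a monomial ideal and s lists, without repetition, the elements of its
   minimal set G(I) of monomial generators. *)
Definition min_mon_gens (K : fieldType) n (I : mpset K n) (s : seq 'X_{1..n}) :
    Prop :=
  [/\ uniq s,
      same_set I (monomial_ideal K s) &
      forall t : seq 'X_{1..n}, {subset t <= s} ->
        same_set I (monomial_ideal K t) -> {subset s <= t}].

(* Positions are counted from 0. *)
Definition linear_quotients (K : fieldType) n (I : mpset K n) : Prop :=
  exists s : seq 'X_{1..n}, min_mon_gens I s /\
    forall i, (0 < i < size s)%N ->
      exists A : {set 'I_n},
        same_set (ideal_colon (monomial_ideal K (take i s)) 'X_[nth 0%MM s i])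
                 (variable_ideal K A).

(* Deleting the variable x from n.+1 variables leaves n variables, the i-th of
   them being the variable [lift x i] of the larger ring. *)
Definition insert_var (K : fieldType) n (x : 'I_n.+1) (p : {mpoly K[n]}) :
    {mpoly K[n.+1]} :=
  p \mPo [tuple 'X_(lift x i) | i < n].

Definition extension (K : fieldType) n (x : 'I_n.+1) (I : mpset K n) :
    mpset K n.+1 :=
  ideal_gen (fun q => exists2 p, I p & q = insert_var x p).

(* G(I) is the disjoint union of G(x I1) and G(I2): since s has no repetition,
   [perm_eq s (s1 ++ s2)] says both that the union is s and that it is
   disjoint. *)
Inductive vertex_splittable (K : fieldType) :
    forall n, mpset K n -> Prop :=
| VSmonomial n (I : mpset K n) (m : 'X_{1..n}) :
    same_set I (monomial_ideal K [:: m]) -> vertex_splittable I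
| VSzero n (I : mpset K n) :
    same_set I (zero_ideal K n) -> vertex_splittable I
| VSunit n (I : mpset K n) :
    same_set I (unit_ideal K n) -> vertex_splittable I
| VSsplit n (x : 'I_n.+1) (I : mpset K n.+1) (I1 I2 : mpset K n)
    (s s1 s2 : seq 'X_{1..n.+1}) :
    vertex_splittable I1 -> vertex_splittable I2 ->
    same_set I (ideal_add (ideal_mulX x (extension x I1)) (extension x I2)) ->
    (forall p, I2 p -> I1 p) ->
    min_mon_gens I s ->
    min_mon_gens (ideal_mulX x (extension x I1)) s1 ->
    min_mon_gens (extension x I2) s2 ->
    perm_eq s (s1 ++ s2) ->
    vertex_splittable I.

(* Main.v *)
Require Import Defs.
From mathcomp Require Import all_boot all_order all_algebra.
From mathcomp Require Import mpoly.
From mathcomp Require Import ring zify.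
From Stdlib Require ClassicalEpsilon.

(** Two of the implications hold for all ideals with monomial generators, and only the
    return from componentwise linear to vertex splittable uses the graph.

    From splittings to quotients. If I = x * I1 + I2 is a vertex splitting, the
    generators of x * I1 followed by those of I2 are in linear quotient order when
    I1 and I2 are ordered in this way: a generator of I2 lies in I1, so it meets the first
    block in the colon generator x ([lq_split]).

    Linearity is measured by Koszul homology. An ideal J generated in degree d has a
    linear resolution exactly when H_i(x; J) vanishes above internal degree i + d,
    for all i ([acyclic]). The long exact sequence of Koszul homology relates H_i of
    the syzygies with H_(i+1) of the module. Read in one direction, it allows a
    linear resolution to be built from the vanishing, one differential after the
    other ([linear_syzygies], [linear_resolution_of_acyclic]); in the other, it
    gives back the vanishing ([acyclic_of_linear_resolution]). All of this rests on the
    exactness of the Koszul complex modulo some of the variables ([koszul_exact]).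

    From quotients to linearity. Adding to (u_1, ..., u_(k-1)) a generator u_k whose
    colon ideal is generated by variables changes the component of degree d by a
    shifted truncation of the ring modulo these variables, the Koszul homology of which
    vanishes in the required degrees ([acyclic_lq]).

    From linearity to splittings. Explicit Koszul cycles in suitable multidegrees turn
    the vanishing into conditions on the edges. First homology gives a connectedness
    statement ([acyclic_cut]), which restricts pairs of generators: two disjoint edges
    are connected by a third, no vertex has two heavy out-neighbours (vertices of weight
    larger than 1), and a path of two heavy edges closes up to a triangle. Higher
    homology in squarefree multidegrees says that the graph of the light edges, which
    generate the component of degree 2, has a chordal complement ([acyclic_copath]);
    what is needed is that it contains no induced 5-cycle and no induced
    complement of a 6-cycle. A chordal graph in which disjoint edges are connected is a
    split graph, and in it these conditions produce a vertex x at which the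
    edge ideal splits ([splitting_vertex_exists]): I1 is generated by variables and at
    most one proper power of a variable, and I2 is the edge ideal of the graph without x,
    which satisfies the same conditions. *)

Set Implicit Arguments.
Unset Strict Implicit.
Unset Printing Implicit Defensive.

(** * Chordal and split graphs *)

Definition clique (T : finType) (g : rel T) (C : {set T}) :=
  [forall x in C, forall y in C, (x != y) ==> g x y].

Lemma cliqueP (T : finType) (g : rel T) (C : {set T}) :
  reflect {in C &, forall x y, x != y -> g x y} (clique g C).
Proof.
apply: (iffP idP) => [h x y xC yC|h].
  by move/forall_inP: h => /(_ x xC)/forall_inP/(_ y yC)/implyP.
by apply/forall_inP=> x xC; apply/forall_inP=> y yC; apply/implyP; apply: h.
Qed.

(** The theorem of Foldes and Hammer. Among the largest cliques, K has the largest
    sum of degrees. If x y were an edge outside K, the three excluded patterns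
    would leave x a single non-neighbour z in K, also missed by y. Exchanging z
    for x keeps the size, so z has a neighbour v that x misses; then
    x y v and the rest of K force a clique K - z + x + y, which is too large. *)
Lemma split_partition (T : finType) (g : rel T)
    (gC : ssrbool.symmetric g) (girr : irreflexive g)
    (no_2K2 : forall a b c d, g a b -> g c d ->
       [&& a != c, a != d, b != c & b != d] ->
       [|| g a c, g a d, g b c | g b d])
    (no_C4 : forall a b c d, g a b -> g b c -> g c d -> g d a ->
       a != c -> b != d -> g a c || g b d)
    (no_C5 : forall a b c d f, g a b -> g b c -> g c d -> g d f -> g f a ->
       ~~ [|| g a c, g a d, g b d, g b f | g c f]-> False) :
  exists K : {set T}, [/\ clique g K,
    forall C, clique g C -> #|C| <= #|K| &
    forall x y, x \notin K -> y \notin K -> ~~ g x y].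
Proof.
pose deg x := #|[set y | g x y]|.
(* no sum of degrees exceeds |T|^2, so [wt] compares sizes before degree sums *)
pose wt (C : {set T}) := #|C| * (#|T| * #|T|).+1 + \sum_(x in C) deg x.
have cl0 : clique g set0 by apply/cliqueP=> x y; rewrite inE.
case: (@arg_maxnP _ set0 (clique g) wt cl0) => K clK maxK.
have degs (C : {set T}) : \sum_(x in C) deg x <= #|T| * #|T|.
  apply: (@leq_trans (\sum_(x in C) #|T|)); last by rewrite sum_nat_const leq_mul2r max_card orbT.
  by apply: leq_sum => x _; apply: max_card.
have max_size C : clique g C -> #|C| <= #|K|.
  move=> clC; rewrite leqNgt; apply/negP=> lt; have /= := maxK C clC.
  rewrite leqNgt => /negP; apply; rewrite /wt.
  apply: (@leq_trans ((#|K|.+1) * (#|T| * #|T|).+1)).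
    by rewrite mulSn addnC ltn_add2r ltnS degs.
  by rewrite -[X in X <= _]addn0 leq_add // leq_mul2r lt orbT.
have clK' := elimT (cliqueP _ _) clK.
exists K; split=> // x y xK yK; apply/negP=> gxy.
have neq u v : u \in K -> v \notin K -> u != v.
  by move=> uK; apply: contraNneq => <-.
wlog [[z zK ygz] h] : x y xK yK gxy /
    (exists2 z, z \in K & ~~ g x z) /\ [forall u in K, ~~ g x u ==> ~~ g y u].
  move=> W.
  have ext v : v \notin K -> exists2 u, u \in K & ~~ g v u.
    move=> vK; apply/exists_inP; rewrite -negb_forall_in; apply/negP=> /forall_inP h.
    have /max_size : clique g (v |: K).
      apply/cliqueP=> p q /setU1P[->|pK] /setU1P[->|qK] pq.
      - by rewrite eqxx in pq.
      - exact: h.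
      - by rewrite gC; apply: h.
      - exact: clK'.
    by rewrite cardsU1 vK add1n ltnn.
  case: (boolP [forall u in K, ~~ g x u ==> ~~ g y u]) => [h|].
    have [z zK gz] := ext x xK.
    by apply: (W x y) => //; split=> //; exists z.
  rewrite negb_forall_in => /exists_inP[u uK]; rewrite negb_imply negbK => /andP[xu yu].
  case: (boolP [forall v in K, ~~ g y v ==> ~~ g x v]) => [h|].
    have [z zK gz] := ext y yK.
    apply: (W y x) => //; first by rewrite gC.
    by split=> //; exists z.
  rewrite negb_forall_in => /exists_inP[v vK]; rewrite negb_imply negbK => /andP[yv xv].
  have uv : u != v by apply: contraNneq xu => ->.
  have nxv : x != v by rewrite eq_sym; apply: neq vK xK.
  have nyu : y != u by rewrite eq_sym; apply: neq uK yK.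
  have nxu : x != u by rewrite eq_sym; apply: neq uK xK.
  have nyv : y != v by rewrite eq_sym; apply: neq vK yK.
  have := no_C4 x y u v gxy yu (clK' _ _ uK vK uv).
  by rewrite [g v x]gC (negPf xu) (negPf yv) => /(_ xv nxu nyv).
have gyz : ~~ g y z by have /implyP := forall_inP h z zK; apply.
have nxz : x != z by rewrite eq_sym; apply: neq zK xK.
have nyz : y != z by rewrite eq_sym; apply: neq zK yK.
have nxy : x != y by apply: contraTneq gxy => ->; rewrite girr.
have gx u : u \in K -> u != z -> g x u.
  move=> uK uz; apply/negPn/negP=> xu.
  have yu : ~~ g y u by have /implyP := forall_inP h u uK; apply.
  have xu' : x != u by rewrite eq_sym; apply: neq uK xK.
  have yu' : y != u by rewrite eq_sym; apply: neq uK yK.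
  have := no_2K2 x y u z gxy (clK' _ _ uK zK uz).
  by rewrite (negPf xu) (negPf ygz) (negPf yu) (negPf gyz) xu' nxz yu' nyz => /(_ isT).
have [v gzv xv] : exists2 v, g z v & ~~ g x v.
  apply/exists_inP; apply: contraT; rewrite negb_exists_in => /forall_inP sub.
  have clx : clique g (x |: K :\ z).
    apply/cliqueP=> p q /setU1P[->|/setD1P[pz pK]] /setU1P[->|/setD1P[qz qK]] pq.
    - by rewrite eqxx in pq.
    - exact: gx.
    - by rewrite gC; apply: gx.
    - exact: clK'.
  have xKz : x \notin K :\ z by rewrite inE (negPf xK) andbF.
  have := maxK _ clx; rewrite /wt cardsU1 xKz big_setU1 //=.
  rewrite [#|K|](cardsD1 z) zK (big_setD1 (A := K) z zK) /=.
  rewrite leq_add2l leq_add2r leqNgt => /negP[]; apply/proper_card/properP; split.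
    by apply/subsetP=> v; rewrite !inE => /sub; rewrite negbK.
  by exists y; rewrite inE // gC.
have vz : v != z by apply: contraTneq gzv => ->; rewrite girr.
have vx : v != x by apply: contraNneq ygz => <-; rewrite gC.
have vK : v \notin K by apply: contra xv => vK; apply: gx.
have nyv : y != v by apply: contraTneq gzv => <-; rewrite gC.
have gyv : g y v.
  have := no_2K2 x y z v gxy gzv.
  rewrite nxz nyz eq_sym vx nyv => /(_ isT).
  by rewrite (negPf ygz) (negPf xv) (negPf gyz).
have gy u : u \in K -> u != z -> g y u.
  move=> uK uz; apply/negPn/negP=> yu.
  have xu := gx u uK uz; have zu := clK' _ _ zK uK; rewrite eq_sym uz in zu; have {}zu := zu isT.
  case: (boolP (g v u)) => vu.
    have yu' : y != u by rewrite eq_sym; apply: neq uK yK.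
    have := no_C4 x y v u gxy gyv vu; rewrite [g u x]gC eq_sym => /(_ xu vx yu').
    by rewrite (negPf xv) (negPf yu).
  apply: (no_C5 x y v z u gxy gyv); rewrite ?[g v z]gC ?[g u x]gC //.
  by rewrite (negPf xv) (negPf ygz) (negPf gyz) (negPf yu) (negPf vu).
have : clique g (x |: (y |: K :\ z)).
  apply/cliqueP=> p q.
  move=> /setU1P[->|/setU1P[->|/setD1P[pz pK]]] /setU1P[->|/setU1P[->|/setD1P[qz qK]]] pq;
    rewrite ?eqxx // in pq *; try by [apply: gx|apply: gy|rewrite gC; apply: gx|rewrite gC;
      apply: gy].
  - by rewrite gC.
  - exact: clK'.
move/max_size; rewrite !cardsU1 !inE (negPf nxy) (negPf xK) (negPf yK) !andbF /=.
by rewrite [#|K|](cardsD1 z) zK ltnn.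
Qed.

Section Chordal.
Context (T : finType) (g : rel T).
Hypotheses (gC : ssrbool.symmetric g) (girr : irreflexive g) (chg : chordal g).

Lemma chordal_C4 a b c d : g a b -> g b c -> g c d -> g d a ->
  a != c -> b != d -> g a c || g b d.
Proof.
move=> ab bc cd da ac bd; apply/negPn/negP => /norP[nac nbd].
have gne x y : g x y -> x != y by apply: contraTneq => ->; rewrite girr.
have nab := gne _ _ ab; have nbc := gne _ _ bc; have ncd := gne _ _ cd; have nda := gne _ _ da.
suff /chg : induced_cycle g [:: a; b; c; d] by [].
split; first by rewrite /ucycle /= ab bc cd da !inE !negb_or nab ac nbc bd ncd eq_sym nda.
have E := (negPf nab, negPf nbc, negPf ncd, negPf nda, negPf ac, negPf bd).
move=> x y; rewrite !inE => /or4P[]/eqP-> /or4P[]/eqP->;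
  rewrite /= ?girr ?(negPf nac) ?(negPf nbd) ?[g c a]gC ?[g d b]gC ?(negPf nac)
    ?(negPf nbd) //= => _;
  rewrite ?eqxx ?E ?[b == a]eq_sym ?[c == b]eq_sym ?[d == c]eq_sym ?[a == d]eq_sym
    ?[c == a]eq_sym ?[d == b]eq_sym ?E ?eqxx ?orbT //.
Qed.

Lemma chordal_C5 a b c d f : g a b -> g b c -> g c d -> g d f -> g f a ->
  ~~ [|| g a c, g a d, g b d, g b f | g c f] -> False.
Proof.
move=> ab bc cd df fa /norP[ac /norP[ad /norP[bd /norP[bf cf]]]].
have gne x y : g x y -> x != y by apply: contraTneq => ->; rewrite girr.
have nab := gne _ _ ab; have nbc := gne _ _ bc; have ncd := gne _ _ cd.
have ndf := gne _ _ df; have nfa := gne _ _ fa.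
have nac : a != c by apply: contraNneq ad => ->.
have nad : a != d by apply: contraNneq ac => ->; rewrite gC.
have nbd : b != d by apply: contraNneq ad => <-.
have nbf : b != f by apply: contraNneq bd => ->; rewrite gC.
have ncf : c != f by apply: contraNneq bf => <-.
suff /chg : induced_cycle g [:: a; b; c; d; f] by [].
split.
  rewrite /ucycle /= ab bc cd df fa !inE !negb_or nab nac nad nbc nbd nbf ncd ncf ndf.
  by rewrite eq_sym nfa.
have E := (negPf nab, negPf nbc, negPf ncd, negPf ndf, negPf nfa, negPf nac, negPf nad,
  negPf nbd, negPf nbf, negPf ncf).
have G := (negPf ac, negPf ad, negPf bd, negPf bf, negPf cf).
have sub x y : g x y -> x \in [:: a; b; c; d; f] -> y \in [:: a; b; c; d; f] ->
    [|| (x, y) == (a, b), (x, y) == (b, c), (x, y) == (c, d), (x, y) == (d, f)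
      | (x, y) == (f, a)] ||
    [|| (y, x) == (a, b), (y, x) == (b, c), (y, x) == (c, d), (y, x) == (d, f)
      | (y, x) == (f, a)].
  rewrite !inE => gxy /or4P[|||/orP[]]/eqP Ex /or4P[|||/orP[]]/eqP Ey; subst x y;
    rewrite ?eqxx ?orbT //;
    by move: gxy; rewrite ?girr ?G // gC ?G.
move=> x y xc yc gxy.
have n1 : next [:: a; b; c; d; f] a = b by rewrite /= eqxx.
have n2 : next [:: a; b; c; d; f] b = c by rewrite /= [b == a]eq_sym E eqxx.
have n3 : next [:: a; b; c; d; f] c = d by rewrite /= [c == a]eq_sym [c == b]eq_sym !E eqxx.
have n4 : next [:: a; b; c; d; f] d = f.
  by rewrite /= [d == a]eq_sym [d == b]eq_sym [d == c]eq_sym !E eqxx.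
have n5 : next [:: a; b; c; d; f] f = a.
  by rewrite /= !E [f == b]eq_sym [f == c]eq_sym [f == d]eq_sym !E eqxx.
case/orP: (sub x y gxy xc yc) => /or4P[|||/orP[]]/eqP[-> ->];
  by rewrite ?n1 ?n2 ?n3 ?n4 ?n5 eqxx ?orbT.
Qed.

End Chordal.

(** * Splitting vertices of weighted chordal graphs *)

Section Patterns.
Context (T : finType) (e : rel T) (hv : pred T).

Definition adj : rel T := fun x y => e x y || e y x.

(** Only the weight of its head enters the generator of an edge: a heavy edge
    gives x * y ^+ w with w > 1, a light one gives x * y, in which the direction
    is no longer visible. The predicate hv stands for weight larger than 1. *)
Definition light : rel T := fun x y => e x y && ~~ hv y || e y x && ~~ hv x.
Definition heavy : rel T := fun x y => e x y && hv y.

(** What linearity of the components forces on the edges. Every clause is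
    universally quantified over at most six vertices, so the whole is inherited
    by induced subgraphs. The weight of a vertex is mentioned only as that of the head
    of an edge, because in an induced subgraph a vertex of weight larger than 1 may
    have become a source. *)
Record pattern_free : Prop := PatternFree {
  pf_irr : forall x, ~~ e x x;
  pf_asym : forall x y, e x y -> ~~ e y x;
  pf_C4 : forall a b c d, adj a b -> adj b c -> adj c d -> adj d a ->
    a != c -> b != d -> adj a c || adj b d;
  pf_C5 : forall a b c d f, adj a b -> adj b c -> adj c d -> adj d f ->
    adj f a -> ~~ [|| adj a c, adj a d, adj b d, adj b f | adj c f] -> False;
  pf_2K2 : forall a b c d, e a b -> e c d ->
    [&& a != c, a != d, b != c & b != d] ->
    [|| light a c, e a d, light a d, e c b, light c b | adj b d];
  pf_heavy_out : forall a b d, heavy a b -> heavy a d -> b = d;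
  pf_heavy_path : forall a b c, heavy a b -> heavy b c -> e c a && ~~ hv a;
  pf_light_C5 : forall a b c d f, light a b -> light b c -> light c d ->
    light d f -> light f a ->
    ~~ [|| light a c, light a d, light b d, light b f | light c f] -> False;
  pf_light_antiC6 : forall a b c d f g,
    light a c -> light a d -> light a f -> light b d -> light b f ->
    light b g -> light c f -> light c g -> light d g ->
    ~~ [|| light a b, light b c, light c d, light d f, light f g | light g a] ->
    False
}.

(** Splitting the edge ideal I at x as x * I1 + I2 requires exponent 1 for x in
    every generator divisible by x, hence no heavy edge into x, and requires I1 to
    contain the generator of each edge u v avoiding x. The ideal I1 is generated
    by the neighbours of x, the head of a heavy edge from x being raised to its
    weight; so a neighbour of x on u v covers this edge unless it is the tail u and
    the edge x u is heavy. *)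
Definition splitting_vertex (x : T) : Prop :=
  (forall y, ~~ heavy y x) /\
  forall u v, e u v -> u != x -> v != x ->
    [|| adj x v, e u x | e x u && ~~ hv u].

Lemma adjC : ssrbool.symmetric adj.
Proof. by move=> x y; rewrite /adj orbC. Qed.

Lemma lightC : ssrbool.symmetric light.
Proof. by move=> x y; rewrite /light orbC. Qed.

Lemma light_adj x y : light x y -> adj x y.
Proof. by rewrite /adj; case/orP=> /andP[->]; rewrite ?orbT. Qed.

End Patterns.

(** Let K be a largest clique with independent complement, and H the set of heads
    of heavy edges. The part of H in K has at most two vertices (no3), and K is
    not inside H. If no x in K outside H splits, each such x has a heavy edge to
    some a in K, and a has a light edge to a vertex b outside K not adjacent to x.
    Two different vertices a, a' arising in this way give a light 5-cycle or a
    light antihexagon, so there is one a for all x. Among the light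
    out-neighbours of a outside K, one with the most neighbours in K must then
    be a splitting vertex: an edge that it fails to cover yields another
    light 5-cycle, a third element of H in K, or a larger clique. *)
Lemma splitting_vertex_exists (T : finType) (e : rel T) (hv : pred T) :
  pattern_free e hv -> (exists x y, e x y) -> exists x, splitting_vertex e hv x.
Proof.
case=> irr asym noC4 noC5 no2K2 hout hpath noL5 noL6 [x1 [y1 e11]].
pose g := adj e; pose l := light e hv; pose h := heavy e hv.
have gC : ssrbool.symmetric g := @adjC _ _.
have lC : ssrbool.symmetric l := @lightC _ _ _.
have girr : irreflexive g by move=> x; rewrite /g /adj (negPf (irr x)).
have lg x y : l x y -> g x y := @light_adj _ _ _ x y.
have eg x y : e x y -> g x y by rewrite /g /adj => ->.
have gne x y : g x y -> x != y by apply: contraTneq => ->; rewrite girr.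
have hN x y : h x y -> ~~ l x y.
  by case/andP=> exy hy; rewrite /l /light hy exy (negPf (asym _ _ exy)).
have hNC x y : h x y -> ~~ l y x by rewrite lC; apply: hN.
have hg x y : h x y -> g x y by case/andP=> /eg.
have le x y : e x y -> ~~ hv y -> l x y by rewrite /l /light => -> ->.
have lf x y : g x y -> ~~ hv x -> ~~ hv y -> l x y.
  by rewrite /g /l /adj /light => gxy -> ->; rewrite !andbT.
have eh x y : e x y -> hv y -> h x y by rewrite /h /heavy => -> ->.
have ge x y : g x y -> ~~ h x y -> hv y -> e y x && ~~ e x y.
  rewrite /g /adj /h /heavy => /orP[] exy; last by rewrite exy (asym _ _ exy).
  by rewrite exy /= => /negPf->.
have {}no2K2 a b c d : e a b -> e c d -> [&& a != c, a != d, b != c & b != d] ->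
    [|| l a c, e a d, l a d, e c b, l c b | g b d] by apply: no2K2.
have no2K2g a b c d : g a b -> g c d -> [&& a != c, a != d, b != c & b != d] ->
    [|| g a c, g a d, g b c | g b d].
  have W a' b' c' d' : e a' b' -> e c' d' -> [&& a' != c', a' != d', b' != c' & b' != d'] ->
    [|| g a' c', g a' d', g b' c' | g b' d'].
    move=> ab cd /(no2K2 _ _ _ _ ab cd).
    case/or4P=> [/lg->//|/eg->|/lg->|/or3P[/eg|/lg|bd]]; rewrite ?orbT //.
    - by rewrite gC => ->; rewrite !orbT.
    - by rewrite gC => ->; rewrite !orbT.
    - by rewrite [g b' d']bd !orbT.
  case/orP=> ab /orP[] cd /and4P[ac ad bc bd].
  - by apply: W => //; apply/and4P.
  - have := W a b d c ab cd; rewrite ac ad bc bd => /(_ isT).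
    by case/or4P=> ->; rewrite ?orbT.
  - have := W b a c d ab cd; rewrite ac ad bc bd => /(_ isT).
    by case/or4P=> ->; rewrite ?orbT.
  - have := W b a d c ab cd; rewrite ac ad bc bd => /(_ isT).
    by case/or4P=> ->; rewrite ?orbT.
have no2K2l a b c d : e a b -> ~~ hv b -> l c d ->
    [&& a != c, a != d, b != c & b != d] -> [|| l a c, l a d, l b c | l b d].
  move=> ab hb; have W c' d' : e c' d' -> ~~ hv d' ->
      [&& a != c', a != d', b != c' & b != d'] ->
      [|| l a c', l a d', l b c' | l b d'].
    move=> cd hd /(no2K2 _ _ _ _ ab cd).
    case/or4P=> [->//|ad|->|/or3P[cb|cb|bd]]; rewrite ?orbT //.
    - by rewrite (le _ _ ad hd) orbT.
    - by rewrite [l b c']lC (le _ _ cb hb) !orbT.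
    - by rewrite [l b c']lC cb !orbT.
    - by rewrite (lf _ _ bd hb hd) !orbT.
  case/orP=> /andP[cd hd] /and4P[ac ad bc bd].
    by apply: W => //; apply/and4P.
  have := W d c cd hd; rewrite ac ad bc bd => /(_ isT).
  by case/or4P=> ->; rewrite ?orbT.
have [K [/cliqueP clK maxK indS]] := split_partition gC girr no2K2g noC4 noC5.
pose H := [set y | [exists x, h x y]].
have HP y : reflect (exists x, h x y) (y \in H).
  by rewrite inE; apply: existsP.
have inH x y : h x y -> y \in H by move=> hxy; apply/HP; exists x.
have Hhv y : y \in H -> hv y by case/HP=> x /andP[].
have eNH x y : e x y -> y \notin H -> ~~ hv y.
  by move=> exy; apply: contra => hy; apply: inH (eh _ _ exy hy).
have hKH x y : x \in K -> y \in K -> y \in H -> x != y -> ~~ h x y -> e y x.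
  move=> xK yK yH xy nh; have /andP[] // := ge x y (clK _ _ xK yK xy) nh (Hhv _ yH).
(* every vertex has at most one heavy out-neighbour, so the three would form a
   directed triangle, which the condition on heavy paths excludes *)
have no3 x y z : x \in K -> y \in K -> z \in K -> x \in H -> y \in H -> z \in H ->
    x != y -> y != z -> x != z -> False.
  have W p q r : h p q -> q \in H -> r \in H -> p \in H -> h q r -> False.
    move=> pq _ _ pH qr; have /andP[erp] := hpath _ _ _ pq qr.
    by rewrite (Hhv _ pH).
  move=> xK yK zK xH yH zH xy yz xz.
  case: (boolP (h x y)) => hxy.
    case: (boolP (h y z)) => hyz; first exact: (W x y z).
    have hzy : h z y by apply: eh (Hhv _ yH); apply: hKH.
    case: (boolP (h x z)) => hxz; first by rewrite (hout _ _ _ hxy hxz) eqxx in yz.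
    have hzx : h z x by apply: eh (Hhv _ xH); apply: hKH.
    exact: (W z x y).
  have hyx : h y x by apply: eh (Hhv _ xH); apply: hKH.
  case: (boolP (h x z)) => hxz; first exact: (W y x z).
  have hzx : h z x by apply: eh (Hhv _ xH); apply: hKH.
  case: (boolP (h y z)) => hyz; first by rewrite (hout _ _ _ hyx hyz) eqxx in xz.
  have hzy : h z y by apply: eh (Hhv _ yH); apply: hKH.
  exact: (W z y x).
pose covered x u v := [|| g x v, e u x | e x u && ~~ hv u].
pose good x := (x \notin H) && [forall u, forall v, [&& e u v, u != x & v != x]
  ==> covered x u v].
case: (pickP good) => [x /andP[xH /forallP gx]|bad].
  exists x; split.
    by move=> y; apply: contra xH => /inH.
  move=> u v uv ux vx; have /forallP/(_ v)/implyP := gx u.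
  by apply; rewrite uv ux.
exfalso.
have uncovered x : x \notin H -> exists u v, [/\ e u v, u != x, v != x & ~~ covered x u v].
  move=> xH; have := bad x; rewrite /good xH /= => /negbT.
  rewrite negb_forall => /existsP[u]; rewrite negb_forall => /existsP[v].
  by rewrite negb_imply => /andP[/and3P[uv ux vx] nc]; exists u, v.
(* a clique inside H is a single heavy edge, and the heavy edge entering its tail
   closes up to a triangle *)
have [x0 x0K x0H] : exists2 x, x \in K & x \notin H.
  apply/exists_inP; apply: contraT; rewrite negb_exists_in => /forall_inP KH.
  have {}KH x : x \in K -> x \in H by move=> xK; apply/negPn/KH.
  have cl2 : clique g [set x1; y1].
    apply/cliqueP=> x y /set2P[]-> /set2P[]->; rewrite ?eqxx // => _; last rewrite gC; exact: eg.
  have n11 := gne _ _ (eg _ _ e11).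
  have := maxK _ cl2; rewrite cards2 n11 => K2.
  have [a aK [b bK ab]] : exists2 a, a \in K & exists2 b, b \in K & h a b.
    have /card_gt1P[a [b [aK bK ab]]] : 1 < #|K| by [].
    case: (boolP (h a b)) => hab; first by exists a => //; exists b.
    exists b => //; exists a => //; apply: eh (Hhv _ (KH _ aK)).
    by apply: hKH => //; apply: KH.
  have [s sa] := HP _ (KH a aK).
  have /andP[ebs hs] := hpath _ _ _ sa ab.
  have cl3 : clique g [set s; a; b].
    have gsa := hg _ _ sa; have gab := hg _ _ ab; have gbs := eg _ _ ebs.
    apply/cliqueP=> x y; rewrite !inE => /orP[/orP[]|]/eqP-> /orP[/orP[]|]/eqP->;
      by rewrite ?eqxx // => _; rewrite // gC.
  have := maxK _ cl3; rewrite -setUA cardsU1 cards2 !inE negb_or.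
  rewrite (gne _ _ (hg _ _ sa)) eq_sym (gne _ _ (eg _ _ ebs)) (gne _ _ (hg _ _ ab)) =>
    /card_gt2P[x [y [z [[xK yK zK] [xy yz zx]]]]].
  by case: (no3 x y z); rewrite ?KH // eq_sym.
(* the uncovered edge u v must be of this form: v lies outside K, u is the head of
   a heavy edge from x, and a heavy edge u v would make v adjacent to x *)
have badK x : x \in K -> x \notin H -> exists a b,
    [/\ h x a, a \in K, e a b & [/\ ~~ hv b, b \notin K & ~~ g x b]].
  move=> xK xH; have [u [v [uv ux vx]]] := uncovered x xH.
  case/norP=> xv /norP[eux].
  have vK : v \notin K by apply: contra xv => vK; apply: clK; rewrite // eq_sym.
  have uK : u \in K by apply: contraLR (eg _ _ uv) => uK; apply: indS.
  have xu : e x u by have := clK x u xK uK; rewrite eq_sym ux /g /adj (negPf eux) orbF; apply.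
  rewrite xu /= negbK => hu; have hxu := eh _ _ xu hu.
  exists u, v; split=> //; split=> //; apply: contra xv => hv'.
  by have /andP[/eg] := hpath _ _ _ hxu (eh _ _ uv hv'); rewrite gC.
have KlN x y : x \in K -> y \in K -> x \notin H -> y \notin H -> x != y -> l x y.
  move=> xK yK xH yH /(clK _ _ xK yK); rewrite /g /adj => /orP[] exy.
    exact: le exy (eNH _ _ exy yH).
  by rewrite lC; apply: le exy (eNH _ _ exy xH).
have KhN x a a' : x \in K -> x \notin H -> a' \in K -> a' \in H -> h x a -> a != a' ->
  e a' x && l a' x.
  move=> xK xH aK aH xa aa'.
  have ea : e a' x.
    apply: hKH => //; first by apply: contraNneq xH => ->.
    by apply: contraNN aa' => /(hout _ _ _ xa) ->.
  by rewrite ea; apply: le (eNH _ _ ea xH).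
have [a [b0 [xa aK ab0 [hb0 b0K x0b]]]] := badK _ x0K x0H.
have aH := inH _ _ xa.
have C5 a1 a2 a3 a4 a5 : l a1 a2 -> l a2 a3 -> l a3 a4 -> l a4 a5 -> l a5 a1 ->
    ~~ l a1 a3 -> ~~ l a1 a4 -> ~~ l a2 a4 -> ~~ l a2 a5 -> ~~ l a3 a5 -> False.
  move=> h12 h23 h34 h45 h51 n13 n14 n24 n25 n35.
  apply: (noL5 a1 a2 a3 a4 a5) => //.
  by apply/norP; split=> //; apply/norP; split=> //; apply/norP; split=> //; apply/norP.
have gN x y : ~~ g x y -> ~~ l x y by apply: contra => /lg.
have KSne x y : x \in K -> y \notin K -> x != y by move=> xK; apply: contraNneq => <-.
case: (boolP [forall x in K :\: H, h x a]) => [/forall_inP hxa|]; last first.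
  rewrite negb_forall => /existsP[x']; rewrite negb_imply inE => /andP[/andP[x'H x'K] x'a].
  have [a' [b1 [x'a' a'K ab1 [hb1 b1K x'b1]]]] := badK _ x'K x'H.
  have a'H := inH _ _ x'a'.
  have aa' : a != a' by apply: contraNneq x'a => ->.
  have /andP[ea'x la'x] := KhN _ _ _ x0K x0H a'K a'H xa aa'.
  rewrite eq_sym in aa'.
  have /andP[eax' lax'] := KhN _ _ _ x'K x'H aK aH x'a' aa'.
  have naa' : ~~ l a a'.
    have := clK _ _ a'K aK aa'; rewrite /g /adj /l /light => /orP[] aa;
      rewrite aa (negPf (asym _ _ aa)) /= ?orbF negbK; exact: Hhv.
  have xx' : x0 != x' by apply: contraNneq x'a => <-.
  have lxx' := KlN _ _ x0K x'K x0H x'H xx'.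
  have la'b : l a' b0.
    have := no2K2l a b0 a' x0 ab0 hb0 la'x.
    rewrite [a == _]eq_sym aa' eq_sym (gne _ _ (hg _ _ xa)).
    rewrite [b0 == a']eq_sym (KSne _ _ a'K b0K) [b0 == x0]eq_sym (KSne _ _ x0K b0K) => /(_ isT).
    by rewrite (negPf naa') (negPf (hNC _ _ xa)) [l b0 x0]lC (negPf (gN _ _ x0b)) orbF /= lC.
  have lab1 : l a b1.
    have := no2K2l a' b1 a x' ab1 hb1 lax'.
    rewrite aa' eq_sym (gne _ _ (hg _ _ x'a')).
    rewrite [b1 == a]eq_sym (KSne _ _ aK b1K) [b1 == x']eq_sym (KSne _ _ x'K b1K) => /(_ isT).
    by rewrite [l a' a]lC (negPf naa') (negPf (hNC _ _ x'a')) [l b1 x']lC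
      (negPf (gN _ _ x'b1)) orbF /= lC.
  have lab0 := le _ _ ab0 hb0; have la'b1 := le _ _ ab1 hb1.
  have nbb : ~~ l b0 b1 by apply/gN/indS.
  have nxa := hN _ _ xa; have nx'a' := hN _ _ x'a'.
  have nxb := gN _ _ x0b; have nx'b := gN _ _ x'b1.
  have lx'b : l x' b0.
    apply: contraT => nx'b0; exfalso.
    by apply: (C5 x0 x' a b0 a') => //; rewrite // lC.
  have lxb1 : l x0 b1.
    apply: contraT => nx0b1; exfalso.
    by apply: (C5 x' x0 a' b1 a) => //; rewrite // lC.
  apply: (noL6 x' a' a x0 b0 b1); rewrite -/l //; try by rewrite lC.
  rewrite -/l; apply/norP; split=> //; apply/norP; split; first by rewrite lC.
  apply/norP; split; first by rewrite lC.
  by apply/norP; split=> //; apply/norP; split=> //; rewrite lC.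
have {}hxa x : x \in K -> x \notin H -> h x a by move=> xK xH; apply: hxa; rewrite inE xH.
pose B b := [&& e a b, ~~ hv b & b \notin K].
pose N b := #|[set x in K | g x b]|.
have Bb0 : B b0 by apply/and3P.
case: (@arg_maxnP _ b0 B N Bb0) => b Bb bmax.
have /and3P[ab hb bK] := Bb.
(* maximality of b, in the form of an exchange *)
have beats b' x : B b' -> x \in K -> g x b' -> ~~ g x b -> exists2 y,
  y \in K & g y b && ~~ g y b'.
  move=> Bb' xK xb' xb; apply/exists_inP; apply: contraT; rewrite negb_exists_in =>
    /forall_inP sub.
  have := bmax b' Bb'; rewrite /N /= leqNgt => /negP[]; apply/proper_card/properP; split.
    apply/subsetP=> y; rewrite !inE => /andP[yK yb]; rewrite yK.
    by have := sub y yK; rewrite yb /= negbK.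
  by exists x; rewrite inE xK //= xb'.
have lab := le _ _ ab hb.
have Bl b' : B b' -> [/\ l a b', g a b', ~~ hv b' & b' \notin K].
  by case/and3P=> ab' hb' b'K; split=> //; [apply: le | apply: eg].
have naH y : y \in K -> y \in H -> a != y -> ~~ l a y.
  move=> yK yH ay; have := clK _ _ aK yK ay; rewrite /g /adj /l /light.
  by case/orP=> ay'; rewrite ay' (negPf (asym _ _ ay')) /= ?orbF negbK Hhv.
(* the light edges y x and a b' would otherwise be disjoint and unconnected *)
have univ y b' x : y \in K -> y \in H -> a != y -> B b' -> ~~ l y b' -> x \in K -> x \notin H ->
  l x b'.
  move=> yK yH ay /and3P[ab' hb' b'K] yb xK xH.
  have /andP[eyx lyx] := KhN _ _ _ xK xH yK yH (hxa _ xK xH) ay.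
  have := no2K2l a b' y x ab' hb' lyx.
  rewrite ay eq_sym (gne _ _ (hg _ _ (hxa _ xK xH))) eq_sym (KSne _ _ yK b'K) eq_sym
    (KSne _ _ xK b'K) => /(_ isT).
  by rewrite (negPf (naH _ yK yH ay)) (negPf (hNC _ _ (hxa _ xK xH))) [l b' y]lC (negPf yb) /= lC.
have le3 y z : y \in K -> z \in K -> y \in H -> z \in H -> a != y -> a != z -> y != z -> False.
  by move=> yK zK yH zH ay az yz; apply: (no3 a y z).
have bH : b \notin H by apply: contra hb => /Hhv.
(* a vertex x of K outside H that b misses is missed by every candidate bt: else the
   maximality of b provides y adjacent to b and not to bt, and a light 5-cycle *)
have caseI bt x : B bt -> x \in K -> x \notin H -> g x bt -> ~~ g x b -> False.
  move=> Bt xK xH xbt xb; have [abt gabt hbt btK] := Bl _ Bt.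
  have [y yK /andP[yb ybt]] := beats _ _ Bt xK xbt xb.
  have lxbt : l x bt.
    by move: xbt; rewrite /g /adj => /orP[] ee; [apply: le | rewrite lC;
      apply: le (eNH _ _ ee xH)].
  have nbb : ~~ l bt b by apply/gN/indS.
  have hx := hxa _ xK xH.
  have xy : x != y by apply: contraNneq xb => ->.
  case: (boolP (y \in H)) => yH; last first.
    have lyb : l y b.
      by move: yb; rewrite /g /adj => /orP[] ee; [apply: le | rewrite lC;
        apply: le (eNH _ _ ee yH)].
    have hy := hxa _ yK yH.
    have nxb := gN _ _ xb; have nxa := hN _ _ hx.
    have nya := hN _ _ hy; have nybt := gN _ _ ybt; have lxy := KlN _ _ xK yK xH yH xy.
    by apply: (C5 x y b a bt) => //; rewrite lC.
  have ay : a != y by apply: contraNneq ybt => <-.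
  have lyb : l y b.
    by apply: contraT => nyb; case/negP: xb; apply/lg/(univ y b).
  have /andP[_ lyx] := KhN _ _ _ xK xH yK yH hx ay.
  have nay := naH _ yK yH ay.
  have nxb := gN _ _ xb; have nax := hNC _ _ hx; have nybt := gN _ _ ybt.
  by apply: (C5 y b a bt x) => //; rewrite lC.
have [u [v [uv ub vb]]] := uncovered b bH.
case/norP=> bv /norP[eub nbu].
have ua : u != a by apply: contraNneq eub => ->.
have va : v != a by apply: contraNneq bv => ->; rewrite gC eg.
have nbv : ~~ l v b by rewrite lC; apply: gN.
have nla y : e y a && ~~ hv a = false by rewrite Hhv // andbF.
have la y : l a y -> e a y && ~~ hv y by case/orP=> //; rewrite nla.
(* the disjoint edges a b and u v are connected, and edges at b cannot do it *)
have e_or : (e a u && ~~ hv u) \/ e a v.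
  have := no2K2 _ _ _ _ ab uv.
  rewrite ![a == _]eq_sym ua va ![b == _]eq_sym ub vb => /(_ isT).
  rewrite (negPf eub) (negPf bv) !orbF /=.
  case/or4P=> [/la|->|/la/andP[->]|]; [by left|by right|by right|].
  by case/orP=> /andP[eb he]; [rewrite eb in eub | rewrite eb he in nbu].
have vB : e a v -> v \notin K -> ~~ hv v -> B v by move=> av vK hv'; apply/and3P.
case: (boolP (u \in K)) => uK.
  have au : a != u by rewrite eq_sym.
  have ltu : e u v -> ~~ hv v -> l v u by move=> ? ?; rewrite lC; apply: le.
  have nKHv : e a v -> v \in K -> v \in H.
    by move=> av vK; apply: contraT => /(hxa _ vK)/andP[/asym]; rewrite av.
  case: (boolP (u \in H)) => uH; last first.
    have hu := hxa _ uK uH; have eua : e u a by case/andP: hu.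
    have av : e a v by case: e_or => // /andP[ea]; rewrite (negPf (asym _ _ ea)) in eua.
    have hvv : ~~ hv v.
      by apply: contraNN va => /(eh _ _ uv)/(hout _ _ _ hu) ->.
    have vK : v \notin K by apply: contra hvv => vK; apply/Hhv/nKHv.
    apply: (caseI v u) => //; first exact: vB.
      exact: eg.
    apply/negP=> /orP[]; first by rewrite (negPf eub).
    by move=> ebu; rewrite ebu (eNH _ _ ebu uH) in nbu.
  have av : e a v by case: e_or => // /andP[_]; rewrite Hhv.
  have vK : v \notin K.
    apply/negP=> vK; apply: (le3 u v) => //; rewrite ?nKHv // 1?eq_sym //.
    by rewrite eq_sym; apply: gne; apply: eg.
  have hvv : ~~ hv v.
    apply/negP=> hvv; have := clK _ _ aK uK au; rewrite /g /adj => /orP[] eau.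
      by have := hout _ _ _ (eh _ _ av hvv) (eh _ _ eau (Hhv _ uH)) => vu; rewrite vu in uv;
        have := irr u; rewrite uv.
    by have := hout _ _ _ (eh _ _ uv hvv) (eh _ _ eau (Hhv _ aH)) => vaE; rewrite vaE eqxx in va.
  have Bv := vB av vK hvv; have nau := naH _ uK uH au.
  case: (boolP (g u b)) => gub.
    have nlub : ~~ l u b.
      move: gub; rewrite /g /adj (negPf eub) /= => ebu.
      by apply: hNC; apply: eh => //; apply: Hhv.
    (* b is adjacent to all of K, against the maximality of K *)
    have : clique g (b |: K).
      have gbK x : x \in K -> g x b.
        move=> xK; case: (boolP (x \in H)) => xH; last by apply/lg/(univ u b).
        have [<-|ax] := eqVneq a x; first exact: eg.
        have [<- //|ux] := eqVneq u x.
        by case: (le3 u x).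
      apply/cliqueP=> p q /setU1P[->|pK] /setU1P[->|qK] pq.
      - by rewrite eqxx in pq.
      - by rewrite gC; apply: gbK.
      - exact: gbK.
      - exact: clK.
    by move/maxK; rewrite cardsU1 bK ltnn.
  have guv := eg _ _ uv.
  have [y yK /andP[yb yv]] := beats _ _ Bv uK guv gub.
  have nub := gN _ _ gub.
  have yH : y \notin H.
    apply/negP=> yH; have [ay|ay] := eqVneq a y; first by rewrite -ay eg in yv.
    have [uy|uy] := eqVneq u y; first by rewrite -uy guv in yv.
    exact: (le3 u y).
  have lyb : l y b by apply: (univ u b).
  have /andP[_ luy] := KhN _ _ _ yK yH uK uH (hxa _ yK yH) au.
  have nyv := gN _ _ yv; have nya := hN _ _ (hxa _ yK yH).
  have lav := le _ _ av hvv; have lvu := ltu uv hvv.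
  by apply: (C5 u v a b y) => //; rewrite lC.
have vK : v \in K by apply: contraLR (eg _ _ uv) => vK; apply: indS.
have gvb : ~~ g v b by rewrite gC.
case: (boolP (v \in H)) => vH; last first.
  case: e_or => [/andP[au hu]|av]; last first.
    by have /andP[/asym] := hxa _ vK vH; rewrite av.
  apply: (caseI u v) => //; last by rewrite gC; apply: eg.
  by apply/and3P.
have av : a != v by rewrite eq_sym.
have hvv := Hhv _ vH; have huv := eh _ _ uv hvv.
case: (boolP (e a u && ~~ hv u)) => [/andP[au hu]|au].
  have Bu : B u by apply/and3P.
  have nvu := hNC _ _ huv.
  have gvu : g v u by rewrite gC; apply: eg.
  have [y yK /andP[yb yu]] := beats _ _ Bu vK gvu gvb.
  case: (boolP (y \in H)) => yH; last by case/negP: yu; apply/lg/(univ v u).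
  apply: (le3 v y) => //; first by apply: contraNneq yu => <-; apply: eg.
  by apply: contraNneq yu => <-.
have {}eav : e a v by case: e_or => // ?; case/negP: au.
have [a2 [b2 [xa2 a2K ab2 [hb2 b2K x0b2]]]] := badK _ x0K x0H.
have a2E := hout _ _ _ xa2 xa; rewrite {}a2E in ab2.
have Bb2 : B b2 by apply/and3P.
have lxb : l x0 b by apply: (univ v b).
have lvb2 : l v b2.
  by apply: contraT => nvb2; case/negP: x0b2; apply/lg/(univ v b2).
have /andP[_ lvx] := KhN _ _ _ x0K x0H vK vH xa av.
have nav := naH _ vK vH av; have nbb : ~~ l b b2 by apply/gN/indS.
have nx0b2 := gN _ _ x0b2; have nxa := hN _ _ xa; have lab2 := le _ _ ab2 hb2.
by apply: (C5 v b2 a b x0) => //; rewrite lC.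
Qed.

Import GRing.Theory.
Local Open Scope ring_scope.

(** * Monomial ideals *)

Section MonomialIdeals.
Context (K : fieldType) (n : nat).
Implicit Types (p q : {mpoly K[n]}) (m u : 'X_{1..n}) (s t : seq 'X_{1..n}).

Lemma ideal_gen_in (S : mpset K n) p : S p -> ideal_gen S p.
Proof.
move=> Sp; exists [:: (1, p)]; split; last by rewrite big_seq1 mul1r.
by move=> c; rewrite inE => /eqP->.
Qed.

Lemma ideal_gen0 (S : mpset K n) : ideal_gen S 0.
Proof. by exists [::]; split=> //; rewrite big_nil. Qed.

Lemma ideal_genD (S : mpset K n) p q :
  ideal_gen S p -> ideal_gen S q -> ideal_gen S (p + q).
Proof.
case=> s [Ss ->] [t [St ->]]; exists (s ++ t); split; last by rewrite big_cat.
by move=> c; rewrite mem_cat => /orP[/Ss|/St].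
Qed.

Lemma ideal_genM (S : mpset K n) p q : ideal_gen S q -> ideal_gen S (p * q).
Proof.
case=> s [Ss ->]; exists [seq (p * c.1, c.2) | c <- s]; split.
  by move=> _ /mapP[c /Ss Sc ->].
by rewrite big_map mulr_sumr; apply: eq_bigr => c _; rewrite mulrA.
Qed.

Lemma ideal_gen_sum (S : mpset K n) (T : eqType) (r : seq T) (P : pred T) F :
  (forall i, i \in r -> P i -> ideal_gen S (F i)) ->
  ideal_gen S (\sum_(i <- r | P i) F i).
Proof.
move=> SF; rewrite big_seq_cond; elim/big_rec: _ => [|i p /andP[ir Pi] Sp].
  exact: ideal_gen0.
by apply: ideal_genD => //; apply: SF.
Qed.

Lemma ideal_gen_sub (S S' : mpset K n) p :
  (forall q, S q -> ideal_gen S' q) -> ideal_gen S p -> ideal_gen S' p.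
Proof.
move=> sub [s [Ss ->]]; apply: ideal_gen_sum => c cs _.
by apply/ideal_genM/sub/Ss.
Qed.

(** A monomial ideal consists of the polynomials supported on its monomials, so
    membership in it is a statement about exponents. *)
Definition supported (N : pred 'X_{1..n}) : mpset K n :=
  fun p => {subset msupp p <= N}.

Lemma supported_coef N p : supported N p <-> (forall m, ~~ N m -> p@_m = 0).
Proof.
split=> [Np m|Np m]; last by rewrite mcoeff_msupp; apply: contraNT => /Np ->.
by move=> Nm; apply/eqP; rewrite mcoeff_eq0; apply: contra Nm => /Np.
Qed.

Lemma supported0 N : supported N 0.
Proof. by apply/supported_coef=> m _; rewrite mcoeff0. Qed.

Lemma supportedD N p q : supported N p -> supported N q -> supported N (p + q).
Proof.
move=> /supported_coef hp /supported_coef hq; apply/supported_coef=> m Nm.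
by rewrite mcoeffD hp // hq // addr0.
Qed.

Lemma supportedN N p : supported N p -> supported N (- p).
Proof.
move=> /supported_coef hp; apply/supported_coef=> m Nm.
by rewrite mcoeffN hp // oppr0.
Qed.

Lemma supported_sum N (T : Type) (r : seq T) (P : pred T) F :
  (forall i, P i -> supported N (F i)) -> supported N (\sum_(i <- r | P i) F i).
Proof. move=> h; apply: big_ind => //; [exact: supported0|exact: supportedD]. Qed.

Lemma supportedM (N : pred 'X_{1..n}) p q :
  (forall m m', N m -> N (m' + m)%MM) -> supported N q -> supported N (p * q).
Proof.
move=> up hq m /msuppM_le /allpairsP[[m1 m2] [/= _ /hq Nm ->]]; exact: up.
Qed.

Lemma supportedX (N : pred 'X_{1..n}) m : N m -> supported N 'X_[m].
Proof. by move=> Nm m'; rewrite msuppX inE => /eqP->. Qed.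

Definition above s : pred 'X_{1..n} := fun m => has (fun u => (u <= m)%MM) s.

Lemma above_up s m m' : above s m -> above s (m' + m)%MM.
Proof.
case/hasP=> u us um; apply/hasP; exists u => //.
exact: (lepm_trans um (lem_addl _ _)).
Qed.

Lemma aboveP s m : reflect (exists2 u, u \in s & (u <= m)%MM) (above s m).
Proof. exact: hasP. Qed.

Lemma monomial_idealP s p : monomial_ideal K s p <-> supported (above s) p.
Proof.
split=> [[t [St ->]]|sp].
  rewrite big_seq; apply: supported_sum => c ct; apply: supportedM.
    exact: above_up.
  have [m ms ->] := St c ct; apply: supportedX; apply/aboveP; exists m => //.
  exact: lepm_refl.
rewrite [p]mpolyE; apply: ideal_gen_sum => m mp _.
have /aboveP[u us um] := sp m mp.
rewrite -(submK um) mpolyXD -mul_mpolyC.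
by do 2!apply: ideal_genM; apply: ideal_gen_in; exists u.
Qed.

Lemma monomial_idealX s m : monomial_ideal K s 'X_[m] <-> above s m.
Proof.
rewrite monomial_idealP; split=> [|sm]; last exact: supportedX.
by apply; rewrite msuppX inE.
Qed.

Lemma mnm_between u m d : (u <= m)%MM -> (mdeg u <= d <= mdeg m)%N ->
  exists m', [/\ (u <= m')%MM, (m' <= m)%MM & mdeg m' = d].
Proof.
move=> um /andP[ud dm]; have [k kE] : exists k, k = (d - mdeg u)%N by exists (d - mdeg u)%N.
elim: k u um ud kE => [|k IH] u um ud kE.
  exists u; split=> //; first exact: lepm_refl.
  by apply/eqP; rewrite eqn_leq ud -subn_eq0 -kE.
have lt : (mdeg u < mdeg m)%N by apply: leq_trans dm; rewrite -subn_gt0 -kE.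
have [i ui] : exists i, (u i < m i)%N.
  apply/existsP; apply: contraTT lt; rewrite negb_exists -leqNgt => /forallP h.
  by rewrite !mdegE; apply: leq_sum => i _; rewrite leqNgt.
have uim : (u + U_(i) <= m)%MM.
  apply/mnm_lepP=> j; rewrite mnmDE mnm1E; case: eqP => [<-|_]; first by rewrite addn1.
  by rewrite addn0; apply/mnm_lepP.
have degi : mdeg (u + U_(i))%MM = (mdeg u).+1 by rewrite mdegD mdeg1 addn1.
have [||m' [h1 h2 h3]] := IH _ uim.
- by rewrite degi -subn_gt0 -kE.
- by rewrite degi subnS -kE.
by exists m'; split=> //; apply: lepm_trans h1; apply: lem_addr.
Qed.

Definition comp_mon s d : pred 'X_{1..n} :=
  fun m => has (fun u => (u <= m)%MM && (mdeg u <= d)%N) s && (d <= mdeg m)%N.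

Lemma comp_monP s d m :
  reflect (exists2 u, u \in s & [&& (u <= m)%MM, (mdeg u <= d)%N & (d <= mdeg m)%N])
          (comp_mon s d m).
Proof.
apply: (iffP andP) => [[/hasP[u us /andP[um ud]] dm]|[u us /and3P[um ud dm]]].
  by exists u => //; apply/and3P.
by split=> //; apply/hasP; exists u => //; rewrite um.
Qed.

Lemma mdeg_le u m : (u <= m)%MM -> (mdeg u <= mdeg m)%N.
Proof. by move=> um; rewrite -(submK um) mdegD leq_addl. Qed.

Lemma comp_mon_le s d m m' : (m <= m')%MM -> comp_mon s d m -> comp_mon s d m'.
Proof.
move=> mm /comp_monP[u us /and3P[um ud dm]]; apply/comp_monP; exists u => //.
by rewrite (lepm_trans um mm) ud (leq_trans dm (mdeg_le mm)).
Qed.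

(** A generator of degree at most d dividing a monomial m of degree at least d can be
    multiplied up to degree d inside m; this makes the component of degree d a
    monomial ideal with the monomials [comp_mon s d]. *)
Lemma componentP (I : mpset K n) s d p : same_set I (monomial_ideal K s) ->
  component I d p <-> supported (comp_mon s d) p.
Proof.
move=> Is; split=> [[t [St ->]]|sp].
  rewrite big_seq; apply: supported_sum => c ct; apply: supportedM.
    by move=> m m'; apply: comp_mon_le; apply: lem_addl.
  have [Ic /dhomogP dc] := St c ct; move=> m mc.
  have /monomial_idealP/(_ m mc)/aboveP[u us um] := (Is _).1 Ic.
  by apply/comp_monP; exists u; rewrite // um -(dc m mc) mdeg_le /=.
rewrite [p]mpolyE; apply: ideal_gen_sum => m mp _.
have /comp_monP[u us /and3P[um ud dm]] := sp m mp.
have [|m' [um' mm' dm']] := mnm_between um (d := d); first by rewrite ud.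
rewrite -(submK mm') mpolyXD -mul_mpolyC.
do 2!apply: ideal_genM; apply: ideal_gen_in; split; last by rewrite dhomogX; apply/eqP.
by apply/Is/monomial_idealX/aboveP; exists u.
Qed.

End MonomialIdeals.

(** * The Koszul complex *)

Lemma antisym_sum0 (V : zmodType) (n : nat) (F : 'I_n -> 'I_n -> V) :
  (forall s, F s s = 0) -> (forall s t, s != t -> F s t = - F t s) ->
  \sum_s \sum_t F s t = 0.
Proof.
move=> F0 FN.
have -> : \sum_s \sum_t F s t = \sum_(s < n) \sum_(t < n | (t < s)%N) F s t
    + \sum_(s < n) \sum_(t < n | (s < t)%N) F s t.
  rewrite -big_split; apply: eq_bigr => s _ /=.
  rewrite (bigID (fun t : 'I_n => (t < s)%N)) /=; congr (_ + _).
  rewrite [LHS](bigD1 s) /= ?ltnn // F0 add0r; apply: eq_bigl => t.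
  by rewrite -leqNgt ltn_neqAle andbC eq_sym.
rewrite [X in _ + X](exchange_big_dep predT) //= -big_split big1 //= => s _.
rewrite -big_split big1 //= => t ts; rewrite [F s t]FN ?addNr //.
by apply: contraTneq ts => ->; rewrite ltnn.
Qed.

Section Koszul.
Context (K : fieldType) (n : nat).
Local Notation R := {mpoly K[n]}.
Implicit Types (p q : R) (m u : 'X_{1..n}) (A T : {set 'I_n}) (v t : 'I_n).
Implicit Types (f g : {set 'I_n} -> R).

Lemma mcoeffXM u p m :
  ('X_[u] * p)@_m = if (u <= m)%MM then p@_(m - u)%MM else 0.
Proof.
rewrite mulrC; case: ifP => um; first by rewrite -{1}(submK um) addmC mcoeffMX.
apply: memN_msupp_eq0; apply: contraFN um => /msuppM_le/allpairsP[[m1 m2] [/= _]].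
by rewrite msuppX inE => /eqP-> ->; apply: lem_addl.
Qed.

Lemma mcoeffXUM v p m :
  ('X_v * p)@_m = if (0 < m v)%N then p@_(m - U_(v))%MM else 0.
Proof. by rewrite mcoeffXM lep1mP lt0n. Qed.

(** Division by x_v of the terms divisible by x_v, the others being dropped. *)
Definition shift v p : R :=
  \sum_(m <- msupp p | (0 < m v)%N) p@_m *: 'X_[m - U_(v)].

Lemma mcoeff_shift v p m : (shift v p)@_m = p@_(m + U_(v))%MM.
Proof.
rewrite raddf_sum /=.
under eq_bigr do rewrite mcoeffZ mcoeffX.
case: (boolP ((m + U_(v))%MM \in msupp p)) => [mp|mp]; last first.
  rewrite (memN_msupp_eq0 mp) big_seq_cond big1 // => m' /andP[mp' m'v].
  case: eqP => [E|]; last by rewrite mulr0.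
  by case/negP: mp; rewrite -E submK // lep1mP -lt0n.
rewrite big_mkcond (bigD1_seq (m + U_(v))%MM) ?msupp_uniq //=.
rewrite mnmDE mnm1E eqxx addn1 /= addmK eqxx mulr1 big1 ?addr0 // => m' ne.
case: ifP => // m'v; case: eqP => [E|]; last by rewrite mulr0.
by case/eqP: ne; rewrite -E submK // lep1mP -lt0n.
Qed.

Definition drop_var v p : R := p - 'X_v * shift v p.

Lemma mcoeff_drop_var v p m :
  (drop_var v p)@_m = if (0 < m v)%N then 0 else p@_m.
Proof.
rewrite mcoeffB mcoeffXUM; case: ifP => mv; last by rewrite subr0.
by rewrite mcoeff_shift submK ?subrr // lep1mP -lt0n.
Qed.

Lemma shift0 v : shift v 0 = 0.
Proof. by apply/mpolyP=> m; rewrite mcoeff_shift !mcoeff0. Qed.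

Lemma shift_sum v (I : Type) (r : seq I) (P : pred I) F :
  shift v (\sum_(i <- r | P i) F i) = \sum_(i <- r | P i) shift v (F i).
Proof.
apply/mpolyP=> m; rewrite mcoeff_shift !raddf_sum /=.
by apply: eq_bigr => i _; rewrite mcoeff_shift.
Qed.

Lemma shiftMsign v k p : shift v ((-1) ^+ k * p) = (-1) ^+ k * shift v p.
Proof. by apply/mpolyP=> m; rewrite mcoeff_shift !raddfMsign /= mcoeff_shift. Qed.

Lemma shiftXM v p : shift v ('X_v * p) = p.
Proof.
by apply/mpolyP=> m; rewrite mcoeff_shift mcoeffXUM mnmDE mnm1E eqxx addn1 addmK.
Qed.

Lemma shiftXMC v t p : t != v -> shift v ('X_t * p) = 'X_t * shift v p.
Proof.
move=> tv; apply/mpolyP=> m; rewrite mcoeff_shift !mcoeffXUM.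
rewrite mnmDE mnm1E eq_sym (negPf tv) addn0; case: ifP => // mt.
rewrite mcoeff_shift; congr (_@__); apply/mnmP=> j; rewrite !(mnmDE, mnmBE, mnm1E).
by case: (t =P j) => [<-|_]; rewrite ?subn0 // eq_sym (negPf tv) !addn0.
Qed.

Definition rank_sign T t : nat := #|[set s in T | (s < t)%N]|.
Definition ksign T t : R := (-1) ^+ rank_sign T t.

Lemma ksignU v T t : v \notin T -> ksign (v |: T) t = (-1) ^+ (v < t)%N * ksign T t.
Proof.
move=> vT; rewrite /ksign -exprD; congr (_ ^+ _); rewrite /rank_sign.
case: ltnP => vt.
  rewrite (cardsD1 v) !inE eqxx vt /=; congr (_ + #|pred_of_set _|)%N.
  by apply/setP=> s; rewrite !inE; case: eqP => // ->; rewrite (negPf vT).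
congr #|pred_of_set _|; apply/setP=> s; rewrite !inE; case: eqP => // ->.
by rewrite (negPf vT) ltnNge vt.
Qed.

Lemma ksign_sq T t : ksign T t * ksign T t = 1.
Proof. by rewrite /ksign -exprD addnn -muln2 exprM sqrr_sign. Qed.

Lemma ksign_anti T v t : v \notin T -> t \notin T -> v != t ->
  ksign (v |: T) t * ksign (t |: T) v = - (ksign T v * ksign T t).
Proof.
move=> vT tT vt; rewrite !ksignU // mulrACA -exprD [ksign T t * _]mulrC -[RHS]mulN1r.
by congr (_ * _); case: ltngtP => // /val_inj E; rewrite E eqxx in vt.
Qed.

(** A Koszul chain f assigns to a set T of variables the coefficient f T of the
    exterior monomial e_T. All homological degrees are treated at once; a chain of
    degree i is one with [concentrated i f]. *)
Definition koszul f T : R :=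
  \sum_(t | t \notin T) ksign T t * 'X_t * f (t |: T).

Lemma eq_koszul f g T : f =1 g -> koszul f T = koszul g T.
Proof. by move=> fg; apply: eq_bigr => t _; rewrite fg. Qed.

Lemma koszulD f g T : koszul (fun T => f T + g T) T = koszul f T + koszul g T.
Proof. by rewrite -big_split; apply: eq_bigr => t _; rewrite mulrDr. Qed.

Lemma koszulN f T : koszul (fun T => - f T) T = - koszul f T.
Proof. by rewrite -sumrN; apply: eq_bigr => t _; rewrite mulrN. Qed.

Lemma koszulB f g T : koszul (fun T => f T - g T) T = koszul f T - koszul g T.
Proof. by rewrite koszulD koszulN. Qed.

Lemma koszulM p f T : koszul (fun T => p * f T) T = p * koszul f T.
Proof. by rewrite mulr_sumr; apply: eq_bigr => t _; rewrite mulrCA. Qed.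

Lemma koszul_koszul f T : koszul (koszul f) T = 0.
Proof.
pose F t s : R := if (t \notin T) && (s \notin t |: T)
  then ksign T t * 'X_t * (ksign (t |: T) s * 'X_s * f (s |: (t |: T))) else 0.
rewrite -[RHS](@antisym_sum0 _ n F).
- rewrite /koszul big_mkcond; apply: eq_bigr => t _; rewrite /F.
  case: ifP => tT; last by rewrite big1.
  by rewrite mulr_sumr big_mkcond.
- by move=> s; rewrite /F setU11 andbF.
move=> t s ts; rewrite /F !inE !negb_or [s == t]eq_sym ts /= andbC.
case: ifP => [/andP[sT tT]|]; last by rewrite oppr0.
rewrite [t |: (s |: T)]setUCA.
have E : ksign T t * ksign (t |: T) s = - (ksign T s * ksign (s |: T) t).
  have := ksign_anti tT sT ts => E.
  have -> : ksign (t |: T) s = ksign (t |: T) s * ksign (s |: T) t * ksign (s |: T) t.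
    by rewrite -mulrA ksign_sq mulr1.
  by rewrite E !mulNr mulrN -!mulrA mulrCA !mulrA ksign_sq mul1r.
transitivity (ksign T t * ksign (t |: T) s * ('X_t * 'X_s * f (s |: (t |: T)))); first by ring.
by rewrite E; ring.
Qed.

Definition contract v f T : R :=
  if v \in T then ksign (T :\ v) v * shift v (f (T :\ v)) else 0.

(** Contraction with one variable v is a homotopy between the identity and the
    projection onto the chains in which neither x_v nor e_v occurs. Treating the
    variables one by one avoids dividing by degrees, which would need
    characteristic 0. *)
Lemma koszul_homotopy v f T :
  koszul (contract v f) T + contract v (koszul f) T =
  f T - (if v \in T then 0 else drop_var v (f T)).
Proof.
case: ifP => vT; last first.
  rewrite /contract vT addr0 /koszul (bigD1 v) ?vT //= big1 ?addr0.
    rewrite setU11 setU1K ?vT // /drop_var opprB addrCA subrr addr0.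
    transitivity (ksign T v * ksign T v * ('X_v * shift v (f T))); first by ring.
    by rewrite ksign_sq mul1r.
  move=> t /andP[tT tv]; rewrite !inE vT orbF eq_sym (negPf tv).
  by rewrite mulr0.
rewrite subr0; have vT' : v \notin T :\ v by rewrite !inE eqxx.
have TE := setD1K vT; move: (T :\ v) vT' TE => S vS TE; rewrite -{}TE {T vT}.
rewrite /contract setU11 setU1K // /koszul shift_sum.
rewrite [X in _ + _ * X](bigD1 v) //= mulrDr addrCA -[RHS]addr0; congr (_ + _).
  by rewrite -mulrA shiftMsign shiftXM mulrA ksign_sq mul1r.
rewrite mulr_sumr (eq_bigl (fun t => (t \notin S) && (t != v))); last first.
  by move=> t; rewrite !inE negb_or andbC.
rewrite -big_split big1 //= => t /andP[tS tv].
rewrite !inE eqxx orbT setUCA setU1K; last by rewrite !inE negb_or eq_sym tv.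
rewrite -[ksign S t * _ * _]mulrA shiftMsign shiftXMC // -/(ksign S t).
have := ksign_anti vS tS; rewrite eq_sym => /(_ tv) E.
transitivity ((ksign (v |: S) t * ksign (t |: S) v + ksign S v * ksign S t)
   * ('X_t * shift v (f (t |: S)))); first by ring.
by rewrite E addNr mul0r.
Qed.

Definition ord_ge c : mpset K n := supported (fun m => c <= mdeg m)%N.
Definition var_ideal A : mpset K n := supported (fun m => [exists a in A, 0 < m a])%N.

Lemma supported_shift (N N' : pred 'X_{1..n}) v p :
  (forall m, N (m + U_(v))%MM -> N' m) -> supported N p -> supported N' (shift v p).
Proof.
move=> NN' /supported_coef Np; apply/supported_coef=> m N'm.
by rewrite mcoeff_shift Np //; apply: contra N'm; apply: NN'.
Qed.

Lemma supported_drop_var N v p : supported N p -> supported N (drop_var v p).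
Proof.
move=> /supported_coef Np; apply/supported_coef=> m Nm.
by rewrite mcoeff_drop_var Np // if_same.
Qed.

Lemma supported_koszul (N : pred 'X_{1..n}) f T :
  (forall m m', N m -> N (m' + m)%MM) -> (forall T, supported N (f T)) ->
  supported N (koszul f T).
Proof. by move=> up Nf; apply: supported_sum => t _; apply: supportedM. Qed.

Lemma var_ideal_up A m m' :
  [exists a in A, 0 < m a]%N -> [exists a in A, 0 < (m' + m)%MM a]%N.
Proof.
case/exists_inP=> a aA ma; apply/exists_inP; exists a => //.
by rewrite mnmDE addn_gt0 ma orbT.
Qed.

Definition concentrated i f := forall T, #|T| != i -> f T = 0.

(** Exactness of the Koszul complex of the ring modulo the variables in A, in
    positive coefficient degree or in homological degree above #|A|. Applying
    [koszul_homotopy] to each variable outside A leaves a chain whose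
    coefficients are constants modulo A and which lives on subsets of A, and such a
    chain vanishes under either assumption. For A empty this is the usual
    acyclicity of the Koszul complex. *)
Lemma koszul_exact A i c f : concentrated i f -> (forall T, ord_ge c (f T)) ->
    (forall T, var_ideal A (koszul f T)) -> (0 < c)%N || (#|A| < i)%N ->
  exists g, [/\ concentrated i.+1 g, forall T, ord_ge c.-1 (g T) &
    forall T, var_ideal A (f T - koszul g T)].
Proof.
move=> fi fc fA ci.
have upA := @var_ideal_up A.
suff H (l : seq 'I_n) : {subset l <= [predC A]} -> exists g f',
   [/\ concentrated i.+1 g, forall T, ord_ge c.-1 (g T),
     forall T, var_ideal A (f T - koszul g T - f' T) &
     [/\ concentrated i f', forall T, ord_ge c (f' T),
       forall T, var_ideal A (koszul f' T) &
       forall v, v \in l -> forall T, (v \in T -> f' T = 0) /\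
         (forall m, (0 < m v)%N -> (f' T)@_m = 0)]].
  have [|g [f' [gi gc fg [f'i f'c _ f'0]]]] := H (enum [predC A]).
    by move=> v; rewrite mem_enum.
  exists g; split=> // T; rewrite -[X in var_ideal A X](subrK (f' T)).
  apply: supportedD; first exact: fg.
  apply/supported_coef=> m Am.
  case: (boolP (T \subset A)) => [TA|/subsetPn[v vT vA]]; last first.
    have vl : v \in enum [predC A] by rewrite mem_enum.
    by rewrite ((f'0 v vl T).1 vT) mcoeff0.
  case: (boolP [exists v, (v \notin A) && (0 < m v)%N]) => [/existsP[v /andP[vA mv]]|m0].
    have vl : v \in enum [predC A] by rewrite mem_enum.
    exact: (f'0 v vl T).2.
  have {}m0 : m = 0%MM.
    apply/mnmP=> v; rewrite mnm0E; apply/eqP; rewrite -leqn0 leqNgt; apply/negP=> mv.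
    case: (boolP (v \in A)) => vA; first by case/negP: Am; apply/exists_inP; exists v.
    by case/negP: m0; apply/existsP; exists v; rewrite vA.
  case/orP: ci => [c0|Ai].
    by have /supported_coef-> := f'c T; rewrite // m0 mdeg0 -ltnNge.
  rewrite f'i ?mcoeff0 //; apply: contraTneq Ai => <-.
  by rewrite -leqNgt subset_leq_card.
elim: l => [|v l IH] lA.
  exists (fun=> 0), f; split=> //.
    by move=> T; apply: supported0.
  move=> T; rewrite [koszul _ T]big1 ?subr0 ?subrr => [|t _]; last by rewrite mulr0.
  exact: supported0.
have [|g [f' [gi gc fg [f'i f'c f'A f'0]]]] := IH.
  by move=> x xl; apply: lA; rewrite inE xl orbT.
have vA : v \notin A by apply: lA; rewrite inE eqxx.
pose f'' T := if v \in T then 0 else drop_var v (f' T).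
have cA T : var_ideal A (contract v (koszul f') T).
  rewrite /contract; case: ifP => _; last exact: supported0.
  apply: supportedM => //; apply: supported_shift (f'A _) => m.
  case/exists_inP=> a aA; rewrite mnmDE mnm1E; case: eqP => [E|_].
    by rewrite E aA in vA.
  by rewrite addn0 => ma; apply/exists_inP; exists a.
have f''E T : f' T - koszul (contract v f') T - f'' T = contract v (koszul f') T.
  by have := koszul_homotopy v f' T; rewrite -/(f'' T) => /eqP; rewrite addrC -subr_eq =>
    /eqP<-; ring.
exists (fun T => g T + contract v f' T), f''; split.
- move=> T Ti; rewrite gi // add0r /contract; case: ifP => // vT.
  rewrite f'i ?shift0 ?mulr0 //; apply: contra Ti => /eqP <-.
  by rewrite [#|T|](cardsD1 v) vT.
- move=> T; apply: supportedD; first exact: gc.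
  rewrite /contract; case: ifP => _; last exact: supported0.
  apply: supportedM => [m m'|]; first by rewrite mdegD => h; apply: leq_trans h (leq_addl _ _).
  apply: supported_shift (f'c (T :\ v)) => m /=.
  by rewrite mdegD mdeg1 addnC -subn1 leq_subLR.
- move=> T; rewrite koszulD.
  rewrite (_ : _ - _ = f T - koszul g T - f' T + (f' T - koszul (contract v f') T - f'' T));
    last by ring.
  by rewrite f''E; apply: supportedD; [apply: fg | apply: cA].
split.
- by move=> T Ti; rewrite /f'' f'i // /drop_var shift0 mulr0 subr0 if_same.
- by move=> T; rewrite /f''; case: ifP => _; [apply: supported0|apply: supported_drop_var;
    apply: f'c].
- move=> T; rewrite (eq_koszul (g := fun T =>
    f' T - koszul (contract v f') T - contract v (koszul f') T)); last first.
    by move=> S; rewrite -f''E; ring.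
  rewrite !koszulB koszul_koszul subr0; apply: supportedD; first exact: f'A.
  by apply: supportedN; apply: supported_koszul => //; apply: cA.
move=> x; rewrite inE => xvl T; split=> [xT|m mx]; rewrite /f''.
  case: ifP => // vT; case/predU1P: xvl => [E|xl]; first by rewrite -E xT in vT.
  by rewrite (f'0 x xl T).1 // /drop_var shift0 mulr0 subr0.
case: ifP => _; first by rewrite mcoeff0.
rewrite mcoeff_drop_var; case/predU1P: xvl => [<-|xl]; first by rewrite mx.
by rewrite (f'0 x xl T).2 // if_same.
Qed.

End Koszul.

(** * Koszul homology and linear resolutions *)

(** The subspace is given by an arbitrary predicate, so that the linear syzygies
    need no description by equations over K. *)
Lemma subspace_basis (K : fieldType) N (P : 'rV[K]_N -> Prop) :
  P 0 -> (forall a u v, P u -> P v -> P (a *: u + v)) ->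
  exists r (B : 'M[K]_(r, N)), row_free B /\ forall v, P v <-> (v <= B)%MS.
Proof.
move=> P0 PL.
have PB r (B : 'M[K]_(r, N)) v : (forall i, P (row i B)) -> (v <= B)%MS -> P v.
  move=> PB /submxP[u ->]; rewrite mulmx_sum_row.
  by elim/big_rec: _ => // i x _ Px; apply: PL.
suff H k : (exists r (B : 'M[K]_(r, N)), row_free B /\ forall v, P v <-> (v <= B)%MS) \/
    exists B : 'M[K]_(k, N), row_free B /\ forall i, P (row i B).
  have [//|[B [Bfree _]]] := H N.+1.
  by have := rank_leq_col B; rewrite (eqP Bfree) ltnn.
elim: k => [|k [|[B [Bfree BP]]]]; [right|by left|].
  by exists 0; split; [rewrite /row_free mxrank0 | case].
case: (Classical_Prop.classic (exists2 v, P v & ~~ (v <= B)%MS)) => [[v Pv vB]|full]; last first.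
  left; exists k, B; split=> // v; split; last exact: PB.
  by move=> Pv; apply/negPn/negP=> vB; apply: full; exists v.
right; rewrite -addn1; exists (col_mx B v); split.
  have : (B < B + v)%MS by rewrite /ltmx addsmxSl /= addsmx_sub submx_refl.
  move/rank_ltmx; rewrite (addsmxE B v) (eqP Bfree) => lt.
  by rewrite /row_free eqn_leq rank_leq_row [X in (X <= _)%N]addn1.
move=> i; case: (split_ordP i) => j ->.
  by rewrite rowKu.
by rewrite rowKd row_id.
Qed.

Section KoszulRows.
Context (K : fieldType) (n : nat).
Local Notation R := {mpoly K[n]}.
Implicit Types (p q : R) (m : 'X_{1..n}) (T : {set 'I_n}).

Lemma ord_geM a b p q : ord_ge a p -> ord_ge b q -> ord_ge (a + b) (p * q).
Proof.
move=> pa qb m /msuppM_le/allpairsP[[m1 m2] [/= /pa h1 /qb h2 ->]].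
by rewrite unfold_in mdegD; apply: leq_add.
Qed.

Lemma ord_ge_le a b p : (a <= b)%N -> ord_ge b p -> ord_ge a p.
Proof. by move=> ab pb m /pb; apply: leq_trans. Qed.

Lemma ord_ge0 p : ord_ge 0 p. Proof. by []. Qed.

Lemma homog_ord_ge c p : p \is c.-homog -> ord_ge c p.
Proof. by move=> /dhomogP h m /h <-; rewrite unfold_in. Qed.

Lemma dhomogXU i : ('X_i : R) \is 1.-homog.
Proof. by rewrite dhomogX; apply/eqP/mdeg1. Qed.

Lemma ord_ge1 p : p@_0 = 0 -> ord_ge 1 p.
Proof.
move=> p0; apply/supported_coef=> m; rewrite -leqNgt leqn0 mdeg_eq0 => /eqP->.
exact: p0.
Qed.

Lemma mcoeffM_homog c p q m : q \is c.-homog -> mdeg m = c ->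
  (p * q)@_m = p@_0 * q@_m.
Proof.
move=> qc mc; have p1 : ord_ge 1 (p - (p@_0)%:MP).
  by apply: ord_ge1; rewrite mcoeffB mcoeffC eqxx mulr1 subrr.
have := ord_geM p1 (homog_ord_ge qc) => /supported_coef/(_ m).
rewrite -leqNgt -mc leqnn => /(_ isT).
by rewrite mulrBl mcoeffB mcoeffCM => /eqP; rewrite subr_eq0 => /eqP.
Qed.

Lemma pihomogM e c p q : q \is c.-homog ->
  pihomog mdeg (e + c)%N (p * q) = pihomog mdeg e p * q.
Proof.
move=> qc; rewrite {1}[p](pihomog_partitionE (mf := mdeg) (leq_addr e.+1 (msize p))).
have ek : (e < msize p + e.+1)%N by rewrite addnS ltnS leq_addl.
rewrite mulr_suml raddf_sum (bigD1 (Ordinal ek)) //= big1 ?addr0.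
  by rewrite pihomog_dE // dhomogM // pihomogP.
move=> i ne; apply: (@pihomog_ne0 _ _ _ (i + c)%N).
  by rewrite eqn_add2r; apply: contra ne => /eqP E; apply/eqP/val_inj.
by rewrite dhomogM // pihomogP.
Qed.

Definition koszul_mx k (f : {set 'I_n} -> 'rV[R]_k) T : 'rV[R]_k :=
  \sum_(t | t \notin T) (ksign K T t * 'X_t) *: f (t |: T).

Lemma koszul_mxE k (f : {set 'I_n} -> 'rV[R]_k) T j :
  koszul_mx f T 0 j = koszul (fun T => f T 0 j) T.
Proof. by rewrite summxE; apply: eq_bigr => t _; rewrite mxE. Qed.

Lemma eq_koszul_mx k (f g : {set 'I_n} -> 'rV[R]_k) T : f =1 g -> koszul_mx f T = koszul_mx g T.
Proof. by move=> fg; apply: eq_bigr => t _; rewrite fg. Qed.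

Lemma koszul_mxB k (f g : {set 'I_n} -> 'rV[R]_k) T :
  koszul_mx (fun T => f T - g T) T = koszul_mx f T - koszul_mx g T.
Proof. by rewrite -sumrB; apply: eq_bigr => t _; rewrite scalerBr. Qed.

Lemma koszul_mx_mul k l (f : {set 'I_n} -> 'rV[R]_k) (D : 'M_(k, l)) T :
  koszul_mx (fun T => f T *m D) T = koszul_mx f T *m D.
Proof. by rewrite mulmx_suml; apply: eq_bigr => t _; rewrite scalemxAl. Qed.

Lemma koszul_mx_koszul_mx k (f : {set 'I_n} -> 'rV[R]_k) T :
  koszul_mx (koszul_mx f) T = 0.
Proof.
apply/rowP=> j; rewrite koszul_mxE mxE.
by rewrite (eq_koszul (g := koszul (fun T => f T 0 j))) ?koszul_koszul // => S;
  rewrite koszul_mxE.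
Qed.

Definition concentrated_mx k i (f : {set 'I_n} -> 'rV[R]_k) :=
  forall T, #|T| != i -> f T = 0.

Lemma concentrated_koszul_mx k i (f : {set 'I_n} -> 'rV[R]_k) :
  concentrated_mx i.+1 f -> concentrated_mx i (koszul_mx f).
Proof.
move=> fi T Ti; apply: big1 => t tT; rewrite fi ?scaler0 //.
by rewrite cardsU1 tT.
Qed.

Lemma koszul_mx0 k (f : {set 'I_n} -> 'rV[R]_k) T :
  concentrated_mx 0 f -> koszul_mx f T = 0.
Proof.
by move=> f0; apply: big1 => t tT; rewrite f0 ?scaler0 // cardsU1 tT.
Qed.

Definition ord_ge_mx k c (v : 'rV[R]_k) := forall j, ord_ge c (v 0 j).

Lemma ord_ge_koszul_mx k c (f : {set 'I_n} -> 'rV[R]_k) T :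
  (forall T, ord_ge_mx c (f T)) -> ord_ge_mx c.+1 (koszul_mx f T).
Proof.
move=> fc j; rewrite koszul_mxE; apply: supported_sum => t _.
rewrite -mulrA; apply: supportedM => [m m'|].
  by rewrite mdegD => h; apply: leq_trans h (leq_addl _ _).
rewrite -add1n; apply: ord_geM; last exact: fc.
exact/homog_ord_ge/dhomogXU.
Qed.

Lemma var_ideal0 p : var_ideal set0 p -> p = 0.
Proof.
move=> /supported_coef h; apply/mpolyP=> m; rewrite mcoeff0 h //.
by apply/exists_inP=> -[a]; rewrite inE.
Qed.

Lemma koszul_mx_exact k i c (f : {set 'I_n} -> 'rV[R]_k) :
    concentrated_mx i f -> (forall T, ord_ge_mx c (f T)) ->
    (forall T, koszul_mx f T = 0) -> (0 < c)%N || (0 < i)%N ->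
  exists g, [/\ concentrated_mx i.+1 g, forall T, ord_ge_mx c.-1 (g T) &
    forall T, f T = koszul_mx g T].
Proof.
move=> fi fc f0 ci.
have H (j : 'I_k) : exists g : {set 'I_n} -> R, [/\ concentrated i.+1 g, forall T,
  ord_ge c.-1 (g T) &
    forall T, var_ideal set0 (f T 0 j - koszul g T)].
  apply: (koszul_exact (f := fun T => f T 0 j)); last by rewrite cards0.
  - by move=> T Ti; rewrite fi // mxE.
  - by move=> T; apply: fc.
  - by move=> T; rewrite -koszul_mxE f0 mxE; apply: supported0.
have [g gP] := fin_all_exists H.
exists (fun T => \row_j g j T); split.
- by move=> T Ti; apply/rowP=> j; rewrite !mxE; have [gi _ _] := gP j; apply: gi.
- by move=> T j; rewrite mxE; have [_ gc _] := gP j; apply: gc.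
move=> T; apply/rowP=> j; rewrite koszul_mxE.
have [_ _ /(_ T)/var_ideal0/eqP] := gP j; rewrite subr_eq0 => /eqP->.
by apply: eq_koszul => S; rewrite mxE.
Qed.

Definition image_mx b a (D : 'M[R]_(b, a)) (v : 'rV[R]_a) := exists u, v = u *m D.

(** Vanishing of the Koszul homology H_i of a submodule M of a free module above
    internal degree i + c. Chains are asked to have no terms of degree c or less
    instead of being homogeneous, which spares all homogeneity side conditions. *)
Definition acyclic k i c (M : 'rV[R]_k -> Prop) := forall f : {set 'I_n} -> 'rV[R]_k,
  concentrated_mx i f -> (forall T, M (f T)) -> (forall T, ord_ge_mx c.+1 (f T)) ->
  (forall T, koszul_mx f T = 0) ->
  exists g, [/\ concentrated_mx i.+1 g, forall T, M (g T) & forall T, f T = koszul_mx g T].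

Definition homog_mx b a c (D : 'M[R]_(b, a)) := forall i j, D i j \is c.-homog.

Definition indep_rows b a (D : 'M[R]_(b, a)) :=
  forall u : 'rV[K]_b, map_mx (@mpolyC n K) u *m D = 0 -> u = 0.

Definition const_part k (v : 'rV[R]_k) : 'rV[K]_k := map_mx (mcoeff 0%MM) v.

(** The terms of degree c of u *m D only see the constant terms of u. *)
Lemma const_part_mul b a c (D : 'M[R]_(b, a)) (u : 'rV[R]_b) : homog_mx c D ->
  ord_ge_mx c.+1 (u *m D) -> map_mx (@mpolyC n K) (const_part u) *m D = 0.
Proof.
move=> Dc uD; apply/rowP=> j; rewrite !mxE; apply/mpolyP=> m; rewrite mcoeff0.
have [mc|mc] := eqVneq (mdeg m) c; last first.
  rewrite raddf_sum /= big1 // => i _; rewrite !mxE mcoeffCM.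
  by rewrite (dhomog_nemf_coeff (Dc i j) mc) mulr0.
have /supported_coef/(_ m) := uD j; rewrite -ltnNge mc ltnS leqnn => /(_ isT) <-.
rewrite mxE !raddf_sum /=; apply: eq_bigr => i _.
by rewrite !mxE mcoeffCM (mcoeffM_homog _ (Dc i j) mc).
Qed.

Lemma image_mx_lift b a c i (D : 'M[R]_(b, a)) (f : {set 'I_n} -> 'rV[R]_a) :
    homog_mx c D -> concentrated_mx i f -> (forall T, image_mx D (f T)) ->
    (forall T, ord_ge_mx c.+1 (f T)) ->
  exists u, [/\ concentrated_mx i u, forall T, ord_ge_mx 1 (u T) & forall T, f T = u T *m D].
Proof.
move=> Dc fi fD fc.
have H T : exists u, [/\ #|T| != i -> u = 0, ord_ge_mx 1 u & f T = u *m D].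
  have [u uE] := fD T; case: (boolP (#|T| == i)) => Ti; last first.
    exists 0; split=> //; last by rewrite mul0mx fi.
    by move=> j; rewrite mxE; apply: supported0.
  exists (u - map_mx (@mpolyC n K) (const_part u)); split=> //.
    by move=> j; apply: ord_ge1; rewrite !mxE mcoeffB mcoeffC eqxx mulr1 subrr.
  by rewrite mulmxBl (const_part_mul Dc) ?subr0 // -uE.
have [u uP] := fin_all_exists H.
by exists u; split=> T; have [] := uP T.
Qed.

Lemma acyclic_image0 b a c (D : 'M[R]_(b, a)) : homog_mx c D -> acyclic 0 c (image_mx D).
Proof.
move=> Dc f f0 fD fc _; have [u [u0 u1 uE]] := image_mx_lift Dc f0 fD fc.
have [|h [hi _ hE]] := koszul_mx_exact u0 u1 (fun T => koszul_mx0 T u0); first by [].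
exists (fun T => h T *m D); split=> [T Ti|T|T].
- by rewrite hi // mul0mx.
- by exists (h T).
- by rewrite koszul_mx_mul -hE.
Qed.

(** One step of the long exact sequence of Koszul homology for the syzygies of D:
    the homology of the free module in the middle is zero, so H_i.+1 of the image
    is controlled by H_i of the syzygies, whose generators have degree 1. *)
Lemma acyclic_imageS b' b a c i (D : 'M[R]_(b, a)) (D' : 'M[R]_(b', b)) :
    homog_mx c D -> (forall v, v *m D = 0 <-> image_mx D' v) ->
    acyclic i 1 (image_mx D') -> acyclic i.+1 c (image_mx D).
Proof.
move=> Dc ex ac f fi fD fc f0; have [u [ui u1 uE]] := image_mx_lift Dc fi fD fc.
have [|||g [gi gD gE]] := ac (koszul_mx u) (concentrated_koszul_mx ui).
- move=> T; apply/ex; rewrite -koszul_mx_mul -[RHS](f0 T).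
  by apply: eq_koszul_mx => S; rewrite uE.
- by move=> T; apply: ord_ge_koszul_mx.
- by move=> T; apply: koszul_mx_koszul_mx.
have [||||h [hi _ hE]] := @koszul_mx_exact _ i.+1 0 (fun T => u T - g T).
- by move=> T Ti; rewrite ui // gi // subrr.
- by move=> T j; apply: ord_ge0.
- by move=> T; rewrite koszul_mxB -gE subrr.
- by [].
exists (fun T => h T *m D); split=> [T Ti|T|T].
- by rewrite hi // mul0mx.
- by exists (h T).
rewrite koszul_mx_mul -hE mulmxBl -uE.
by have /ex-> := gD T; rewrite subr0.
Qed.

(** The same long exact sequence read in the other direction. *)
Lemma acyclic_syzygies b a c (D : 'M[R]_(b, a)) : homog_mx c D ->
  (forall i, acyclic i c (image_mx D)) ->
  forall i, acyclic i 1 (fun v => v *m D = 0).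
Proof.
move=> Dc ac i f fi fD f2 f0.
have [|u [ui u1 uE]] := koszul_mx_exact fi f2 f0; first by [].
have ucyc T : koszul_mx (fun T => u T *m D) T = 0 by rewrite koszul_mx_mul -uE.
have [|||g [gi gD gE]] := ac i.+1 (fun T => u T *m D) _ _ _ ucyc.
- by move=> T Ti; rewrite ui // mul0mx.
- by move=> T; exists (u T).
- move=> T j; rewrite mxE; apply: supported_sum => l _.
  by rewrite -add1n; apply: ord_geM; [apply: u1 | apply: homog_ord_ge].
have H T : exists v, [/\ #|T| != i.+2 -> v = 0 & g T = v *m D].
  have [v vE] := gD T; case: (boolP (#|T| == i.+2)) => Ti; first by exists v.
  by exists 0; split=> //; rewrite mul0mx gi.
have [v vP] := fin_all_exists H.
exists (fun T => u T - koszul_mx v T); split=> [T Ti|T|T].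
- rewrite ui // sub0r (@concentrated_koszul_mx _ i.+1) ?oppr0 // => S Si.
  by have [-> ] := vP S.
- rewrite mulmxBl gE -koszul_mx_mul -[X in _ - X](eq_koszul_mx (f := g)) ?subrr // => S.
  by have [] := vP S.
- by rewrite koszul_mxB koszul_mx_koszul_mx subr0.
Qed.

End KoszulRows.

Section LinearSyzygies.
Context (K : fieldType) (n : nat).
Local Notation R := {mpoly K[n]}.
Implicit Types (p q : R) (m : 'X_{1..n}) (T : {set 'I_n}).

Definition lin_row b (c : 'rV[K]_(n * b)) : 'rV[R]_b :=
  \row_j \sum_t c 0 (mxvec_index t j) *: 'X_t.

Lemma mcoeff_lin_row b (c : 'rV[K]_(n * b)) j t :
  (lin_row c 0 j)@_U_(t) = c 0 (mxvec_index t j).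
Proof.
rewrite mxE raddf_sum (bigD1 t) //= mcoeffZ mcoeffXU eqxx mulr1 big1 ?addr0 //.
by move=> s st; rewrite mcoeffZ mcoeffXU (negPf st) mulr0.
Qed.

Lemma lin_row_homog b (c : 'rV[K]_(n * b)) j : lin_row c 0 j \is 1.-homog.
Proof. by rewrite mxE; apply: rpred_sum => t _; apply: rpredZ; apply: dhomogXU. Qed.

Lemma lin_row_inj b (c : 'rV[K]_(n * b)) : lin_row c = 0 -> c = 0.
Proof.
move=> c0; apply/rowP=> k; case/mxvec_indexP: k => t j.
by rewrite -mcoeff_lin_row c0 !mxE mcoeff0.
Qed.

Lemma lin_rowP b (v : 'rV[R]_b) : (forall j, v 0 j \is 1.-homog) ->
  exists c, v = lin_row c.
Proof.
move=> v1; exists (mxvec (\matrix_(t, j) (v 0 j)@_U_(t))); apply/rowP=> j.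
apply/mpolyP=> m; have [m1|m1] := eqVneq (mdeg m) 1%N.
  have /mdeg1P[t /eqP->] : mdeg m == 1%N by apply/eqP.
  by rewrite mcoeff_lin_row mxvecE mxE.
by rewrite (dhomog_nemf_coeff (v1 j) m1) (dhomog_nemf_coeff (lin_row_homog _ j) m1).
Qed.

Lemma lin_row_linear b a (c c' : 'rV[K]_(n * b)) :
  lin_row (a *: c + c') = a%:MP *: lin_row c + lin_row c'.
Proof.
apply/rowP=> j; rewrite !mxE mulr_sumr -big_split; apply: eq_bigr => t _ /=.
by rewrite !mxE scalerDl -scalerA mul_mpolyC.
Qed.

Lemma lin_row_mul b r (B : 'M[K]_(r, n * b)) (u : 'rV[K]_r) :
  map_mx (@mpolyC n K) u *m (\matrix_i lin_row (row i B)) = lin_row (u *m B).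
Proof.
apply/rowP=> j; rewrite !mxE.
under [RHS]eq_bigr do rewrite mxE scaler_suml.
rewrite exchange_big /=; apply: eq_bigr => i _.
rewrite !mxE mulr_sumr; apply: eq_bigr => t _.
by rewrite !mxE mul_mpolyC scalerA.
Qed.

Definition pihomog_mx k e (v : 'rV[R]_k) : 'rV[R]_k := map_mx (pihomog mdeg e) v.

Lemma pihomog_mx_mul b a c e (D : 'M[R]_(b, a)) (v : 'rV[R]_b) : homog_mx c D ->
  v *m D = 0 -> pihomog_mx e v *m D = 0.
Proof.
move=> Dc /rowP vD; apply/rowP=> j; have := vD j; rewrite !mxE => vDj.
transitivity (pihomog mdeg (e + c)%N (\sum_i v 0 i * D i j)); last by rewrite vDj linear0.
by rewrite linear_sum /=; apply: eq_bigr => i _; rewrite mxE (pihomogM _ _ (Dc i j)).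
Qed.

Lemma image_mx0 b a (D : 'M[R]_(b, a)) : image_mx D 0.
Proof. by exists 0; rewrite mul0mx. Qed.

Lemma image_mxD b a (D : 'M[R]_(b, a)) u v : image_mx D u -> image_mx D v -> image_mx D (u + v).
Proof. by case=> x -> [y ->]; exists (x + y); rewrite mulmxDl. Qed.

Lemma image_mxZ b a (D : 'M[R]_(b, a)) p v : image_mx D v -> image_mx D (p *: v).
Proof. by case=> x ->; exists (p *: x); rewrite scalemxAl. Qed.

Lemma image_mx_sum b a (D : 'M[R]_(b, a)) (I : Type) (r : seq I) (P : pred I) F :
  (forall i, P i -> image_mx D (F i)) -> image_mx D (\sum_(i <- r | P i) F i).
Proof. by move=> h; apply: big_ind => //; [apply: image_mx0 | apply: image_mxD]. Qed.

(** Vanishing of H_0 writes a homogeneous syzygy of degree at least 2 as a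
    combination of syzygies of smaller degree, so the linear ones generate, and a
    K-basis of these is the next differential. Its rows are again independent over
    K and its image is again acyclic, so the construction can be iterated. *)
Lemma linear_syzygies b a c (D : 'M[R]_(b, a)) :
    homog_mx c D -> indep_rows D -> (forall i, acyclic i c (image_mx D)) ->
  exists b' (D' : 'M[R]_(b', b)), [/\ homog_mx 1 D', indep_rows D',
    forall i, acyclic i 1 (image_mx D') & forall v, v *m D = 0 <-> image_mx D' v].
Proof.
move=> Dc Dind Dac; have Zac := acyclic_syzygies Dc Dac.
have [||r [B [Bfree BP]]] := @subspace_basis K (n * b) (fun c => lin_row c *m D = 0).
- have -> : lin_row (0 : 'rV[K]_(n * b)) = 0.
    by apply/rowP=> j; rewrite !mxE big1 // => t _; rewrite mxE scale0r.
  by rewrite mul0mx.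
- by move=> x u v uD vD; rewrite lin_row_linear mulmxDl -scalemxAl uD vD scaler0 addr0.
pose D' : 'M[R]_(r, b) := \matrix_i lin_row (row i B).
have D'D : D' *m D = 0.
  apply/row_matrixP=> i; rewrite row_mul rowK row0; apply/BP; exact: row_sub.
have D'1 : homog_mx 1 D' by move=> i j; rewrite mxE lin_row_homog.
have D'ind : indep_rows D'.
  move=> u; rewrite lin_row_mul => /lin_row_inj uB.
  by apply: (row_free_inj Bfree); rewrite uB mul0mx.
have ZD' e (v : 'rV[R]_b) : v *m D = 0 -> (forall j, v 0 j \is e.-homog) -> image_mx D' v.
  elim: e v => [|e IH] v vD ve.
    suff -> : v = 0 by apply: image_mx0.
    have vE : v = map_mx (@mpolyC n K) (const_part v).
      apply/rowP=> j; rewrite !mxE; apply/mpolyP=> m; rewrite mcoeffC.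
      have [->|m0] := eqVneq m 0%MM; first by rewrite mulr1.
      by rewrite mulr0 (dhomog_nemf_coeff (ve j)) // mdeg_eq0.
    by rewrite vE (Dind (const_part v)) ?map_mx0 // -vE.
  case: e IH ve => [|e] IH ve.
    have [x vx] := lin_rowP ve.
    have /submxP[u xE] : (x <= B)%MS by apply/BP; rewrite -vx.
    by exists (map_mx (@mpolyC n K) u); rewrite lin_row_mul -xE.
  pose f T := if T == set0 then v else 0.
  have f0 : concentrated_mx 0 f by move=> T; rewrite cards_eq0 /f => /negPf->.
  have [|||g [_ gZ gE]] := Zac 0%N f f0.
  - by move=> T; rewrite /f; case: ifP => // _; rewrite mul0mx.
  - move=> T j; rewrite /f; case: ifP => _; last by rewrite mxE; apply: supported0.
    by apply: ord_ge_le (homog_ord_ge (ve j)).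
  - by move=> T; apply: koszul_mx0.
  have -> : v = \sum_t (ksign K set0 t * 'X_t) *: pihomog_mx e.+1 (g (t |: set0)).
    apply/rowP=> j; have := congr1 (fun w : 'rV_b => w 0 j) (gE set0).
    rewrite /f eqxx koszul_mxE => vE.
    rewrite -[LHS](pihomog_dE (ve j)) vE linear_sum summxE [LHS]big_mkcond /=.
    apply: eq_bigr => t _; rewrite in_set0 !mxE /ksign -mulrA -[RHS]mulrA.
    rewrite raddfMsign /=; congr (_ * _).
    by rewrite ![ 'X_t * _]mulrC -[e.+2]addn1 (pihomogM _ _ (dhomogXU _ t)).
  apply: image_mx_sum => t _; apply: image_mxZ; apply: IH => [|j].
    exact: pihomog_mx_mul (gZ _).
  by rewrite mxE pihomogP.
have ex v : v *m D = 0 <-> image_mx D' v.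
  split=> [vD|[u ->]]; last by rewrite -mulmxA D'D mulmx0.
  pose k := \max_j msize (v 0%R j).
  have -> : v = \sum_(e < k) pihomog_mx e v.
    apply/rowP=> j; rewrite summxE [LHS](@pihomog_partitionE _ _ mdeg k).
      by apply: eq_bigr => e _; rewrite mxE.
    exact: (leq_bigmax j).
  apply: image_mx_sum => e _; apply: (ZD' e); first exact: pihomog_mx_mul vD.
  by move=> j; rewrite mxE pihomogP.
exists r, D'; split=> // i f fi fD f2 f0.
have [|g [gi gZ gE]] := Zac i f fi _ f2 f0; first by move=> T; apply/ex.
by exists g; split=> // T; apply/ex.
Qed.

End LinearSyzygies.

Section LinearResolutions.
Context (K : fieldType) (n : nat).
Local Notation R := {mpoly K[n]}.
Implicit Types (p q : R) (m : 'X_{1..n}) (T : {set 'I_n}).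

(** Matrices of all sizes form one type, so that the differentials can be obtained
    by iterating a function; the rows of one are the columns of the next. *)
Record pmat := PMat { pcols : nat; prows : nat; pmx : 'M[R]_(prows, pcols) }.

Definition linear_pmat c (s : pmat) := [/\ homog_mx c (pmx s), indep_rows (pmx s) &
  forall i, acyclic i c (image_mx (pmx s))].

Definition syzygy_pmat b a (D : 'M[R]_(b, a)) (x : {b' & 'M[R]_(b', b)}) :=
  linear_pmat 1 (PMat (projT2 x)) /\ forall v, v *m D = 0 <-> image_mx (projT2 x) v.

(** The choice is total and meaningful on linear matrices only ([syzygyP]); this
    makes it a function that can be iterated without carrying proofs. *)
Definition syzygy b a (D : 'M[R]_(b, a)) : {b' & 'M[R]_(b', b)} :=
  ClassicalEpsilon.epsilon (inhabits (existT (fun b' => 'M[R]_(b',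
    b)) 0%N (const_mx 0))) (syzygy_pmat D).

Definition next_pmat (s : pmat) : pmat := PMat (projT2 (syzygy (pmx s))).

Lemma syzygyP c s : linear_pmat c s -> syzygy_pmat (pmx s) (syzygy (pmx s)).
Proof.
case=> h1 h2 h3; apply: ClassicalEpsilon.epsilon_spec.
by have [b' [D' [d1 d2 d3 d4]]] := linear_syzygies h1 h2 h3; exists (existT _ b' D').
Qed.

Lemma linear_resolution_of_acyclic (J : mpset K n) d r (a : 'cV[R]_r) :
    homog_mx d a -> indep_rows a -> (forall i, acyclic i d (image_mx a)) ->
    (forall p, J p <-> exists v : 'rV_r, p = (v *m a) 0 0) -> linear_resolution d J.
Proof.
move=> ad aind aac Ja; case: (posnP r) => [r0|r_gt0].
  left=> p; rewrite Ja; split=> [[v ->]|->]; last by exists 0; rewrite mul0mx mxE.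
  by rewrite mxE big1 // => i; have: (i < 0)%N by rewrite -r0; apply: ltn_ord.
right; pose st i := iter i next_pmat (PMat a).
have st_lin i : linear_pmat (if i is 0 then d else 1%N) (st i).
  elim: i => [|i IH]; first by split.
  by have [] := syzygyP IH.
have st_ex i (v : 'rV_(prows (st i))) : v *m pmx (st i) = 0 <-> exists u, v = u *m pmx (st i.+1).
  by have [_ h] := syzygyP (st_lin i); exact: (h v).
pose rk i := prows (st i).
pose dg i (k : 'I_(rk i)) := (d + i)%N.
pose df i : 'M[R]_(rk i.+1, rk i) := pmx (st i.+1).
have df1 i : homog_mx 1 (df i) by have [] := st_lin i.+1.
have h1 k : (a : 'cV[R]_(rk 0)) k 0 \is (dg 0 k).-homog by rewrite /dg addn0; apply: ad.
have h2 i k l m : m \in msupp (df i k l) -> (mdeg m + dg i l = dg i.+1 k)%N.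
  by move/(dhomogP _ _ _ (df1 i k l)) => m1; rewrite /dg addnS -add1n m1.
have h6 i k l : (df i k l)@_0%MM = 0.
  have m0 : mdeg (0 : 'X_{1..n})%MM != 1%N by rewrite mdeg0.
  exact: dhomog_nemf_coeff (df1 i k l) m0.
pose F : min_graded_resolution J := @MinGradedRes K n J rk dg a df h1 h2 Ja
  (fun v => st_ex 0%N v) (fun i v => st_ex i.+1 v) h6.
exists F; split.
  move=> i j /eqP; rewrite -lt0n => /card_gt0P[k]; rewrite inE => /eqP <-.
  by rewrite /F /= /dg.
exists 0%N, d; rewrite addn0; split=> //; apply/eqP; rewrite -lt0n.
by apply/card_gt0P; exists (Ordinal r_gt0); rewrite inE /= /dg addn0.
Qed.

(** Minimality makes the degrees of the basis elements grow by at least 1 at each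
    step, and the regularity bounds them by d + i. So the basis of the i-th module
    lies in degree d + i, all differentials have linear entries, and
    [acyclic_imageS] applies along the whole resolution. *)
Lemma acyclic_of_linear_resolution (J : mpset K n) d :
    (forall p, J p -> ord_ge d p) -> linear_resolution d J ->
  forall i, acyclic i d (fun v : 'rV[R]_1 => J (v 0 0)).
Proof.
move=> Jd [J0|[F [Fle _]]] i.
  move=> f fi fJ _ _; exists (fun=> 0); split=> // T.
    by rewrite mxE; apply/J0.
  rewrite [RHS]big1 => [|t _]; last by rewrite scaler0.
  by apply/rowP=> j; rewrite ord1 mxE; apply/J0.
have degle j k : (deg (m0 := F) (i := j) k <= d + j)%N.
  apply: (Fle j); apply/eqP; rewrite -lt0n; apply/card_gt0P; exists k.
  by rewrite inE.
have minimal b b' (D : 'M[R]_(b', b)) (k : 'I_b) : (forall x y, (D x y)@_0%MM = 0) ->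
    (exists u : 'rV_b', delta_mx 0 k = u *m D) -> False.
  move=> D0 [u uE]; have := congr1 (fun w : 'rV[R]_b => w 0 k) uE; rewrite !mxE !eqxx =>
    /(congr1 (mcoeff 0%MM)).
  rewrite mcoeff1 eqxx raddf_sum /= big1 => [/eqP|x _]; first by rewrite oner_eq0.
  by rewrite rmorphM /= D0 mulr0.
have dege j k : (deg (m0 := F) (i := j) k = d + j)%N.
  elim: j k => [|j IH] k; apply/eqP; rewrite eqn_leq degle /= leqNgt; apply/negP=> lt.
    apply: (minimal _ _ (diff F 0) k); first by move=> x y; apply: diff_minimal.
    apply/exact0; rewrite -rowE; apply/rowP=> y; rewrite ord1 !mxE.
    apply/mpolyP=> m; rewrite mcoeff0.
    have [md|md] := eqVneq (mdeg m) (deg (m0 := F) (i := 0) k); last first.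
      exact: dhomog_nemf_coeff (aug_homog k) md.
    have /Jd/supported_coef-> // : J (aug F k 0).
      by apply/(aug_image F); exists (delta_mx 0 k); rewrite -rowE mxE.
    by rewrite -ltnNge md -[X in (_ < X)%N]addn0.
  apply: (minimal _ _ (diff F j.+1) k); first by move=> x y; apply: diff_minimal.
  apply/exactS; rewrite -rowE; apply/rowP=> y; rewrite !mxE.
  apply/mpolyP=> m; rewrite mcoeff0; apply/eqP; apply: contraT.
  rewrite -mcoeff_msupp => mF; have := diff_homog mF; rewrite IH => E.
  have m0 : m = 0%MM.
    by apply/eqP; rewrite -mdeg_eq0 -leqn0 -(leq_add2r (d + j)) E add0n -ltnS -addnS.
  by move: mF; rewrite m0 mcoeff_msupp diff_minimal eqxx.
have augd : homog_mx d (aug F).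
  by move=> x y; rewrite ord1; have := aug_homog x; rewrite dege addn0.
have diff1 j : homog_mx 1 (diff F j).
  move=> x y; apply/dhomogP=> m /diff_homog; rewrite !dege addnS -add1n => /eqP.
  by rewrite eqn_add2r => /eqP.
have diffac s j : acyclic s 1 (image_mx (diff F j)).
  elim: s j => [|s IH] j; first exact: acyclic_image0.
  by apply: (acyclic_imageS (diff1 j) _ (IH j.+1)) => v; apply: exactS.
have augac : acyclic i d (image_mx (aug F)).
  case: i => [|i]; first exact: acyclic_image0.
  by apply: (acyclic_imageS augd _ (diffac i 0%N)) => v; apply: exact0.
have JF (v : 'rV[R]_1) : J (v 0 0) <-> image_mx (aug F) v.
  rewrite (aug_image F); split=> [[u uE]|[u ->]]; last by exists u.
  by exists u; apply/rowP=> y; rewrite ord1.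
move=> f fi fJ fd f0; have [|g [gi gJ gE]] := augac f fi _ fd f0.
  by move=> T; apply/JF.
by exists g; split=> // T; apply/JF.
Qed.

End LinearResolutions.

(** * Linear quotients *)

Section LinearQuotients.
Context (K : fieldType) (n : nat).
Local Notation R := {mpoly K[n]}.
Implicit Types (p q : R) (m u : 'X_{1..n}) (s : seq 'X_{1..n}) (T : {set 'I_n}).

Definition antichain s := {in s &, forall u v, (u <= v)%MM -> u = v}.

Lemma min_mon_gensP (I : mpset K n) s :
  min_mon_gens I s <-> [/\ uniq s, same_set I (monomial_ideal K s) & antichain s].
Proof.
split=> [[us Is mins]|[us Is anti]]; split=> //.
  move=> u v us' vs uv; apply/eqP; apply: contraT => ne.
  suff: {subset s <= [seq w <- s | w != v]} by move/(_ v vs); rewrite mem_filter eqxx.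
  apply: mins => [w|p]; first by rewrite mem_filter => /andP[].
  rewrite (Is p) !monomial_idealP; split=> h m /h /aboveP[w].
    move=> ws wm; apply/aboveP; have [E|wv] := eqVneq w v; last by exists w;
      rewrite // mem_filter wv.
    by exists u; [rewrite mem_filter ne | apply: lepm_trans uv _; rewrite -E].
  by rewrite mem_filter => /andP[_ ws] wm; apply/aboveP; exists w.
move=> t ts It u us'; have /aboveP[v vt vu] : above t u.
  by apply/(monomial_idealX K)/It/Is/monomial_idealX/aboveP; exists u; rewrite // lepm_refl.
by rewrite -(anti v u (ts v vt) us' vu).
Qed.

(** The condition on colon ideals in terms of exponents: u_j with j < i contributes
    u_j / gcd (u_j, u_i) to the colon ideal at u_i, and this must be a multiple of a
    variable x_y that lies in the colon ideal, thanks to some u_k with k < i. *)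
Definition lq s := forall i j, (j < i < size s)%N -> exists y k,
  [/\ (k < i)%N, (nth 0%MM s i y < nth 0%MM s j y)%N &
      (nth 0%MM s k <= nth 0%MM s i + U_(y))%MM].

Lemma variable_idealP (A : {set 'I_n}) p : variable_ideal K A p <-> var_ideal A p.
Proof.
have E : monomial_ideal K [seq U_(x)%MM | x <- enum A] p <-> variable_ideal K A p.
  split; apply: ideal_gen_sub => q [].
    by move=> m /mapP[x]; rewrite mem_enum => xA -> ->; apply: ideal_gen_in; exists x.
  by move=> x xA ->; apply: ideal_gen_in; exists U_(x)%MM; rewrite ?map_f ?mem_enum.
rewrite -E monomial_idealP; split=> h m /h.
  case/aboveP=> u /mapP[x]; rewrite mem_enum => xA ->; rewrite lep1mP -lt0n => mx.
  by apply/exists_inP; exists x.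
case/exists_inP=> x xA mx; apply/aboveP; exists U_(x)%MM; first by rewrite map_f ?mem_enum.
by rewrite lep1mP -lt0n.
Qed.

Lemma colonP s u p : ideal_colon (monomial_ideal K s) 'X_[u] p <->
  supported (fun m => above s (u + m)%MM) p.
Proof.
rewrite /ideal_colon monomial_idealP; split=> h m.
  by move=> mp; apply: h; rewrite (perm_mem (msuppMX _ _)) map_f.
by rewrite (perm_mem (msuppMX _ _)) => /mapP[m' /h ? ->].
Qed.

Lemma nth_takeP s i u : (i <= size s)%N ->
  reflect (exists2 j, (j < i)%N & nth 0%MM s j = u) (u \in take i s).
Proof.
move=> ile; apply: (iffP (nthP 0%MM)) => -[j].
  by rewrite size_takel // => ji <-; exists j; rewrite // nth_take.
by move=> ji <-; exists j; rewrite ?size_takel // nth_take.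
Qed.

Lemma linear_quotientsP (I : mpset K n) : linear_quotients I <->
  exists s, [/\ uniq s, same_set I (monomial_ideal K s), antichain s & lq s].
Proof.
split=> [[s [/min_mon_gensP[us Is anti] h]]|[s [us Is anti h]]]; exists s.
  split=> // i j /andP[ji isz]; have [|A colA] := h i; first by rewrite (leq_ltn_trans _ ji).
  set u := nth 0%MM s i in colA *; set v := nth 0%MM s j.
  have ile := ltnW isz.
  have : ideal_colon (monomial_ideal K (take i s)) 'X_[u] 'X_[v - u].
    apply/colonP/supportedX/aboveP; exists v; first by apply/nth_takeP => //; exists j.
    by apply/mnm_lepP=> x; rewrite mnmDE mnmBE; rewrite -maxnE leq_maxr.
  move/colA/variable_idealP/(_ (v - u)%MM); rewrite msuppX inE eqxx => /(_ isT).
  case/exists_inP=> y yA; rewrite mnmBE subn_gt0 => uv.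
  have /colA/colonP : variable_ideal K A 'X_y by apply: ideal_gen_in; exists y.
  move/(_ U_(y)%MM); rewrite msuppX inE eqxx => /(_ isT)/aboveP[w].
  by case/nth_takeP=> // k ki <- wu; exists y, k.
split; first exact/min_mon_gensP.
move=> i /andP[i0 isz]; have ile := ltnW isz.
exists [set x | above (take i s) (nth 0%MM s i + U_(x))%MM] => p.
rewrite colonP variable_idealP; split=> hp m /hp.
  case/aboveP=> _ /nth_takeP[//|j ji <-] /mnm_lepP le.
  have [|y [k [ki uv wu]]] := h i j; first by rewrite ji.
  apply/exists_inP; exists y.
    by rewrite inE; apply/aboveP; exists (nth 0%MM s k) => //; apply/nth_takeP => //; exists k.
  by have := leq_trans uv (le y); rewrite mnmDE -[X in (X < _)%N]addn0 ltn_add2l.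
case/exists_inP=> y; rewrite inE => /aboveP[w ws wu] my; apply/aboveP; exists w => //.
apply: lepm_trans wu _; apply/mnm_lepP=> x; rewrite !mnmDE leq_add2l mnm1E.
by case: eqP => [<-|].
Qed.

Lemma concentrated_koszul i (f : {set 'I_n} -> R) :
  concentrated i.+1 f -> concentrated i (koszul f).
Proof.
by move=> fi T Ti; apply: big1 => t tT; rewrite fi ?mulr0 // cardsU1 tT.
Qed.

Lemma ord_ge_koszul c (f : {set 'I_n} -> R) T :
  (forall T, ord_ge c (f T)) -> ord_ge c.+1 (koszul f T).
Proof.
move=> fc; apply: supported_sum => t _.
rewrite -mulrA; apply: supportedM => [m m'|].
  by rewrite mdegD => h; apply: leq_trans h (leq_addl _ _).
rewrite -add1n; apply: ord_geM; last exact: fc.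
exact/homog_ord_ge/dhomogXU.
Qed.

(** [acyclic] for a monomial ideal, with polynomials in place of rows of length 1. *)
Definition acyclic_mon i d (N : pred 'X_{1..n}) := forall f : {set 'I_n} -> R,
  concentrated i f -> (forall T, supported N (f T)) -> (forall T, ord_ge d.+1 (f T)) ->
  (forall T, koszul f T = 0) ->
  exists g, [/\ concentrated i.+1 g, forall T, supported N (g T) & forall T, f T = koszul g T].

Lemma acyclic_monP i d N :
  acyclic_mon i d N <-> acyclic i d (fun v : 'rV[R]_1 => supported N (v 0 0)).
Proof.
split=> ac f fi fN fd f0.
  have [||||g [gi gN gE]] := ac (fun T => f T 0 0).
  - by move=> T Ti; rewrite fi // mxE.
  - exact: fN.
  - by move=> T; apply: fd.
  - by move=> T; rewrite -koszul_mxE f0 mxE.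
  exists (fun T => const_mx (g T)); split=> T.
  - by move=> Ti; rewrite gi //; apply/rowP=> j; rewrite !mxE.
  - by rewrite mxE.
  - apply/rowP=> j; rewrite ord1 gE koszul_mxE.
    by apply: eq_koszul => S; rewrite mxE.
have [||||g [gi gN gE]] := ac (fun T => const_mx (f T)).
- by move=> T Ti; rewrite fi //; apply/rowP=> j; rewrite !mxE.
- by move=> T; rewrite mxE.
- by move=> T j; rewrite mxE.
- move=> T; apply/rowP=> j; rewrite koszul_mxE mxE -[RHS](f0 T).
  by apply: eq_koszul => S; rewrite mxE.
exists (fun T => g T 0 0); split=> T.
- by move=> Ti; rewrite gi // mxE.
- exact: gN.
- by have := congr1 (fun v : 'rV_1 => v 0 0) (gE T); rewrite mxE koszul_mxE.
Qed.

Lemma lem_mdeg_eq u m : (u <= m)%MM -> (mdeg m <= mdeg u)%N -> u = m.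
Proof.
move=> um mu; rewrite -(submK um); have : mdeg (m - u)%MM == 0%N.
  by have := mu; rewrite -{1}(submK um) mdegD -{2}[mdeg u]add0n leq_add2r leqn0.
by rewrite mdeg_eq0 => /eqP->; rewrite add0m.
Qed.

(** Let u be the generator that follows the prefix s', of degree at most d. It
    enlarges the component of degree d by the multiples of u of degree at least d,
    modulo those divisible by u * x_a with x_a in the colon ideal: a shifted
    truncation of the ring modulo the variables in A, which is acyclic by
    [koszul_exact]. The generators need not be sorted by degree: a generator w of s'
    dividing u * x_a and of larger degree than u would be u * x_a itself, which
    contradicts minimality. *)
Lemma acyclic_lq s d i : antichain s -> uniq s -> lq s -> acyclic_mon i d (comp_mon s d).
Proof.
move=> anti us h; rewrite -[s in comp_mon s]take_size.
have [k kE] : exists k, k = size s by exists (size s).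
have := leqnn (size s); rewrite -{1 3}kE => {kE}.
elim: k => [_|k IH ksz].
  move=> f fi fN fd f0; have fE T : f T = 0.
    by apply/msuppnil0; case E: (msupp (f T)) (fN T) => [//|m l] /(_ m);
      rewrite E take0 inE eqxx => /(_ isT).
  by exists (fun=> 0); split=> // T; [exact: supported0 | rewrite fE [RHS]big1 // => t _;
    rewrite mulr0].
have {}IH := IH (ltnW ksz).
set s' := take k s in IH *; rewrite (take_nth 0%MM ksz) -/s'; set u := nth 0%MM s k.
have us' : u \notin s' by move: us;
  rewrite -{1}(cat_take_drop k.+1 s) (take_nth 0%MM ksz) cat_uniq rcons_uniq => /and3P[/andP[]].
have uss : u \in s by rewrite mem_nth.
have s's : {subset s' <= s} by move=> x /mem_take.
case: (leqP (mdeg u) d) => ud; last first.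
  have E m : comp_mon (rcons s' u) d m = comp_mon s' d m.
    by rewrite /comp_mon has_rcons [(mdeg u <= d)%N]leqNgt ud andbF.
  move=> f fi fN fd f0; have [|g [gi gN gE]] := IH f fi _ fd f0.
    by move=> T m /fN; rewrite /in_mem /= E.
  by exists g; split=> // T m /gN; rewrite /in_mem /= E.
(* the variables generating the colon ideal of s' at u *)
pose A := [set x | above s' (u + U_(x))%MM].
have colA m : above s' (u + m)%MM -> [exists a in A, 0 < m a]%N.
  case/aboveP=> _ /nth_takeP[|j jk <-]; first exact: ltnW.
  move/mnm_lepP=> le; have [|y [l [lk uv wu]]] := h k j; first by rewrite jk.
  apply/exists_inP; exists y.
    by rewrite inE; apply/aboveP; exists (nth 0%MM s l) => //; apply/nth_takeP;
      [exact: ltnW | exists l].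
  by have := leq_trans uv (le y); rewrite mnmDE -[X in (X < _)%N]addn0 ltn_add2l.
have Acol m : [exists a in A, 0 < m a]%N -> (d <= mdeg (u + m))%N -> comp_mon s' d (u + m)%MM.
  case/exists_inP=> y; rewrite inE => /aboveP[w ws wu] my dm.
  apply/comp_monP; exists w => //; rewrite dm andbT; apply/andP; split.
    apply: lepm_trans wu _; apply/mnm_lepP=> x; rewrite !mnmDE leq_add2l mnm1E.
    by case: eqP => [<-|].
  apply: leq_trans ud; rewrite leqNgt; apply/negP=> lt.
  have wE : w = (u + U_(y))%MM by apply: lem_mdeg_eq wu _; rewrite mdegD mdeg1 addn1.
  case/negP: us'; rewrite (anti u w uss (s's w ws)) //.
  by rewrite wE lem_addr.
move=> f fi fN fd f0.
(* f = u * y + r, where r collects the terms already in the component of s' *)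
pose y T : R := \sum_(m <- msupp (f T) | ~~ comp_mon s' d m) (f T)@_m *: 'X_[m - u].
pose r T : R := \sum_(m <- msupp (f T) | comp_mon s' d m) (f T)@_m *: 'X_[m].
have leu T m : m \in msupp (f T) -> ~~ comp_mon s' d m -> (u <= m)%MM.
  move=> /(fN T)/comp_monP[w]; rewrite mem_rcons inE => /predU1P[->|ws] /and3P[um wd dm] //.
  by case/negP; apply/comp_monP; exists w => //; rewrite um wd dm.
have fE T : f T = 'X_[u] * y T + r T.
  rewrite {1}[f T]mpolyE (bigID (comp_mon s' d)) /= addrC; congr (_ + _).
  rewrite mulr_sumr [LHS]big_seq_cond [RHS]big_seq_cond; apply: eq_bigr => m /andP[mf mc].
  by rewrite -scalerAr -mpolyXD addmC submK // (leu T).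
have upc m m' : comp_mon s' d m -> comp_mon s' d (m' + m)%MM by apply: comp_mon_le;
  apply: lem_addl.
have rN T : supported (comp_mon s' d) (r T).
  apply: supported_sum => m mc; rewrite -mul_mpolyC.
  by apply: supportedM; [exact: upc | exact: supportedX].
pose c := (d - mdeg u)%N.
have yc T : ord_ge c.+1 (y T).
  rewrite /y big_seq_cond; apply: supported_sum => m /andP[mf mc].
  rewrite -mul_mpolyC; apply: supportedM => [m1 m2|]; first by rewrite mdegD => le;
    apply: leq_trans le (leq_addl _ _).
  apply: supportedX; have um := leu T m mf mc.
  have : (d < mdeg m)%N := fd T m mf.
  by rewrite -{1}(submK um) mdegD addnC -leq_subLR subSn.
have yi : concentrated i y by move=> T Ti; rewrite /y fi // msupp0 big_nil.
have yA T : var_ideal A (koszul y T).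
  have ky : supported (comp_mon s' d) ('X_[u] * koszul y T).
    rewrite -koszulM (eq_koszul (g := fun T => f T - r T)).
      by rewrite koszulB f0 sub0r; apply/supportedN/supported_koszul.
    by move=> S; rewrite fE addrK.
  move=> m mk; apply: colA; have : comp_mon s' d (u + m)%MM.
    by apply: ky; rewrite mulrC (perm_mem (msuppMX _ _)) map_f.
  by case/comp_monP=> w ws /and3P[wm _ _]; apply/aboveP; exists w.
have [//|g [gi gc gA]] := koszul_exact yi yc yA.
have XN (N : pred 'X_{1..n}) p : (forall m, m \in msupp p -> N (u + m)%MM) ->
  supported N ('X_[u] * p).
  by move=> hp m; rewrite mulrC (perm_mem (msuppMX _ _)) => /mapP[m' /hp ? ->].
have Xgd T : ord_ge d ('X_[u] * g T).
  by apply: XN => m /(gc T) /= le; rewrite mdegD -leq_subLR.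
have [||||g1 [g1i g1N g1E]] := IH (fun T => f T - koszul (fun T => 'X_[u] * g T) T).
- move=> T Ti; rewrite fi // sub0r (@concentrated_koszul i) ?oppr0 // => S Si.
  by rewrite gi ?mulr0.
- move=> T; rewrite koszulM fE addrAC -mulrBr; apply: supportedD; last exact: rN.
  apply: XN => m mg; apply: Acol; first exact: (gA T).
  rewrite mdegD -leq_subLR.
  have : ord_ge c.+1 (y T - koszul g T).
    by apply: supportedD; [apply: yc | apply/supportedN/ord_ge_koszul].
  by move/(_ m mg); apply: ltnW.
- move=> T; apply: supportedD; first exact: fd.
  exact/supportedN/ord_ge_koszul.
- by move=> T; rewrite koszulB koszul_koszul f0 subr0.
exists (fun T => 'X_[u] * g T + g1 T); split=> T.
- by move=> Ti; rewrite gi // g1i // mulr0 addr0.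
- apply: supportedD.
    apply: XN => m /(gc T) /= le; apply/comp_monP; exists u; first by rewrite mem_rcons inE eqxx.
    by rewrite lem_addr ud mdegD -leq_subLR.
  move=> m /(g1N T)/comp_monP[w ws wm]; apply/comp_monP; exists w => //.
  by rewrite mem_rcons inE ws orbT.
- by rewrite koszulD -g1E addrC subrK.
Qed.

Lemma monomial_ideal_image s p : monomial_ideal K s p <->
  exists v : 'rV[R]_(size s), p = (v *m \col_i 'X_[nth 0%MM s i]) 0 0.
Proof.
set a := \col_i _; split=> [[t [St ->]]|[v ->]].
  rewrite big_seq; elim/big_rec: _ => [|c q ct [v ->]]; first by exists 0; rewrite mul0mx mxE.
  have [m /(nthP 0%MM)[i isz <-] ->] := St c ct.
  exists (c.1 *: delta_mx 0 (Ordinal isz) + v); rewrite mulmxDl -scalemxAl -rowE.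
  by rewrite [RHS]mxE; congr (_ + _); rewrite !mxE.
rewrite mxE; apply: ideal_gen_sum => i _ _; rewrite mxE.
by apply/ideal_genM/ideal_gen_in; exists (nth 0%MM s i); rewrite ?mem_nth.
Qed.

Lemma linear_quotients_componentwise_linear (I : mpset K n) :
  linear_quotients I -> componentwise_linear I.
Proof.
case/linear_quotientsP=> s [us Is anti h] d.
pose t := [seq m <- [seq val b | b : 'X_{1..n < d.+1}] | (mdeg m == d) && above s m].
have tP m : (m \in t) = (mdeg m == d) && above s m.
  rewrite mem_filter; case: eqP => //= md; case: (above s m) => //=.
  have mb : (mdeg m < d.+1)%N by rewrite md.
  by apply/mapP; exists (BMultinom mb); rewrite // mem_enum.
have ut : uniq t by rewrite filter_uniq // map_inj_uniq ?enum_uniq //; apply: val_inj.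
have tc m : above t m = comp_mon s d m.
  apply/aboveP/comp_monP => [[w]|[u us' /and3P[um ud dm]]].
    rewrite tP => /andP[/eqP wd /aboveP[u us' uw]] wm; exists u => //.
    by rewrite (lepm_trans uw wm) -wd !mdeg_le.
  have [|m' [um' mm' m'd]] := mnm_between um (d := d); first by rewrite ud.
  by exists m' => //; rewrite tP m'd eqxx; apply/aboveP; exists u.
have Jt p : component I d p <-> monomial_ideal K t p.
  by rewrite (componentP _ _ Is) monomial_idealP; split=> hp m /hp; rewrite /in_mem /= tc.
apply: (@linear_resolution_of_acyclic _ _ _ d _ (\col_(i < size t) 'X_[nth 0%MM t i])).
- move=> i j; rewrite mxE dhomogX; apply/eqP.
  by have := mem_nth 0%MM (ltn_ord i); rewrite tP => /andP[/eqP].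
- move=> u /(congr1 (fun v : 'rV[R]_1 => v 0 0)); rewrite !mxE => u0.
  apply/rowP=> i; have := congr1 (mcoeff (nth 0%MM t i)) u0.
  rewrite mcoeff0 raddf_sum (bigD1 i) //= big1 ?addr0 => [|j ji].
    by rewrite !mxE mcoeffCM mcoeffX eqxx mulr1.
  rewrite !mxE mcoeffCM mcoeffX nth_uniq //.
  by rewrite (_ : (j == i :> nat) = false) ?mulr0 //; apply: contraNF ji => /eqP/val_inj->.
- move=> i; have /acyclic_monP ac := acyclic_lq (i := i) (d := d) anti us h.
  have E (v : 'rV[R]_1) : image_mx (\col_(i < size t) 'X_[nth 0%MM t i]) v <->
      supported (comp_mon s d) (v 0 0).
    rewrite -(componentP _ _ Is) Jt monomial_ideal_image; split=> -[x xE].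
      by exists x; rewrite -xE.
    by exists x; apply/rowP=> j; rewrite ord1.
  move=> f fi fN fd f0; have [|g [gi gN gE]] := ac f fi _ fd f0; first by move=> T; apply/E.
  by exists g; split=> // T; apply/E.
- by move=> p; rewrite Jt monomial_ideal_image.
Qed.

End LinearQuotients.

(** * Vertex splittings *)

Section VertexSplitting.
Context (K : fieldType).

Lemma eq_monomial_ideal n (s t : seq 'X_{1..n}) : s =i t ->
  same_set (monomial_ideal K s) (monomial_ideal K t).
Proof.
by move=> st p; split; apply: ideal_gen_sub => q [m ms ->]; apply: ideal_gen_in; exists m;
  rewrite // ?st // -st.
Qed.

Lemma ideal_add_monomial n (s t : seq 'X_{1..n}) :
  same_set (ideal_add (monomial_ideal K s) (monomial_ideal K t)) (monomial_ideal K (s ++ t)).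
Proof.
move=> p; split=> [[a [b [sa tb ->]]]|[r [rS ->]]].
  by apply: ideal_genD; [move: sa|move: tb]; apply: ideal_gen_sub => q [m ms ->];
    apply: ideal_gen_in; exists m; rewrite // mem_cat ms ?orbT.
rewrite big_seq; elim/big_rec: _ => [|c p' cr [a [b [sa tb ->]]]].
  by exists 0, 0; rewrite addr0; split=> //; apply: ideal_gen0.
have [m] := rS c cr; rewrite mem_cat => /orP[] ms ->.
  exists (c.1 * 'X_[m] + a), b; rewrite addrA; split=> //.
  by apply: ideal_genD => //; apply/ideal_genM/ideal_gen_in; exists m.
exists a, (c.1 * 'X_[m] + b); rewrite addrCA; split=> //.
by apply: ideal_genD => //; apply/ideal_genM/ideal_gen_in; exists m.
Qed.

Lemma ideal_mulX_monomial n x (s : seq 'X_{1..n}) :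
  same_set (ideal_mulX x (monomial_ideal K s)) (monomial_ideal K [seq (U_(x) + u)%MM | u <- s]).
Proof.
move=> p; split=> [[q [r [rS ->]] ->]|[r [rS ->]]].
  rewrite mulr_sumr; apply: ideal_gen_sum => c cr _.
  have [m ms ->] := rS c cr; rewrite mulrCA -mpolyXD.
  by apply/ideal_genM/ideal_gen_in; exists (U_(x) + m)%MM; rewrite ?map_f.
rewrite big_seq; elim/big_rec: _ => [|c p' cr [q sq ->]].
  by exists 0; [apply: ideal_gen0 | rewrite mulr0].
have [_ /mapP[m ms ->] ->] := rS c cr.
exists (c.1 * 'X_[m] + q); last by rewrite mulrDr mpolyXD mulrCA.
by apply: ideal_genD => //; apply/ideal_genM/ideal_gen_in; exists m.
Qed.

Definition lift_mon n (x : 'I_n.+1) (u : 'X_{1..n}) : 'X_{1..n.+1} :=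
  [multinom if unlift x i is Some j then u j else 0%N | i < n.+1].

Lemma lift_monE n (x : 'I_n.+1) u j : lift_mon x u (lift x j) = u j.
Proof. by rewrite mnmE liftK. Qed.

Lemma lift_mon0 n (x : 'I_n.+1) u : lift_mon x u x = 0%N.
Proof. by rewrite mnmE unlift_none. Qed.

Lemma lift_mon_le n (x : 'I_n.+1) u v : (lift_mon x u <= lift_mon x v)%MM = (u <= v)%MM.
Proof.
apply/mnm_lepP/mnm_lepP=> h i; first by have := h (lift x i); rewrite !lift_monE.
by case: (unliftP x i) => [j|] ->; rewrite ?lift_monE ?lift_mon0.
Qed.

Lemma lift_mon_inj n (x : 'I_n.+1) : injective (lift_mon x).
Proof. by move=> u v E; apply/mnmP=> i; rewrite -!(lift_monE x) E. Qed.

Lemma lift_monD n (x : 'I_n.+1) u v : lift_mon x (u + v) = (lift_mon x u + lift_mon x v)%MM.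
Proof.
apply/mnmP=> i; rewrite mnmDE.
by case: (unliftP x i) => [j|] ->; rewrite ?lift_monE ?lift_mon0 // mnmDE.
Qed.

Lemma lift_monU n (x : 'I_n.+1) y : lift_mon x U_(y) = U_(lift x y)%MM.
Proof.
apply/mnmP=> i; rewrite mnm1E.
case: (unliftP x i) => [j|] ->; first by rewrite lift_monE mnm1E (inj_eq lift_inj).
by rewrite lift_mon0 eq_sym (negPf (neq_lift _ _)).
Qed.

Lemma insert_varX n (x : 'I_n.+1) (u : 'X_{1..n}) :
  insert_var x 'X_[u] = 'X_[lift_mon x u] :> {mpoly K[n.+1]}.
Proof.
rewrite /insert_var comp_mpolyX.
under eq_bigr do rewrite tnth_mktuple mpolyXn.
rewrite mprodXE; congr 'X_[_]; rewrite [in RHS](multinomUE_id u).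
elim/big_rec2: _ => [|i v w _ ->]; last first.
  rewrite lift_monD; congr (_ + _)%MM; apply/mnmP=> j; rewrite mulmnE.
  rewrite -lift_monU; case: (unliftP x j) => [k|] ->; rewrite ?lift_monE ?lift_mon0 //.
  by rewrite mulmnE.
by apply/mnmP=> j; case: (unliftP x j) => [k|] ->; rewrite ?lift_monE ?lift_mon0 !mnm0E.
Qed.

Lemma extension_monomial n (x : 'I_n.+1) (s : seq 'X_{1..n}) :
  same_set (extension x (monomial_ideal K s)) (monomial_ideal K (map (lift_mon x) s)).
Proof.
move=> p; split; apply: ideal_gen_sub => q [].
  move=> _ [r [rS ->]] ->; rewrite /insert_var rmorph_sum; apply: ideal_gen_sum => c cr _.
  have [m ms ->] := rS c cr; rewrite rmorphM /= -/(insert_var x 'X_[m]) insert_varX.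
  by apply/ideal_genM/ideal_gen_in; exists (lift_mon x m); rewrite ?map_f.
move=> _ /mapP[m ms ->] ->; apply: ideal_gen_in; exists 'X_[m]; last by rewrite insert_varX.
by apply: ideal_gen_in; exists m.
Qed.

Lemma eq_extension n (x : 'I_n.+1) (I J : mpset K n) : same_set I J ->
  same_set (extension x I) (extension x J).
Proof.
by move=> IJ p; split; apply: ideal_gen_sub => q [r /IJ Jr ->]; apply: ideal_gen_in; exists r.
Qed.

Lemma eq_ideal_mulX n (x : 'I_n) (I J : mpset K n) : same_set I J ->
  same_set (ideal_mulX x I) (ideal_mulX x J).
Proof. by move=> IJ p; split=> -[q /IJ Jq ->]; exists q. Qed.

Lemma eq_ideal_add n (I I' J J' : mpset K n) : same_set I I' -> same_set J J' ->
  same_set (ideal_add I J) (ideal_add I' J').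
Proof. by move=> II JJ p; split=> -[a [b [/II ha /JJ hb ->]]]; exists a, b. Qed.

Lemma same_set_trans n (I J L : mpset K n) : same_set I J -> same_set J L -> same_set I L.
Proof. by move=> IJ JL p; rewrite (IJ p). Qed.

Lemma same_set_sym n (I J : mpset K n) : same_set I J -> same_set J I.
Proof. by move=> IJ p; rewrite (IJ p). Qed.

(** Divisors are found back and forth between the two lists; this identifies the
    lists of a splitting, given up to order, with the ones built from I1 and I2. *)
Lemma antichain_gens_unique n (s t : seq 'X_{1..n}) :
  uniq s -> uniq t -> antichain s -> antichain t ->
  same_set (monomial_ideal K s) (monomial_ideal K t) -> perm_eq s t.
Proof.
move=> us ut sa ta st.
have W (r r' : seq 'X_{1..n}) : antichain r ->
  same_set (monomial_ideal K r) (monomial_ideal K r') ->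
    {subset r <= r'}.
  move=> ra rr u ur.
  have /aboveP[v vr' vu] : above r' u.
    by apply/(monomial_idealX K)/rr/monomial_idealX/aboveP; exists u; rewrite // lepm_refl.
  have /aboveP[w wr wv] : above r v.
    by apply/(monomial_idealX K)/rr/monomial_idealX/aboveP; exists v; rewrite // lepm_refl.
  have wu := ra w u wr ur (lepm_trans wv vu); rewrite wu in wv.
  by rewrite (lem_mdeg_eq wv (mdeg_le vu)).
apply: uniq_perm => // u; apply/idP/idP; first exact: W.
by apply: W => //; apply: same_set_sym.
Qed.

Lemma map_antichain n k (f : 'X_{1..n} -> 'X_{1..k}) s :
  (forall u v, (f u <= f v)%MM = (u <= v)%MM) -> antichain s -> antichain (map f s).
Proof.
by move=> fle sa _ _ /mapP[u us ->] /mapP[v vs ->]; rewrite fle => /sa->.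
Qed.

Definition split_gens n (x : 'I_n.+1) (s1 s2 : seq 'X_{1..n}) :=
  [seq (U_(x) + u)%MM | u <- map (lift_mon x) s1] ++ map (lift_mon x) s2.

Lemma split_gensP n (x : 'I_n.+1) (I1 I2 : mpset K n) s1 s2 :
  same_set I1 (monomial_ideal K s1) -> same_set I2 (monomial_ideal K s2) ->
  [/\ same_set (ideal_mulX x (extension x I1))
        (monomial_ideal K [seq (U_(x) + u)%MM | u <- map (lift_mon x) s1]),
      same_set (extension x I2) (monomial_ideal K (map (lift_mon x) s2)) &
      same_set (ideal_add (ideal_mulX x (extension x I1)) (extension x I2))
        (monomial_ideal K (split_gens x s1 s2))].
Proof.
move=> Is1 Is2.
have E1 := same_set_trans (eq_extension x Is1) (extension_monomial x s1).
have E2 := same_set_trans (eq_extension x Is2) (extension_monomial x s2).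
have E3 := same_set_trans (eq_ideal_mulX x E1) (ideal_mulX_monomial x _).
split=> //; exact: same_set_trans (eq_ideal_add E3 E2) (ideal_add_monomial _ _).
Qed.

Lemma lem_add2l n (w u v : 'X_{1..n}) : (w + u <= w + v)%MM = (u <= v)%MM.
Proof.
by apply/mnm_lepP/mnm_lepP=> h i; have := h i; rewrite !mnmDE leq_add2l.
Qed.

Lemma uniq_split_parts n (x : 'I_n.+1) s :
  uniq s -> antichain s ->
  [/\ uniq [seq (U_(x) + u)%MM | u <- map (lift_mon x) s],
      antichain [seq (U_(x) + u)%MM | u <- map (lift_mon x) s],
      uniq (map (lift_mon x) s) & antichain (map (lift_mon x) s)].
Proof.
move=> us sa; have ul : uniq (map (lift_mon x) s) by rewrite map_inj_uniq //; apply: lift_mon_inj.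
have al : antichain (map (lift_mon x) s) by apply: map_antichain sa => u v; apply: lift_mon_le.
split=> //; first by rewrite map_inj_uniq //; apply: addmI.
by apply: map_antichain al => u v; apply: lem_add2l.
Qed.

(** List the generators divisible by x before the others. A generator v of I2 is
    free of x and lies in I1, so x itself is in the colon ideal at v and accounts
    for the whole first block. *)
Lemma lq_split n (x : 'I_n.+1) (s1 s2 : seq 'X_{1..n}) : {subset s2 <= above s1} ->
  lq s1 -> lq s2 -> lq (split_gens x s1 s2).
Proof.
move=> sub lq1 lq2 i j; rewrite /split_gens size_cat !size_map => /andP[ji isz].
have n1 l : (l < size s1)%N ->
  nth 0%MM (split_gens x s1 s2) l = (U_(x) + lift_mon x (nth 0%MM s1 l))%MM.
  by move=> ls; rewrite nth_cat !size_map ls (nth_map 0%MM) ?size_map // (nth_map 0%MM).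
have n2 l : (size s1 <= l < size s1 + size s2)%N ->
    nth 0%MM (split_gens x s1 s2) l = lift_mon x (nth 0%MM s2 (l - size s1)).
  move=> /andP[sl ls]; rewrite nth_cat !size_map ltnNge sl /= (nth_map 0%MM) //.
  by rewrite ltn_subLR.
rewrite -/(split_gens x s1 s2).
case: (ltnP i (size s1)) => is1.
  have [|y [k [ki uv wu]]] := lq1 i j; first by rewrite ji.
  have js1 := ltn_trans ji is1; have ks1 := ltn_trans ki is1.
  exists (lift x y), k; rewrite !n1 //; split=> //.
    by rewrite !mnmDE ltn_add2l !lift_monE.
  by rewrite -addmA lem_add2l -lift_monU -lift_monD lift_mon_le.
have i2 : (i - size s1 < size s2)%N by rewrite ltn_subLR.
rewrite (n2 i) ?is1 //.
case: (ltnP j (size s1)) => js1.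
  have /sub/aboveP[w /(nthP 0%MM)[k ks <-] wv]
    : nth 0%MM s2 (i - size s1) \in s2 by rewrite mem_nth.
  exists x, k; rewrite !n1 //; split; first exact: leq_trans is1.
    by rewrite mnmDE mnm1E eqxx lift_mon0.
  by rewrite [X in (_ <= X)%MM]addmC lem_add2l lift_mon_le.
have [|y [k [ki uv wu]]] := lq2 (i - size s1)%N (j - size s1)%N;
  first by rewrite ltn_sub2r // (leq_ltn_trans js1).
exists (lift x y), (size s1 + k)%N; have ki' : (size s1 + k < i)%N by rewrite -ltn_subRL.
have jsz := ltn_trans ji isz; have ksz := ltn_trans ki' isz.
rewrite !n2 ?js1 ?leq_addr // addKn; split=> //.
  by rewrite !lift_monE.
by rewrite -lift_monU -lift_monD lift_mon_le.
Qed.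

Lemma perm_antichain n (s t : seq 'X_{1..n}) : perm_eq s t -> antichain s -> antichain t.
Proof. by move=> /perm_mem st sa u v ut vt; apply: sa; rewrite st. Qed.

Lemma lq_small n (s : seq 'X_{1..n}) : (size s <= 1)%N -> lq s.
Proof. by move=> s1 i j /andP[ji /leq_trans/(_ s1)]; rewrite ltnS leqn0 => /eqP i0;
  rewrite i0 in ji. Qed.

Lemma vertex_splittable_linear_quotients n (I : mpset K n) :
  vertex_splittable I -> linear_quotients I.
Proof.
move=> vsI; apply/linear_quotientsP.
elim: vsI => {n I} [n I m Im|n I I0|n I I1|n x I I1 I2 s s1 s2 _ IH1 _ IH2 IE I21 sI s1I s2I perm].
- exists [:: m]; split=> //; last exact: lq_small.
  by move=> u v; rewrite !inE => /eqP-> /eqP->.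
- exists [::]; split=> //; last exact: lq_small.
  move=> p; rewrite (I0 p) monomial_idealP; split=> [->|h].
    exact: supported0.
  by apply/msuppnil0; case E: (msupp p) h => [//|m l] /(_ m); rewrite E inE eqxx => /(_ isT).
- exists [:: 0%MM]; split=> // [p|u v|]; last exact: lq_small.
    rewrite (I1 p) monomial_idealP; split=> // _ m _; apply/aboveP; exists 0%MM; rewrite ?inE //.
    by apply/mnm_lepP=> i; rewrite mnm0E.
  by rewrite !inE => /eqP-> /eqP->.
have [t1 [ut1 It1 at1 lq1]] := IH1; have [t2 [ut2 It2 at2 lq2]] := IH2.
have [E1 E2 E] := split_gensP x It1 It2.
have /min_mon_gensP[us Is sa] := sI.
have /min_mon_gensP[us1 Is1 sa1] := s1I; have /min_mon_gensP[us2 Is2 sa2] := s2I.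
have [u1 a1 _ _] := uniq_split_parts x ut1 at1; have [_ _ u2 a2] := uniq_split_parts x ut2 at2.
have p1 := antichain_gens_unique us1 u1 sa1 a1 (same_set_trans (same_set_sym Is1) E1).
have p2 := antichain_gens_unique us2 u2 sa2 a2 (same_set_trans (same_set_sym Is2) E2).
have pst : perm_eq s (split_gens x t1 t2) by apply: perm_trans perm (perm_cat p1 p2).
exists (split_gens x t1 t2); split.
- by rewrite -(perm_uniq pst).
- exact: same_set_trans IE E.
- exact: perm_antichain pst sa.
apply: lq_split => // v vt2; apply/(monomial_idealX K)/It1/I21/It2/monomial_idealX/aboveP.
by exists v; rewrite // lepm_refl.
Qed.

End VertexSplitting.

(** * Vertex splittings of edge ideals *)

Section EdgeIdeals.
Context (K : fieldType).

Definition edge_mon n (w : 'I_n -> nat) (x y : 'I_n) : 'X_{1..n} := (U_(x) + U_(y) *+ w y)%MM.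

Definition edge_gens n (e : rel 'I_n) (w : 'I_n -> nat) : seq 'X_{1..n} :=
  [seq edge_mon w p.1 p.2 | p <- enum [pred p : 'I_n * 'I_n | e p.1 p.2]].

Lemma edge_gensP n (e : rel 'I_n) w m :
  reflect (exists x y, e x y /\ m = edge_mon w x y) (m \in edge_gens e w).
Proof.
apply: (iffP mapP) => [[[x y]]|[x [y [exy ->]]]]; first by rewrite mem_enum => exy ->; exists x,
  y.
by exists (x, y); rewrite ?mem_enum.
Qed.

Lemma edge_monE n (w : 'I_n -> nat) x y z :
  edge_mon w x y z = ((x == z) + (y == z) * w y)%N.
Proof. by rewrite mnmDE mulmnE !mnm1E. Qed.

Lemma edge_idealP n (D : wo_graph n) :
  same_set (edge_ideal K D) (monomial_ideal K (edge_gens (dedge D) (weight D))).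
Proof.
move=> p; split; apply: ideal_gen_sub => q.
  move=> [x [y [xy ->]]]; apply: ideal_gen_in; exists (edge_mon (weight D) x y).
    by apply/edge_gensP; exists x, y.
  by rewrite mpolyXD mpolyXn.
case=> _ /edge_gensP[x [y [xy ->]]] ->; apply: ideal_gen_in; exists x, y; split=> //.
by rewrite mpolyXD mpolyXn.
Qed.

(** The support of a generator is its edge, and each edge has one direction; so the
    listed generators are minimal. *)
Lemma edge_mon_le n (e : rel 'I_n) (w : 'I_n -> nat) a b c d :
  (forall x, ~~ e x x) -> (forall x y, e x y -> ~~ e y x) -> (forall x, (0 < w x)%N) ->
  e a b -> e c d -> (edge_mon w a b <= edge_mon w c d)%MM -> a = c /\ b = d.
Proof.
move=> irr asym w0 ab cd /mnm_lepP le.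
have ba : b != a by apply: contraTneq ab => ->; apply: irr.
have := le a; have := le b; rewrite !edge_monE !eqxx (negPf ba) [a == b]eq_sym (negPf ba).
rewrite add0n mul1n mul0n addn0.
have [Ec|ca] := eqVneq c a.
  rewrite Ec [a == b]eq_sym (negPf ba); have [<-//|_] := eqVneq d b.
  by rewrite leqNgt w0.
have [Ed|//] := eqVneq d a; have [Ec|cb] := eqVneq c b.
  by rewrite Ed Ec in cd; have := asym _ _ ab; rewrite cd.
by rewrite Ed [a == b]eq_sym (negPf ba) leqNgt w0.
Qed.

Lemma edge_gens_uniq n (e : rel 'I_n) (w : 'I_n -> nat) :
  (forall x, ~~ e x x) -> (forall x y, e x y -> ~~ e y x) -> (forall x, (0 < w x)%N) ->
  uniq (edge_gens e w) /\ antichain (edge_gens e w).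
Proof.
move=> irr asym w0; split.
  rewrite map_inj_in_uniq ?enum_uniq // => -[a b] [c d]; rewrite !mem_enum /= => ab cd E.
  have le : (edge_mon w a b <= edge_mon w c d)%MM by rewrite E lepm_refl.
  by have [<- <-] := @edge_mon_le _ _ _ a b c d irr asym w0 ab cd le.
move=> _ _ /edge_gensP[a [b [ab ->]]] /edge_gensP[c [d [cd ->]]].
by case/(edge_mon_le irr asym w0 ab cd) => -> ->.
Qed.

Lemma VSsplit_gens n (x : 'I_n.+1) (I : mpset K n.+1) (s1 s2 : seq 'X_{1..n}) t :
  uniq s1 -> antichain s1 -> uniq s2 -> antichain s2 -> antichain t ->
  t =i split_gens x s1 s2 -> {subset s2 <= above s1} ->
  vertex_splittable (monomial_ideal K s1) -> vertex_splittable (monomial_ideal K s2) ->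
  same_set I (monomial_ideal K t) -> vertex_splittable I.
Proof.
move=> us1 as1 us2 as2 ta tE sub vs1 vs2 It.
have [E1 E2 E] := split_gensP (K := K) x (fun p => iff_refl (monomial_ideal K s1 p)) (fun p =>
  iff_refl (monomial_ideal K s2 p)).
have [u1 a1 _ _] := uniq_split_parts x us1 as1; have [_ _ u2 a2] := uniq_split_parts x us2 as2.
have IE : same_set I (monomial_ideal K (split_gens x s1 s2)) :=
  same_set_trans It (eq_monomial_ideal tE).
apply: (VSsplit (s := split_gens x s1 s2) vs1 vs2 (x := x)
  (s1 := [seq (U_(x) + u)%MM | u <- map (lift_mon x) s1])
  (s2 := map (lift_mon x) s2)).
- exact: same_set_trans IE (same_set_sym E).
- move=> p; rewrite !monomial_idealP => h m /h /aboveP[v /sub/aboveP[u us1' uv] vm].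
  by apply/aboveP; exists u => //; apply: lepm_trans vm.
- apply/min_mon_gensP; split=> //; last by move=> u v; rewrite -!tE; apply: ta.
  rewrite cat_uniq u1 u2 andbT; apply/hasPn=> _ /mapP[v _ ->]; apply/mapP=> -[_ /mapP[u _ ->]].
  move/(congr1 (fun m : 'X_{1..n.+1} => m x)); rewrite mnmDE mnm1E eqxx !lift_mon0.
  by [].
- by apply/min_mon_gensP; split=> //; exact: E1.
- by apply/min_mon_gensP; split=> //; exact: E2.
- exact: perm_refl.
Qed.

Definition power_gens n (c : 'I_n -> nat) (l : seq 'I_n) : seq 'X_{1..n} :=
  [seq (U_(j) *+ c j)%MM | j <- l].

Lemma power_gens_antichain n (c : 'I_n -> nat) l : uniq l -> {in l, forall j, (0 < c j)%N} ->
  uniq (power_gens c l) /\ antichain (power_gens c l).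
Proof.
move=> ul c0; have W j k : j \in l -> (U_(j) *+ c j <= U_(k) *+ c k)%MM -> j = k.
  move=> jl /mnm_lepP/(_ j); rewrite !mulmnE !mnm1E eqxx mul1n.
  by case: (k =P j) => // _; rewrite leqNgt c0.
split; last by move=> _ _ /mapP[j jl ->] /mapP[k kl ->] /(W _ _ jl) ->.
rewrite map_inj_in_uniq // => j k jl kl E; apply: W => //.
by rewrite E lepm_refl.
Qed.

(** If there are two generators, one of them is a variable x, which splits off with the
    unit ideal as I1. *)
Lemma vertex_splittable_powers n (c : 'I_n -> nat) l :
  uniq l -> {in l, forall j, (0 < c j)%N} ->
  {in l &, forall j k, (1 < c j)%N -> (1 < c k)%N -> j = k} ->
  vertex_splittable (monomial_ideal K (power_gens c l)).
Proof.
elim: n c l => [|n IH] c l ul c0 c1.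
  case: l ul c0 c1 => [|[]//] _ _ _; apply: VSzero => p; rewrite monomial_idealP; split=> [h|->].
    by apply/msuppnil0; case E: (msupp p) h => [//|m l] /(_ m); rewrite E inE eqxx => /(_ isT).
  exact: supported0.
have [up ap] := power_gens_antichain ul c0.
case: (boolP (has (fun j => c j == 1%N) l)) => [/hasP[x xl /eqP cx]|/hasPn c2]; last first.
  case: l ul c0 c1 c2 up ap => [|j [|k l]] ul c0 c1 c2 _ _.
  - apply: VSzero => p; rewrite monomial_idealP; split=> [h|->]; last exact: supported0.
    by apply/msuppnil0; case E: (msupp p) h => [//|m l] /(_ m); rewrite E inE eqxx => /(_ isT).
  - by apply: (@VSmonomial K _ _ (U_(j) *+ c j)%MM).
  have gt1 i : i \in [:: j, k & l] -> (1 < c i)%N.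
    by move=> il; rewrite ltn_neqAle c0 // eq_sym c2.
  have jE : j = k by apply: c1; rewrite ?gt1 // !inE eqxx ?orbT.
  by move: ul; rewrite jE /= inE eqxx.
pose l' := [seq k <- enum 'I_n | lift x k \in l].
have l'P k : (k \in l') = (lift x k \in l) by rewrite mem_filter mem_enum andbT.
have ul' : uniq l' by rewrite filter_uniq ?enum_uniq.
have c0' : {in l', forall j, (0 < c (lift x j))%N} by move=> j; rewrite l'P => /c0.
have [u2 a2] := power_gens_antichain ul' c0'.
have lE k : lift_mon x (U_(k) *+ c (lift x k)) = (U_(lift x k) *+ c (lift x k))%MM.
  apply/mnmP=> i; rewrite -lift_monU mulmnE; case: (unliftP x i) => [j|] ->.
    by rewrite !lift_monE mulmnE.
  by rewrite !lift_mon0.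
apply: (@VSsplit_gens _ x _ [:: 0%MM] (power_gens (c \o lift x) l') (power_gens c l)) => //.
- by move=> u v; rewrite !inE => /eqP-> /eqP->.
- move=> m; apply/mapP/idP => [[j jl ->]|].
    case: (unliftP x j) => [k|] jE.
      rewrite jE -lE mem_cat orbC map_f //; apply: (map_f (fun k => U_(k) *+ c (lift x k))%MM).
      by rewrite l'P -jE.
    rewrite jE cx mulm1n mem_cat; apply/orP; left; rewrite inE; apply/eqP.
    by apply/mnmP=> i; rewrite mnmDE; case: (unliftP x i) => [k|] ->;
      rewrite ?lift_monE ?lift_mon0 ?mnm0E addn0.
  rewrite mem_cat => /orP[|/mapP[_ /mapP[k kl' ->] ->]].
    rewrite inE => /eqP->; exists x => //; rewrite cx mulm1n.
    by apply/mnmP=> i; rewrite mnmDE; case: (unliftP x i) => [k|] ->;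
      rewrite ?lift_monE ?lift_mon0 ?mnm0E addn0.
  by exists (lift x k); rewrite ?lE // -l'P.
- move=> m _; apply/aboveP; exists 0%MM; rewrite ?inE //.
  by apply/mnm_lepP=> i; rewrite mnm0E.
- by apply: (@VSmonomial K _ _ 0%MM).
- apply: IH => // j k; rewrite !l'P => jl kl cj ck.
  by apply: (@lift_inj _ x); apply: c1.
Qed.

Lemma pattern_free_pull (T T' : finType) (f : T' -> T) (e : rel T) hv : injective f ->
  pattern_free e hv -> pattern_free (fun x y => e (f x) (f y)) (fun x => hv (f x)).
Proof.
move=> fI [irr asym c4 c5 k2 out path l5 l6].
split=> //.
- by move=> x y; apply: asym.
- by move=> a b c d ab bc cd da ac bd; apply: (c4 (f a) (f b) (f c) (f d)); rewrite ?(inj_eq fI).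
- by move=> a b c d g *; apply: (c5 (f a) (f b) (f c) (f d) (f g)).
- by move=> a b c d ab cd ne; apply: (k2 (f a) (f b) (f c) (f d)); rewrite ?(inj_eq fI).
- by move=> a b d ab ad; apply: fI; apply: (out (f a)).
- by move=> a b c; apply: path.
- by move=> a b c d g *; apply: (l5 (f a) (f b) (f c) (f d) (f g)).
- by move=> a b c d g h *; apply: (l6 (f a) (f b) (f c) (f d) (f g) (f h)).
Qed.

(** A splitting vertex x gives I1 generated by pure powers of its neighbours,
    at most one of which is not a variable by [pf_heavy_out], and I2 the ideal of
    the induced subgraph without x. *)
Lemma vertex_splittable_edges n (e : rel 'I_n) (w : 'I_n -> nat) (I : mpset K n) :
  pattern_free e (fun x => 1 < w x)%N -> (forall x, (0 < w x)%N) ->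
  same_set I (monomial_ideal K (edge_gens e w)) -> vertex_splittable I.
Proof.
elim: n e w I => [|n IH] e w I pf w0 IE.
  apply: VSzero => p; rewrite (IE p) monomial_idealP; split=> [h|->]; last exact: supported0.
  apply/msuppnil0; case E: (msupp p) h => [//|m l] /(_ m); rewrite E inE eqxx => /(_ isT).
  by case/aboveP=> u /edge_gensP[[]].
have [irr asym _ _ _ out _ _ _] := pf.
case: (pickP (fun p : 'I_n.+1 * 'I_n.+1 => e p.1 p.2)) => [[x0 y0] /= xy0|e0]; last first.
  apply: VSzero => p; rewrite (IE p) monomial_idealP; split=> [h|->]; last exact: supported0.
  apply/msuppnil0; case E: (msupp p) h => [//|m l] /(_ m); rewrite E inE eqxx => /(_ isT).
  by case/aboveP=> u /edge_gensP[x [y [xy _]]]; have := e0 (x, y); rewrite /= xy.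
have [|x [xin cov]] := splitting_vertex_exists pf; first by exists x0, y0.
pose e' (i j : 'I_n) := e (lift x i) (lift x j).
pose w' (i : 'I_n) := w (lift x i).
pose c (j : 'I_n) := if e (lift x j) x then 1%N else w' j.
pose l := enum [pred j : 'I_n | adj e x (lift x j)].
have lP j : (j \in l) = adj e x (lift x j) by rewrite mem_enum.
have c0 : {in l, forall j, (0 < c j)%N} by move=> j _; rewrite /c; case: ifP => // _; apply: w0.
have ul : uniq l := enum_uniq _.
have [u1 a1] := power_gens_antichain ul c0.
have pf' : pattern_free e' (fun i => 1 < w' i)%N by apply: (pattern_free_pull (@lift_inj _ x) pf).
have [irr' asym' _ _ _ _ _ _ _] := pf'.
have [u2 a2] := edge_gens_uniq irr' asym' (fun i => w0 (lift x i)).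
have [_ a] := edge_gens_uniq irr asym w0.
have wx y : e y x -> w x = 1%N.
  move=> yx; have := xin y; rewrite /heavy yx /= -leqNgt => le.
  by apply/eqP; rewrite eqn_leq le w0.
have lUk j k : lift_mon x (U_(j) *+ k) = (U_(lift x j) *+ k)%MM.
  apply/mnmP=> i; rewrite -lift_monU mulmnE; case: (unliftP x i) => [j'|] ->.
    by rewrite !lift_monE mulmnE.
  by rewrite !lift_mon0.
have lE i j : lift_mon x (edge_mon w' i j) = edge_mon w (lift x i) (lift x j).
  by rewrite lift_monD lift_monU lUk.
have nb_in y j : y = lift x j -> e y x -> edge_mon w y x = (U_(x) + lift_mon x (U_(j) *+ c j))%MM.
  by move=> -> yx; rewrite /c yx lUk /edge_mon (wx _ yx) !mulm1n addmC.
have nb_out y j : y = lift x j -> e x y ->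
  edge_mon w x y = (U_(x) + lift_mon x (U_(j) *+ c j))%MM.
  by move=> -> xy; rewrite /c (negPf (asym _ _ xy)) lUk.
apply: (@VSsplit_gens _ x _ (power_gens c l) (edge_gens e' w') (edge_gens e w)) => //.
- move=> m; rewrite mem_cat; apply/edge_gensP/orP => [[y [z [yz ->]]]|].
    case: (unliftP x y) => [j|] yE; case: (unliftP x z) => [k|] zE.
    + right; rewrite yE zE -lE; apply: map_f; apply/edge_gensP; exists j, k.
      by rewrite /e' -yE -zE.
    + left; rewrite zE in yz *; rewrite (nb_in _ _ yE yz); do 2!apply: map_f.
      by apply: (map_f (fun j => U_(j) *+ c j)%MM); rewrite lP /adj -yE yz orbT.
    + left; rewrite yE in yz *; rewrite (nb_out _ _ zE yz); do 2!apply: map_f.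
      by apply: (map_f (fun j => U_(j) *+ c j)%MM); rewrite lP /adj -zE yz.
    + by have := irr x; rewrite -{1}yE -zE yz.
  case=> [/mapP[_ /mapP[_ /mapP[j jl ->] ->] ->]|].
    move: jl; rewrite lP => /orP[] xy.
      by exists x, (lift x j); split=> //; rewrite (nb_out _ j).
    by exists (lift x j), x; split=> //; rewrite (nb_in _ j).
  case/mapP=> u /edge_gensP[j [k [jk ->]]] ->.
  by exists (lift x j), (lift x k); rewrite lE.
- move=> _ /edge_gensP[j [k [jk ->]]].
  have lift_ne i : lift x i != x by rewrite eq_sym neq_lift.
  have gen i (u : 'X_{1..n}) : adj e x (lift x i) -> (c i <= u i)%N -> above (power_gens c l) u.
    move=> xi ci; apply/aboveP; exists (U_(i) *+ c i)%MM; first by apply: (map_f (fun j =>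
      U_(j) *+ c j)%MM); rewrite lP.
    apply/mnm_lepP=> i'; rewrite mulmnE mnm1E; case: eqP => [<-|//]; by rewrite mul1n.
  have [xk|xk] := boolP (adj e x (lift x k)).
    apply: (gen k) => //; rewrite edge_monE eqxx mul1n /c; case: ifP => _; last exact: leq_addl.
    by rewrite addn_gt0 w0 orbT.
  have := cov _ _ jk (lift_ne j) (lift_ne k); rewrite (negPf xk) /= => jx.
  apply: (gen j); rewrite /adj; first by case/orP: jx => [->|/andP[->]]; rewrite ?orbT.
  rewrite edge_monE eqxx /c; case: ifP => jx' //=; rewrite jx' /= -leqNgt in jx.
  by case/andP: jx => _ le; apply: leq_trans le (leq_addr _ _).
- apply: vertex_splittable_powers => // j k; rewrite !lP /c => xj xk.
  case: ifP => // jx; case: ifP => // kx cj ck; apply: (@lift_inj _ x).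
  apply: (out x); rewrite /heavy ?cj ?ck andbT.
    by move: xj; rewrite /adj jx orbF.
  by move: xk; rewrite /adj kx orbF.
- by apply: (IH e' w') => // i; apply: w0.
Qed.

End EdgeIdeals.

(** * Obstructions to linearity *)

Section Obstructions.
Context (K : fieldType) (n : nat).
Local Notation R := {mpoly K[n]}.
Implicit Types (N : pred 'X_{1..n}).

Lemma ksign0 (t : 'I_n) : ksign K set0 t = 1.
Proof. by rewrite /ksign /rank_sign (_ : [set s in _ | _] = set0) ?cards0 //; apply/setP=> s;
  rewrite !inE. Qed.

Lemma ksign1 (u r : 'I_n) : ksign K [set u] r = (-1) ^+ (u < r)%N.
Proof. by rewrite -[[set u]]setU0 ksignU ?inE // ksign0 mulr1. Qed.

Lemma ksign1N (u r : 'I_n) : u != r -> ksign K [set u] r = - ksign K [set r] u.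
Proof.
by rewrite !ksign1; case: ltngtP => [_ _|_ _|/val_inj->]; rewrite ?eqxx ?expr1 ?expr0 ?opprK.
Qed.

Lemma mcoeffXXM (u v : 'I_n) (p : R) a :
  ('X_u * 'X_v * p)@_a = if (U_(u) + U_(v) <= a)%MM then p@_(a - (U_(u) + U_(v))) else 0.
Proof. by rewrite -mpolyXD mcoeffXM. Qed.

(** In multidegree a, first homology is that of a graph: the vertices are the
    variables u with a - u in N, the edges the pairs with a - u - r in N.
    Vanishing means connectedness, so any cut X separating s from t is crossed by
    an edge. The functional detecting a cut adds up the coefficients over X; on a
    boundary the pairs inside X cancel. *)
Lemma acyclic_cut d N (a : 'X_{1..n}) (X : {set 'I_n}) s t :
    acyclic_mon K 1 d N -> s \in X -> t \notin X -> (0 < a s)%N -> (0 < a t)%N ->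
    N (a - U_(s))%MM -> N (a - U_(t))%MM -> (d.+2 <= mdeg a)%N ->
  exists s' t', [/\ s' \in X, t' \notin X, (U_(s') + U_(t') <= a)%MM &
    N (a - (U_(s') + U_(t')))%MM].
Proof.
move=> ac sX tX as0 at0 Ns Nt da.
have st : s != t by apply: contraTneq sX => ->.
pose f (T : {set 'I_n}) : R := if T == [set s] then 'X_[a - U_(s)]
  else if T == [set t] then - 'X_[a - U_(t)] else 0.
have fs : f [set s] = 'X_[a - U_(s)] by rewrite /f eqxx.
have ft : f [set t] = - 'X_[a - U_(t)].
  by rewrite /f (inj_eq set1_inj) eq_sym (negPf st) eqxx.
have f0 (u : 'I_n) : u != s -> u != t -> f [set u] = 0.
  by move=> us ut; rewrite /f !(inj_eq set1_inj) (negPf us) (negPf ut).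
have f1 : concentrated 1 f.
  by move=> T; rewrite /f; case: (T =P _) => [->|_]; [rewrite cards1 | case: (T =P _) =>
    [->|//]; rewrite cards1].
have Xm u : (0 < a u)%N -> 'X_u * 'X_[a - U_(u)] = 'X_[a] :> R.
  by move=> au; rewrite -mpolyXD addmC submK // lep1mP -lt0n.
have degm u : (0 < a u)%N -> (d < mdeg (a - U_(u))%MM)%N.
  move=> au; have um : (U_(u) <= a)%MM by rewrite lep1mP -lt0n.
  by rewrite -ltnS; apply: leq_trans da _; rewrite -{1}(submK um) mdegD mdeg1 addn1.
have [//|||T|g [gi gN gE]] := ac f.
- move=> T; rewrite /f; case: ifP => _; first exact: supportedX.
  by case: ifP => _; [apply/supportedN/supportedX | apply: supported0].
- move=> T; rewrite /f; case: ifP => _; first exact/supportedX/degm.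
  by case: ifP => _; [exact/supportedN/supportedX/degm | apply: supported0].
- case: (set_0Vmem T) => [->|[u uT]].
    rewrite /koszul (eq_bigl xpredT) => [|u]; last by rewrite inE.
    rewrite (bigD1 s) // (bigD1 t) 1?eq_sym //= !setU0 fs ft !ksign0 !mul1r mulrN !Xm //.
    rewrite big1 ?addr0 ?subrr // => u /andP[us ut].
    by rewrite setU0 f0 // mulr0.
  apply: big1 => v vT; rewrite f1 ?mulr0 // cardsU1 vT.
  by rewrite -[X in _ != X]addn0 eqn_add2l -lt0n card_gt0; apply/set0Pn; exists u.
case: (boolP [exists s', [exists t', [&& s' \in X, t' \notin X, (U_(s') + U_(t') <= a)%MM &
    N (a - (U_(s') + U_(t')))%MM]]]) => [/existsP[s' /existsP[t' /and4P[? ? ? ?]]]|none].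
  by exists s', t'.
have sum1 : \sum_(u in X) 'X_u * f [set u] = 'X_[a].
  rewrite (bigD1 s) //= fs Xm // big1 ?addr0 // => u /andP[uX us].
  by rewrite f0 ?mulr0 //; apply: contraTneq uX => ->.
pose F u r : R := if [&& u \in X, r \in X & u != r]
  then 'X_u * (ksign K [set u] r * 'X_r * g (r |: [set u])) else 0.
have F0 : \sum_u \sum_r F u r = 0.
  apply: antisym_sum0 => [u|u r ur]; first by rewrite /F eqxx !andbF.
  rewrite /F [r == u]eq_sym andbCA; case: ifP => _; last by rewrite oppr0.
  by rewrite (ksign1N ur) [r |: _]setUC; ring.
have := congr1 (mcoeff a) sum1; rewrite mcoeffX eqxx => E; exfalso.
suff : (\sum_(u in X) 'X_u * f [set u])@_a = 0 by rewrite E => /eqP; rewrite oner_eq0.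
transitivity ((\sum_u \sum_r F u r)@_a); last by rewrite F0 mcoeff0.
rewrite [LHS]raddf_sum [RHS]raddf_sum /= [LHS]big_mkcond.
apply: eq_bigr => u _ /=; rewrite [RHS]raddf_sum /=; case: ifP => uX; last first.
  by rewrite big1 // => r _; rewrite /F uX mcoeff0.
rewrite gE /koszul mulr_sumr raddf_sum [LHS]big_mkcond /=; apply: eq_bigr => r _.
rewrite in_set1 eq_sym /F uX /=; case: (boolP (r \in X)) => rX /=; first by case: ifP;
  rewrite ?mcoeff0.
rewrite mcoeff0; case: ifP => // _.
rewrite (_ : _ * _ = ksign K [set u] r * ('X_u * 'X_r * g (r |: [set u]))); last by ring.
rewrite raddfMsign /= mcoeffXXM; case: ifP => [le|]; last by rewrite mulr0.
have /supported_coef-> := gN (r |: [set u]); rewrite ?mulr0 //.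
apply: contra none => Na; apply/existsP; exists u; apply/existsP; exists r.
by rewrite uX rX le.
Qed.

(** The boundary of x_a * x_b * e_(C - a - b) has its coefficients in the ideal, although
    x_a * x_b is not in it, and so bounds a chain g of the ideal. The cycle
    f0 - g is in turn a boundary, of h say. The coefficients gam v of h are then
    equal along pairs u, v whose product is not in the ideal, where f0 - g vanishes,
    but differ at a and b. So a chain of such pairs from a to b is impossible. *)
Lemma acyclic_copath N (C : {set 'I_n}) a b p :
    acyclic_mon K (#|C| - 3)%N 2 N -> a \in C -> b \in C -> a != b ->
    ~~ N (U_(a) + U_(b))%MM -> (2 < #|C|)%N ->
    (forall t, t \in C -> t != a -> t != b -> N (U_(t) + (U_(a) + U_(b)))%MM) ->
    path (fun u v => [&& v \in C, u != v, ~~ N (U_(u) + U_(v))%MM &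
      [set u; v] != [set a; b]]) a p ->
  last a p = b -> False.
Proof.
move=> ac aC bC ab nab C3 tri.
pose D (u v : 'I_n) := C :\ u :\ v.
have cardD u v : u \in C -> v \in C -> u != v -> #|D u v| = (#|C| - 2)%N.
  move=> uC vC uv; rewrite (cardsD1 u C) uC (cardsD1 v (C :\ u)) !inE eq_sym uv vC.
  by rewrite addnA addKn.
have DK u v : u \in C -> v \in C -> C :\: D u v = [set u; v].
  move=> uC vC; apply/setP=> x; rewrite !inE.
  by case: eqP => [->|_]; case: eqP => [->|_] //=; rewrite ?uC ?vC //= andNb.
have k2 : (#|C| - 2)%N = (#|C| - 3)%N.+1 by rewrite -subSn.
pose f0 (T : {set 'I_n}) : R := if T == D a b then 'X_[U_(a) + U_(b)] else 0.
have f0i : concentrated (#|C| - 3)%N.+1 f0.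
  by move=> T; rewrite /f0; case: (T =P _) => // ->; rewrite cardD // k2 eqxx.
have f02 T : ord_ge 2 (f0 T).
  rewrite /f0; case: ifP => _; last exact: supported0.
  by apply: supportedX; rewrite mdegD !mdeg1.
have [||||g [gi gN gE]] := ac (koszul f0).
- exact: concentrated_koszul.
- move=> T; apply: supported_sum => t tT; rewrite /f0; case: eqP => [E|_]; last first.
    by rewrite mulr0; apply: supported0.
  have : t \in D a b by rewrite -E setU11.
  rewrite !inE => /and3P[tb ta tC]; rewrite -mulrA -mpolyXD.
  move=> m mm; suff -> : m = (U_(t) + (U_(a) + U_(b)))%MM by apply: tri.
  apply/eqP; apply: contraTT mm => ne; rewrite mcoeff_msupp negbK raddfMsign /= mcoeffX.
  by rewrite [_ == m]eq_sym (negPf ne) mulr0.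
- by move=> T; apply: ord_ge_koszul.
- by move=> T; apply: koszul_koszul.
have [||||h [_ _ hE]] := @koszul_exact K n set0 (#|C| - 3)%N.+1 0 (fun T => f0 T - g T).
- by move=> T Ti; rewrite f0i // gi // subrr.
- by move=> T; apply: ord_ge0.
- by move=> T; rewrite koszulB gE subrr; apply: supported0.
- by rewrite cards0.
pose Gam v : R := ksign K (C :\ v) v * h (C :\ v).
pose gam v := (Gam v)@_(U_(v)).
have key u v : u \in C -> v \in C -> u != v ->
    exists k, (f0 (D u v) - g (D u v))@_(U_(u) + U_(v)) = (-1) ^+ k * (gam v - gam u).
  move=> uC vC uv; have /var_ideal0/eqP := hE (D u v); rewrite subr_eq0 => /eqP->.
  set T := D u v.
  have uT : u \notin T by rewrite !inE eqxx andbF.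
  have vT : v \notin T by rewrite !inE eqxx.
  have uTE : u |: T = C :\ v by apply/setP=> x; rewrite !inE; case: (x =P u) => [->|//];
    rewrite uv uC.
  have vTE : v |: T = C :\ u by rewrite /T /D setD1K // !inE eq_sym uv.
  have anti := ksign_anti K uT vT uv; rewrite uTE vTE in anti.
  have sqv := ksign_sq K (C :\ v) v; have squ := ksign_sq K (C :\ u) u.
  have squT := ksign_sq K T u; have sqvT := ksign_sq K T v.
  have t1 : ksign K T u * 'X_u * h (C :\ v) = ksign K T u * ksign K (C :\ v) v * ('X_u * Gam v).
    rewrite /Gam -[LHS]mul1r -sqv; ring.
  have tE : ksign K T v = - (ksign K T u * ksign K (C :\ v) v) * ksign K (C :\ u) u.
    by rewrite mulNr -mulrA anti mulrN opprK mulrA squT mul1r.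
  have t2 : ksign K T v * 'X_v * h (C :\ u) = - (ksign K T u * ksign K (C :\ v) v) * ('X_v * Gam u).
    by rewrite /Gam {1}tE; ring.
  exists (rank_sign T u + rank_sign (C :\ v) v)%N.
  rewrite /koszul (bigD1 u) // (bigD1 v) 1?eq_sym ?uv ?vT //= uTE vTE t1 t2 addrA mcoeffD.
  rewrite [X in _ + X]raddf_sum /= big1 ?addr0 => [|t /andP[/andP[tT tu] tv]].
    rewrite mulNr -mulrBr -exprD raddfMsign /= mcoeffB; congr (_ * (_ - _)).
      by rewrite mulrC mcoeffMX.
    by rewrite mulrC addmC mcoeffMX.
  rewrite -mulrA raddfMsign /= mcoeffXUM mnmDE !mnm1E.
  by rewrite eq_sym (negPf tu) eq_sym (negPf tv) mulr0.
have step u v : u \in C -> v \in C -> u != v -> ~~ N (U_(u) + U_(v))%MM ->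
    [set u; v] != [set a; b] -> gam u = gam v.
  move=> uC vC uv nuv ne; have [k] := key u v uC vC uv.
  have -> : f0 (D u v) = 0.
    rewrite /f0; case: eqP => // E; case/eqP: ne.
    by rewrite -(DK u v) // E DK.
  have /supported_coef gc := gN (D u v); rewrite sub0r mcoeffN gc // oppr0 => /esym/eqP.
  by rewrite mulf_eq0 signr_eq0 subr_eq0 => /eqP.
have gab : gam a != gam b.
  have [k] := key a b aC bC ab; have /supported_coef gc := gN (D a b).
  rewrite mcoeffB gc // subr0 /f0 eqxx mcoeffX eqxx => E.
  by apply/eqP=> G; move: E => /eqP; rewrite G subrr mulr0 oner_eq0.
move=> pth lp; case/eqP: gab; rewrite -lp; move: pth; set r := (fun u v => _).
suff W q u : u \in C -> path r u q -> gam u = gam (last u q) by apply: W.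
elim: q u => //= v q IH u uC /andP[/and4P[vC uv nuv ne] pth].
by rewrite (step u v) // IH.
Qed.

End Obstructions.

Local Close Scope ring_scope.

Section EdgeObstructions.
Context (K : fieldType) (n : nat) (e : rel 'I_n) (w : 'I_n -> nat).

Lemma edge_mon_leq x y (m : 'X_{1..n}) : x != y ->
  (edge_mon w x y <= m)%MM = (0 < m x) && (w y <= m y).
Proof.
move=> xy; apply/mnm_lepP/andP => [h|[h1 h2] z].
  have := h x; have := h y; rewrite !edge_monE !eqxx (negPf xy) eq_sym (negPf xy).
  by rewrite addn0 mul1n.
rewrite edge_monE; case: (x =P z) => [<-|_]; first by rewrite eq_sym (negPf xy).
by case: (y =P z) => [<-|//]; rewrite mul1n.
Qed.

Lemma mdeg_edge_mon x y : mdeg (edge_mon w x y) = (w y).+1.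
Proof. by rewrite mdegD mdegMn !mdeg1 mul1n. Qed.

Hypotheses (irr : forall x, ~~ e x x) (asym : forall x y, e x y -> ~~ e y x)
  (w0 : forall x, 0 < w x).

Lemma edge_ne x y : e x y -> x != y.
Proof. by apply: contraTneq => ->; apply: irr. Qed.

Lemma edge_compP d (m : 'X_{1..n}) : reflect
  (exists x y, [/\ e x y, 0 < m x, w y <= m y, w y < d & d <= mdeg m])
  (comp_mon (edge_gens e w) d m).
Proof.
apply: (iffP (comp_monP _ _ _)).
  case=> u /edge_gensP[x [y [xy ->]]]; rewrite edge_mon_leq ?edge_ne // mdeg_edge_mon.
  by case/and3P=> /andP[? ?] ? ?; exists x, y.
move=> [x [y [xy mx my wd dm]]]; exists (edge_mon w x y); first by apply/edge_gensP; exists x, y.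
by rewrite edge_mon_leq ?edge_ne // mx my mdeg_edge_mon wd.
Qed.

Local Notation hv := (fun x => 1 < w x).

Hypothesis lin : forall i d, acyclic_mon K i d (comp_mon (edge_gens e w) d).

Lemma edge_cut d (M : 'X_{1..n}) (X : {set 'I_n}) s t x1 y1 x2 y2 :
  s \in X -> t \notin X -> d.+2 <= mdeg M -> 0 < M s -> 0 < M t ->
  [/\ e x1 y1, w y1 < d, (s == x1) < M x1 & (s == y1) + w y1 <= M y1] ->
  [/\ e x2 y2, w y2 < d, (t == x2) < M x2 & (t == y2) + w y2 <= M y2] ->
  exists s' t' x y, [/\ s' \in X, t' \notin X, 0 < M s', 0 < M t' &
    [/\ e x y, (s' == x) + (t' == x) < M x & (s' == y) + (t' == y) + w y <= M y]].
Proof.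
move=> sX tX dM Ms Mt [e1 wd1 Mx1 My1] [e2 wd2 Mx2 My2].
have degm u : 0 < M u -> d <= mdeg (M - U_(u))%MM.
  move=> au; have um : (U_(u) <= M)%MM by rewrite lep1mP -lt0n.
  by move: dM; rewrite -{1}(submK um) mdegD mdeg1 addn1 ltnS => /ltnW.
have [||s' [t' [sX' tX' le /edge_compP[x [y [exy mx my _ _]]]]]] :=
  acyclic_cut (@lin 1 d) sX tX Ms Mt _ _ dM.
- apply/edge_compP; exists x1, y1; rewrite !mnmBE !mnm1E subn_gt0.
  by rewrite leq_subRL ?degm // (leq_trans (leq_addr _ _) My1).
- apply/edge_compP; exists x2, y2; rewrite !mnmBE !mnm1E subn_gt0.
  by rewrite leq_subRL ?degm // (leq_trans (leq_addr _ _) My2).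
have := mnm_lepP le s'; have := mnm_lepP le t'; rewrite !mnmDE !mnm1E !eqxx => lt' ls'.
rewrite !(mnmBE, mnmDE, mnm1E) subn_gt0 in mx my.
exists s', t', x, y; split=> //.
- exact: leq_trans (leq_addr _ 1) ls'.
- exact: leq_trans (leq_addl _ 1) lt'.
split=> //; rewrite -leq_subRL // ltnW // -subn_gt0; exact: leq_trans (w0 y) my.
Qed.

Lemma avoid_lt (s t z : 'I_n) : (s == z) + (t == z) < 1 -> s != z /\ t != z.
Proof. by case: eqP; case: eqP. Qed.

Lemma avoid_le (s t z : 'I_n) k : (s == z) + (t == z) + k <= k -> s != z /\ t != z.
Proof. by rewrite -[X in _ <= X]add0n leq_add2r; apply: avoid_lt. Qed.

(** The multidegree is the least common multiple of the two generators. The cut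
    separates b from d, and a is put on the side on which the generator of a
    possible edge between b and d cannot cross the cut. *)
Lemma edges_heavy_out a b d : heavy e hv a b -> heavy e hv a d -> b = d.
Proof.
move=> /andP[ab hb] /andP[ad hd]; apply/eqP; apply: contraT => bd; exfalso.
wlog le : b d ab hb ad hd bd / w b <= w d.
  by move=> W; case: (leqP (w b) (w d)) => [|/ltnW] le; [apply: (W b d) | apply: (W d b);
    rewrite // eq_sym].
have nab := edge_ne ab; have nad := edge_ne ad.
pose M := (U_(a) + (U_(b) *+ w b + U_(d) *+ w d))%MM.
have ME z : M z = (a == z) + ((b == z) * w b + (d == z) * w d).
  by rewrite !mnmDE !mulmnE !mnm1E.
have Ma : M a = 1 by rewrite ME eqxx ![_ == a]eq_sym (negPf nab) (negPf nad).
have Mb : M b = w b by rewrite ME eqxx (negPf nab) [d == b]eq_sym (negPf bd) addn0 mul1n.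
have Md : M d = w d by rewrite ME eqxx (negPf nad) (negPf bd) mul1n.
have M0 z : 0 < M z -> [|| z == a, z == b | z == d].
  by rewrite ME ![_ == z]eq_sym; do 3!case: eqP => //.
have dM : mdeg M = (1 + (w b + w d))%N by rewrite !mdegD !mdegMn !mdeg1 !mul1n.
pose X := [set z | (z == b) || (z == a) && e b d].
have [|||||||s [t [x [y [sX tX Ms Mt [exy Mx My]]]]]] :=
    @edge_cut (w d).+1 M X b d a d a b.
- by rewrite inE eqxx.
- by rewrite inE eq_sym (negPf bd) eq_sym (negPf nad).
- by rewrite dM; move: hb; lia.
- by rewrite Mb w0.
- by rewrite Md w0.
- by rewrite Ma Md eq_sym (negPf nab) (negPf bd); split.
- by rewrite Ma Mb eq_sym (negPf nad) eq_sym (negPf bd); split.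
have ub : e b a = false by apply: negbTE; apply: asym.
have ud : e d a = false by apply: negbTE; apply: asym.
have xM : 0 < M x by apply: leq_ltn_trans Mx.
have yM : 0 < M y by apply: leq_trans (w0 y) _; apply: leq_trans My; apply: leq_addl.
move: sX tX; rewrite !inE => sX tX.
have nst : s != t by apply: contraNneq tX => <-.
have Es := M0 s Ms; have Et := M0 t Mt.
case/or3P: (M0 x xM) (M0 y yM) exy => /eqP Ex /or3P[] /eqP Ey; subst x y => exy;
  rewrite ?(negPf (irr _)) ?ub ?ud in exy => //.
- move: Mx My; rewrite Ma Mb => /avoid_lt[/negPf sa /negPf ta] /avoid_le[/negPf sb /negPf tb].
  by case/negP: nst; rewrite sa sb ta tb in Es Et; rewrite (eqP Es) (eqP Et).
- move: Mx My; rewrite Ma Md => /avoid_lt[/negPf sa /negPf ta] /avoid_le[/negPf sb /negPf tb].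
  by case/negP: nst; rewrite sa sb ta tb ?orbF in Es Et; rewrite (eqP Es) (eqP Et).
- move: My; rewrite Md => /avoid_le[_ /negPf td].
  by move: tX; rewrite exy andbT; case/or3P: Et => [->|->|]; rewrite ?orbT ?td.
- move: My; rewrite Mb => /avoid_le[/negPf sb _].
  by move: sX; rewrite sb (negPf (asym exy)) andbF.
Qed.

(** In the least common multiple of the generators of a b and b c, only the
    generator c * a of a light edge can connect the two. *)
Lemma edges_heavy_path a b c : heavy e hv a b -> heavy e hv b c -> e c a && ~~ hv a.
Proof.
move=> /andP[ab hb] /andP[bc hc]; apply: contraT => nca; exfalso.
have nab := edge_ne ab; have nbc := edge_ne bc.
have nac : a != c by apply: contraTneq ab => ->; apply: asym.
pose M := (U_(a) + (U_(b) *+ w b + U_(c) *+ w c))%MM.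
have ME z : M z = (a == z) + ((b == z) * w b + (c == z) * w c).
  by rewrite !mnmDE !mulmnE !mnm1E.
have Ma : M a = 1 by rewrite ME eqxx ![_ == a]eq_sym (negPf nab) (negPf nac).
have Mb : M b = w b by rewrite ME eqxx (negPf nab) [c == b]eq_sym (negPf nbc) addn0 mul1n.
have Mc : M c = w c by rewrite ME eqxx (negPf nac) (negPf nbc) mul1n.
have M0 z : 0 < M z -> [|| z == a, z == b | z == c].
  by rewrite ME ![_ == z]eq_sym; do 3!case: eqP => //.
have dM : mdeg M = (1 + (w b + w c))%N by rewrite !mdegD !mdegMn !mdeg1 !mul1n.
have [|||||||s [t [x [y [sX tX Ms Mt [exy Mx My]]]]]] :=
    @edge_cut (maxn (w b) (w c)).+1 M [set c] c a a b b c.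
- by rewrite inE eqxx.
- by rewrite inE.
- by rewrite dM; move: hb hc; lia.
- by rewrite Mc w0.
- by rewrite Ma.
- by rewrite Ma Mb ltnS leq_maxl eq_sym (negPf nac) eq_sym (negPf nbc); split.
- by rewrite Mb Mc ltnS leq_maxr (negPf nab) (negPf nac); split=> //; apply: w0.
have xM : 0 < M x by apply: leq_ltn_trans Mx.
have yM : 0 < M y by apply: leq_trans (w0 y) _; apply: leq_trans My; apply: leq_addl.
have ub : e b a = false by apply: negbTE; apply: asym.
have uc : e c b = false by apply: negbTE; apply: asym.
move: sX tX; rewrite !inE => /eqP Es tc; subst s.
have Et := M0 t Mt.
case/or3P: (M0 x xM) (M0 y yM) exy => /eqP Ex /or3P[] /eqP Ey; subst x y => exy;
  rewrite ?(negPf (irr _)) ?ub ?uc in exy => //.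
- move: Mx My; rewrite Ma Mb => /avoid_lt[_ /negPf ta] /avoid_le[_ /negPf tb].
  by rewrite ta tb (negPf tc) in Et.
- by move: My; rewrite Mc => /avoid_le[]; rewrite eqxx.
- by move: My; rewrite Mc => /avoid_le[]; rewrite eqxx.
- case/negP: nca; rewrite exy -leqNgt -Ma; apply: leq_trans (leq_addl _ _) My.
Qed.

(** The cut separates {a, b} from {c, d} in the product of the two generators. An
    edge crossing it has as its head b, d, or a vertex whose exponent there is 1. *)
Lemma edges_2K2 a b c d : e a b -> e c d -> [&& a != c, a != d, b != c & b != d] ->
  [|| light e hv a c, e a d, light e hv a d, e c b, light e hv c b | adj e b d].
Proof.
wlog le : a b c d / w b <= w d.
  move=> W ab cd /and4P[ac ad bc bd]; case: (leqP (w b) (w d)) => [|/ltnW] le.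
    by apply: W => //; apply/and4P.
  have := W c d a b le cd ab; rewrite ![c == _]eq_sym ![d == _]eq_sym ac ad bc bd => /(_ isT).
  rewrite lightC [adj e d b]adjC.
  by case/or4P=> [->|->|->|/or3P[->|->|->]]; rewrite ?orbT.
move=> ab cd /and4P[ac ad bc bd].
have nab := edge_ne ab; have ncd := edge_ne cd.
pose M := (edge_mon w a b + edge_mon w c d)%MM.
have ME z : M z = ((a == z) + (b == z) * w b) + ((c == z) + (d == z) * w d).
  by rewrite mnmDE !edge_monE.
have Ma : M a = 1 by rewrite ME eqxx ![_ == a]eq_sym (negPf nab) (negPf ac) (negPf ad).
have Mb : M b = w b by rewrite ME eqxx ![_ == b]eq_sym [b == a]eq_sym (negPf nab)
  (negPf bc) (negPf bd) addn0 mul1n.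
have Mc : M c = 1 by rewrite ME eqxx [d == c]eq_sym (negPf ncd) (negPf ac) (negPf bc).
have Md : M d = w d by rewrite ME eqxx (negPf ncd) (negPf ad) (negPf bd) mul1n.
have M0 z : 0 < M z -> [|| z == a, z == b, z == c | z == d].
  by rewrite ME ![_ == z]eq_sym; do 4!case: eqP => //.
have dM : mdeg M = (w b).+1 + (w d).+1 by rewrite mdegD !mdeg_edge_mon.
have [|||||||s [t [x [y [sX tX Ms Mt [exy Mx My]]]]]] :=
    @edge_cut (w d).+1 M [set a; b] a c c d a b.
- by rewrite !inE eqxx.
- by rewrite !inE ![c == _]eq_sym (negPf ac) (negPf bc).
- by rewrite dM; move: (w0 b); lia.
- by rewrite Ma.
- by rewrite Mc.
- by rewrite Mc Md (negPf ac) (negPf ad); split.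
- by rewrite Ma Mb eq_sym (negPf ac) eq_sym (negPf bc); split.
have xM : 0 < M x by apply: leq_ltn_trans Mx.
have yM : 0 < M y by apply: leq_trans (w0 y) _; apply: leq_trans My; apply: leq_addl.
move: sX tX; rewrite !inE negb_or => sX /andP[ta tb].
have la z : 0 < M z -> z != b -> z != d -> M z = 1.
  by move=> /M0/or4P[]/eqP->; rewrite ?eqxx.
have lgt z u : e u z -> w z <= 1 -> light e hv u z by move=> uz; rewrite /light uz leqNgt => ->.
have Et := M0 t Mt; rewrite (negPf ta) (negPf tb) /= in Et.
have My1 : M y = 1 -> w y <= 1 by move=> E; rewrite -E; apply: leq_trans My; apply: leq_addl.
case/or4P: (M0 x xM) (M0 y yM) exy My1 => /eqP Ex /or4P[] /eqP Ey; subst x y => exy My1;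
  rewrite ?(negPf (irr _)) ?(negPf (asym ab)) ?(negPf (asym cd)) in exy => //;
  rewrite /adj ?exy ?orbT //.
- move: Mx My; rewrite Ma Mb => /avoid_lt[/negPf sa _] /avoid_le[/negPf sb _].
  by rewrite sa sb in sX.
- by rewrite (lgt c a) ?My1.
- by rewrite [light _ _ c b]lightC (lgt c b) ?My1 ?orbT.
- by rewrite [light _ _ a c]lightC (lgt a c) ?My1.
- move: Mx My; rewrite Mc Md => /avoid_lt[_ /negPf tc] /avoid_le[_ /negPf td].
  by rewrite tc td in Et.
- by rewrite [light _ _ a d]lightC (lgt a d) ?My1 ?orbT.
Qed.

Lemma light_comp u v : u != v -> comp_mon (edge_gens e w) 2 (U_(u) + U_(v))%MM = light e hv u v.
Proof.
move=> uv; have w1 y : (w y < 2) = ~~ (1 < w y) by rewrite -leqNgt.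
apply/edge_compP/orP => [[x [y [xy]]]|].
  rewrite !mnmDE !mnm1E addn_gt0 !lt0b => mx wy; rewrite w1 => hy _.
  have my : (u == y) || (v == y) by have := leq_trans (w0 y) wy; rewrite addn_gt0 !lt0b.
  case/orP: mx my => /eqP Ex /orP[] /eqP Ey; subst x y; rewrite ?(negPf (irr _)) in xy => //.
    by left; rewrite xy.
  by right; rewrite xy.
have d2 : mdeg (U_(u) + U_(v))%MM = 2 by rewrite mdegD !mdeg1.
have le1 y : ~~ (1 < w y) -> w y <= 1 by move=> h; rewrite leqNgt.
case=> /andP[xy hy]; [exists u, v | exists v, u]; rewrite !mnmDE !mnm1E !eqxx w1 hy d2;
  split=> //.
- by apply: leq_trans (le1 _ hy) (leq_addl _ _).
- by rewrite addn_gt0 orbT.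
- by apply: leq_trans (le1 _ hy) (leq_addr _ _).
Qed.

Lemma light_irr x : light e hv x x = false.
Proof. by rewrite /light (negPf (irr x)). Qed.

(** The degree 2 component is the squarefree ideal of the light edges, and
    [acyclic_copath] says for it that the complement of the light graph is
    chordal: the chain through s and the missing edge a b would form a cycle
    in which no vertex of s is joined to both a and b. *)
Lemma no_light_copath (s : seq 'I_n) a b : a != b -> ~~ light e hv a b -> s != [::] ->
    {in s, forall t, light e hv t a || light e hv t b} ->
  path (fun u v => (u != v) && ~~ light e hv u v) a (rcons s b) -> False.
Proof.
move=> ab nab s0 sl pth; pose C := [set x in a :: b :: s].
have sab t : t \in s -> (t != a) && (t != b).
  move=> ts; have := sl t ts; case: eqP => [->|_]; first by rewrite light_irr (negPf nab).
  by case: eqP => [->|//]; rewrite light_irr lightC (negPf nab).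
have CP x : (x \in C) = (x \in a :: b :: s) by rewrite inE.
have aC : a \in C by rewrite CP inE eqxx.
have bC : b \in C by rewrite CP !inE eqxx orbT.
have sC t : t \in s -> t \in C by rewrite CP !inE => ->; rewrite !orbT.
apply: (acyclic_copath (@lin (#|C| - 3) 2) aC bC ab (p := rcons s b)).
- by rewrite light_comp.
- have [t ts] : exists t, t \in s by case: (s) s0 => // t l _; exists t; rewrite inE eqxx.
  have /andP[ta tb] := sab t ts; apply/card_gt2P; exists a, b, t.
  by rewrite aC bC sC // ab eq_sym tb ta.
- move=> t; rewrite CP !inE => /or3P[/eqP->|/eqP->|ts]; rewrite ?eqxx // => ta tb.
  case/orP: (sl t ts) => tl.
    apply: comp_mon_le (_ : comp_mon _ _ (U_(t) + U_(a))%MM); last by rewrite light_comp.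
    by rewrite addmA lem_addr.
  apply: comp_mon_le (_ : comp_mon _ _ (U_(t) + U_(b))%MM); last by rewrite light_comp.
  by rewrite [(U_(a) + _)%MM]addmC addmA lem_addr.
- set r := (fun u v => _); suff W (q : seq 'I_n) u : {subset q <= s} ->
    u \in s \/ (u = a /\ q != [::]) ->
      path (fun u v => (u != v) && ~~ light e hv u v) u (rcons q b) -> path r u (rcons q b).
    by apply: W pth => //; right.
  have ne x y t : t \in s -> t \in [set x; y] -> [set x; y] != [set a; b].
    move=> ts txy; apply: contraTneq txy => ->; rewrite !inE negb_or.
    exact: sab.
  elim: q u => [|v q IH] u qs us /= /andP[/andP[uv nuv]].
    case: us => [us _|[//]]; rewrite /r bC uv light_comp // nuv (ne u b u) ?inE ?eqxx //.
  have vs : v \in s by apply: qs; rewrite inE eqxx.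
  move=> pth'; rewrite {1}/r (sC _ vs) uv light_comp // nuv (ne u v v) ?inE ?eqxx ?orbT //=.
  by apply: IH pth' => //; [move=> z zq; apply: qs; rewrite inE zq orbT | left].
- by rewrite last_rcons.
Qed.

Lemma edges_light_C5 a b c d f : light e hv a b -> light e hv b c -> light e hv c d ->
    light e hv d f -> light e hv f a ->
    ~~ [|| light e hv a c, light e hv a d, light e hv b d, light e hv b f | light e hv c f] ->
      False.
Proof.
move=> ab bc cd df fa /norP[ac /norP[ad /norP[bd /norP[bf cf]]]].
have ac' : a != c by apply: contraNneq ad => ->.
have ad' : a != d by apply: contraNneq ac => ->; rewrite lightC.
have bd' : b != d by apply: contraNneq ad => <-.
have bf' : b != f by apply: contraNneq bd => ->; rewrite lightC.
have cf' : c != f by apply: contraNneq bf => <-.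
apply: (@no_light_copath [:: d; b; f] a c) => //.
  by move=> t; rewrite !inE => /or3P[]/eqP->;
    rewrite ?fa ?bc ?orbT // [light _ _ d c]lightC cd orbT.
by rewrite /= ad' ad eq_sym bd' lightC bd bf' bf eq_sym cf' lightC cf.
Qed.

Lemma edges_light_antiC6 a b c d f g :
    light e hv a c -> light e hv a d -> light e hv a f -> light e hv b d -> light e hv b f ->
    light e hv b g -> light e hv c f -> light e hv c g -> light e hv d g ->
    ~~ [|| light e hv a b, light e hv b c, light e hv c d, light e hv d f,
      light e hv f g | light e hv g a] ->
    False.
Proof.
move=> ac ad af bd bf bg cf cg dg; case/norP=> ab /norP[bc /norP[cd /norP[df /norP[fg ga]]]].
have ab' : a != b by apply: contraNneq bc => <-.
have bc' : b != c by apply: contraNneq cd => <-.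
have cd' : c != d by apply: contraNneq df => <-.
have df' : d != f by apply: contraNneq fg => <-.
have fg' : f != g by apply: contraNneq ga => <-; rewrite lightC.
have ga' : g != a by apply: contraNneq ab => <-; rewrite lightC.
apply: (@no_light_copath [:: g; f; d; c] a b) => //.
  move=> t; rewrite !inE => /or4P[]/eqP->; rewrite ![light _ _ _ a]lightC ![light _ _ _ b]lightC.
  - by rewrite bg orbT.
  - by rewrite af.
  - by rewrite ad.
  - by rewrite ac.
rewrite /= [a == g]eq_sym ga' [light _ _ a g]lightC ga [g == f]eq_sym fg' [light _ _ g f]lightC fg.
rewrite [f == d]eq_sym df' [light _ _ f d]lightC df [d == c]eq_sym cd' [light _ _ d c]lightC cd.
by rewrite [c == b]eq_sym bc' [light _ _ c b]lightC bc.
Qed.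

End EdgeObstructions.

Theorem theorem4p9 (K : fieldType) (n : nat) (D : wo_graph n)
    (chordalD : chordal (underlying D)) :
  (componentwise_linear (edge_ideal K D) <-> vertex_splittable (edge_ideal K D))
  /\
  (vertex_splittable (edge_ideal K D) <-> linear_quotients (edge_ideal K D)).
Proof.
have IE := @edge_idealP K n D.
have irr := dedge_irrefl D; have asym := @dedge_asym _ D; have w0 := weight_gt0 D.
have uC : ssrbool.symmetric (underlying D) by move=> x y; rewrite /underlying orbC.
have uirr : irreflexive (underlying D) by move=> x; rewrite /underlying (negPf (irr x)).
have cl_vs : componentwise_linear (edge_ideal K D) -> vertex_splittable (edge_ideal K D).
  move=> cl; apply: (vertex_splittable_edges _ w0 IE).
  have lin i d : acyclic_mon K i d (comp_mon (edge_gens (dedge D) (weight D)) d).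
    apply/acyclic_monP => f fi fN fd f0.
    have cP p : component (edge_ideal K D) d p <->
        supported (comp_mon (edge_gens (dedge D) (weight D)) d) p.
      exact: componentP IE.
    have J p : component (edge_ideal K D) d p -> ord_ge d p.
      by move/cP => h m /h /comp_monP[u us /and3P[]].
    have [|g [gi gN gE]] := acyclic_of_linear_resolution J (cl d) fi _ fd f0.
      by move=> S; apply/cP.
    by exists g; split=> // S; apply/cP.
  split=> //.
  - exact: chordal_C4.
  - exact: chordal_C5.
  - exact: edges_2K2.
  - exact: edges_heavy_out.
  - exact: edges_heavy_path.
  - exact: edges_light_C5.
  - exact: edges_light_antiC6.
have vs_lq := @vertex_splittable_linear_quotients K n (edge_ideal K D).
have lq_cl := @linear_quotients_componentwise_linear K n (edge_ideal K D).
split; split=> h; [exact: cl_vs | exact/lq_cl/vs_lq | exact: vs_lq | exact/cl_vs/lq_cl].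
Qed.
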